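(* Let $s\in\mathbb N$ and let $\{(\xi_l^{(1)},\dots,\xi_l^{(s)})\}_{l\in\mathbb Z}$ be i.i.d. $\mathbb R^s$-valued random vectors with zero mean (no assumption is made on the dependence among $\xi_l^{(1)},\dots,\xi_l^{(s)}$ for fixed $l$). Let $\{(c_l^{(1)},\dots,c_l^{(s)})\}_{l\in\mathbb Z}$ be vectors in $\mathbb R^s$. Assume: (Reg) $E\big[|\xi_1^{(r)}|^{s\vee 2}\big]<\infty$ for all $1\le r\le s$; (Tail) for some $\alpha_0>1$, with $\alpha_i=\frac{s}{s-i}\alpha_0$ for $i\in\{1,\dots,\lfloor\frac{s-1}{2}\rfloor\}$, $$\max_{\pi\in\mathcal P_s}\ \max_{0\le i\le\lfloor\frac{s-1}{2}\rfloor}\ \sup_{t\ge1}\ t^{\alpha_i}\,P\Big(\prod_{r\in\{\pi(1),\dots,\pi(s-i)\}}|\xi_1^{(r)}|>t\Big)<\infty;$$ (Decay) for each $1\le r\le s$ there is $\sigma_r\in(\frac12,1]$ with $\sup_{l\in\mathbb Z}|l|^{\sigma_r}|c_l^{(r)}|<\infty$. Define $x_k^{(r)}=\sum_{l=-\infty}^{\infty}c_{k-l}^{(r)}\xi_l^{(r)}$ for $k\in\mathbb Z$, $1\le r\le s$, and let $d_k=\prod_{r=1}^s x_k^{(r)}$ and $d=E[d_1]$. Then $$\lim_{n\to\infty}n^{-\frac1p}\sum_{k=1}^n(d_k-d)=0\quad\text{a.s.}$$ for every $p$ satisfying $$0<p<\begin{cases}\dfrac{2}{3-2\sigma_1},&s=1,\\[2mm]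 2\wedge\alpha_0\wedge\dfrac{1}{2-\sigma_1-\sigma_2},&s=2,\\[2mm] \alpha_0\wedge\dfrac{2}{3-2\min_{1\le i\le s}\sigma_i},&s>2.\end{cases}$$ Furthermore, if $\xi_1^{(1)}=\xi_1^{(2)}=\dots=\xi_1^{(s)}$, $\xi_1^{(1)}$ is a symmetric random variable, and $s$ is even, then the same convergence holds for every $p$ satisfying the relaxed constraint $$0<p<2\wedge\alpha_0\wedge\frac{1}{2-\min_{1\le i<j\le s}\{\sigma_i+\sigma_j\}}.$$
   Context: $\mathcal P_s$ denotes the set of permutations of $\{1,\dots,s\}$; $a\vee b=\max\{a,b\}$, $a\wedge b=\min\{a,b\}$. Convention: in an expression $a\wedge\frac1x$ with $a>0$ and $x=0$, the fraction $\frac1x$ is read as $+\infty$ (so $a\wedge\frac10=a$). Under the hypotheses the two-sided series defining $x_k^{(r)}$ converge almost surely. A random variable $X$ is symmetric if $X$ and $-X$ have the same distribution. *)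

(* Defs.v *)
From mathcomp Require Import all_boot all_order perm all_algebra.
From mathcomp Require Import all_classical all_reals all_analysis.

Set Implicit Arguments.
Unset Strict Implicit.
Unset Printing Implicit Defensive.

Import Order.TTheory GRing.Theory Num.Theory.
Import numFieldNormedType.Exports.

Local Open Scope classical_set_scope.
Local Open Scope ring_scope.

Section Probability.
Context (d d' : measure_display) (T : measurableType d) (R : realType)
  (P : probability T R) (T' : measurableType d').

(* Mutual independence: the product rule for every finite subfamily. *)
Definition independent (I : choiceType) (X : I -> {RV P >-> T'}) : Prop :=
  forall (J : seq I) (A : I -> set T'), uniq J ->
    (forall i, measurable (A i)) ->
    P (\bigcap_(i in [set` J]) (X i @^-1` A i)) =
    (\prod_(i <- J) P (X i @^-1` A i))%E.

Definition same_distribution (X Y : T -> T') : Prop :=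
  forall A : set T', measurable A -> P (X @^-1` A) = P (Y @^-1` A).

Definition iid (I : choiceType) (X : I -> {RV P >-> T'}) : Prop :=
  independent X /\ forall i j, same_distribution (X i) (X j).

End Probability.

Definition symmetric_rv (d : measure_display) (T : measurableType d)
    (R : realType) (P : probability T R) (X : T -> R) : Prop :=
  same_distribution P X (fun w => - X w).

(* The two halves of the two-sided series are summed separately, i.e. the two
   truncation bounds go to infinity independently of each other; recall that
   [Negz n] is [- n.+1]. *)
Definition bilateral_sum (R : realType) (u : int -> R) : R :=
  limn (series (fun n : nat => u (Posz n))) +
  limn (series (fun n : nat => u (Negz n))).

Section Model.
Context (d : measure_display) (T : measurableType d) (R : realType)
  (P : probability T R) (s : nat).
Implicit Types (c : int -> 'I_s -> R) (xi : int -> {RV P >-> s.-tuple R}).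

Definition linear_process c xi (k : int) (r : 'I_s) (w : T) : R :=
  bilateral_sum (fun l => c (k - l) r * tnth (xi l w) r).

Definition process_product c xi (k : int) (w : T) : R :=
  \prod_(r < s) linear_process c xi k r w.

Definition normalized_sums_to_0 c xi (p : R) : Prop :=
  {ae P, forall w,
    (fun n : nat => n%:R `^ (- p^-1) *
      \sum_(1 <= k < n.+1) (process_product c xi (Posz k) w
                            - fine 'E_P[process_product c xi 1]))
    @ \oo --> (0 : R)}.

(* For [s > 0] and [i = 0] this is [alpha0]. *)
Definition tail_exponent (alpha0 : R) (i : nat) : R :=
  s%:R / (s - i)%:R * alpha0.

(* The permutation [pi] acts on the 0-based indices ['I_s], so that
   [{pi j | j < s - i}] is the set of the first [s - i] values of [pi]. *)
Definition tail_sup xi (alpha0 : R) (pi : 'S_s) (i : nat) : \bar R :=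
  ereal_sup [set ((t `^ tail_exponent alpha0 i)%:E *
      P [set w | (t < \prod_(j < s | (j < s - i)%N)
                       `|tnth (xi 1%R w) (pi j)|)%R])%E
    | t in `[1, +oo[ ].

Definition tail_condition xi (alpha0 : R) : Prop :=
  (\big[maxe/-oo]_(pi : 'S_s) \big[maxe/-oo]_(0 <= i < (s.-1)./2.+1)
     tail_sup xi alpha0 pi i < +oo)%E.

Definition decay_condition c (sigma : 'I_s -> R) : Prop :=
  forall r : 'I_s,
    (ereal_sup [set (`|l%:~R : R| `^ sigma r * `|c l r|)%R%:E
               | l in [set: int]] < +oo)%E.

End Model.

(* In [\bar R] one has [0^-1 = +oo], which is the value wanted when a sum of
   two of the [sigma]s equals 2; [+oo] is also neutral for [mine], so that the
   iterated [mine] below are genuine minima.  The last case is meant for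
   [s > 2]; the unused value at [s = 0] is arbitrary. *)
Definition p_bound (R : realType) (alpha0 : R) (s : nat) :
    ('I_s -> R) -> \bar R :=
  match s return ('I_s -> R) -> \bar R with
  | 1%N => fun sigma => (2 / (3 - 2 * sigma ord0))%:E
  | 2%N => fun sigma =>
      (mine (mine 2%:E alpha0%:E) (2 - sigma ord0 - sigma ord_max)%:E^-1)%E
  | _ => fun sigma =>
      (mine alpha0%:E
        (2%:E / (3%:E - 2%:E * \big[mine/+oo]_(i < _) (sigma i)%:E)))%E
  end.

Definition p_bound_symmetric (R : realType) (alpha0 : R) (s : nat)
    (sigma : 'I_s -> R) : \bar R :=
  (mine (mine 2%:E alpha0%:E)
    (2%:E - \big[mine/+oo]_(ij : 'I_s * 'I_s | (ij.1 < ij.2)%N)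
               (sigma ij.1 + sigma ij.2)%:E)^-1)%E.

(* Main.v *)
(** Expand [d_k] over index functions [f : 'I_s -> L], where [f r] is the index of
    the innovation used by the [r]-th factor.  Grouping the factors by the fibres
    of [f] writes the term of [f] as a product, over the innovations, of
    independent variables [zeta_B = \prod_(r in B) xi^(r)].  A block [B] is light
    if the regularity condition makes [zeta_B] square integrable; at most one
    fibre of [f] is heavy, and the tail condition gives [zeta_B] a moment of some
    order [q] with [p < q < 2] for heavy [B].

    Truncate the heavy block at the level [M = 2 ^ (m / p)].  The term then splits
    into a light part (with the heavy block replaced by its truncated mean), a
    centred truncated part and a remainder.  The remainder has L1 norm of order
    [M ^ (1 - q)].  In the variance of a sum over a window of length [n], two
    terms are correlated only if their combined fibres have no singleton and meet;
    Cauchy-Schwarz along these matchings bounds the variance of the light part by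
    [n ^ beta] for any [beta < 2 / p] allowed by the decay of the coefficients,
    and that of the centred truncated part by [n * M ^ (2 - q)].  If only fibres
    of even size contribute (symmetric innovations, or [s = 2]), two links between
    the terms are available instead of one, which gives the weaker constraint.

    A Rademacher-Menshov inequality bounds the maximum of the partial sums over
    dyadic blocks, uniformly in a truncation of the two-sided series to finitely
    many innovations.  Fatou's lemma removes this truncation, and the normalized
    maxima are summable over the dyadic scales. *)

Require Import Defs.
From mathcomp Require Import all_boot all_order perm all_algebra.
From mathcomp Require Import all_classical all_reals all_analysis.
From mathcomp Require Import measurable_realfun simple_functions.
From mathcomp Require Import ring lra zify.

Set Implicit Arguments.
Unset Strict Implicit.
Unset Printing Implicit Defensive.

Import Order.TTheory GRing.Theory Num.Theory.
Import numFieldNormedType.Exports.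

Local Open Scope ring_scope.

(** * Weighted sums over index functions *)

Section Combinatorics.
Context (R : realFieldType).

(** The decay condition makes the coefficients square summable but in general not summable, so no
    bound can be taken term by term over index functions: every sum must exploit either vanishing
    correlations or a pairing of coefficients. For the remainder, which need not have a second
    moment, the location and the set of the heavy fibre are frozen; as this fibre has two elements,
    its coefficient is summable over locations, and the light factor that is left is handled by its
    second moment. Subtracting the truncated mean of the heavy block, instead of only truncating,
    forces the heavy fibre of each of two correlated terms to meet the other term. The resulting
    overlaps sum to order [n] over a window by square summability alone, so the rate of decay
    affects the light part only. The level [M = 2 ^ (m / p)] balances the errors: at scale
    [n = 2 ^ m], relative to [n ^ (1 / p)], the remainders add up to order [n ^ (1 - q / p)] and the
    standard deviation of the centred truncated part is the square root of that; both are negative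
    powers since [p < q]. *)

Lemma ler_sum_subset (I : finType) (A B : pred I) (F : I -> R) :
  (forall i, 0 <= F i) -> (forall i, A i -> B i) ->
  \sum_(i | A i) F i <= \sum_(i | B i) F i.
Proof.
move=> F0 AB; rewrite [leRHS](bigID A) /= ler_wpDr ?sumr_ge0//.
rewrite (eq_bigl (fun i => B i && A i)) // => i.
by case Ai: (A i); rewrite ?andbF// AB.
Qed.

Lemma ler_sum_cover (I K : finType) (A : pred I) (C : K -> pred I) (F : I -> R) :
  (forall i, 0 <= F i) -> (forall i, A i -> exists k, C k i) ->
  \sum_(i | A i) F i <= \sum_k \sum_(i | C k i) F i.
Proof.
move=> F0 AC; rewrite (exchange_big_dep predT)//= big_mkcond /= ler_sum// => i _.
have sge0 : 0 <= \sum_(k | C k i) F i by exact: sumr_ge0.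
case: ifP => // Ai; have [k Cki] := AC i Ai.
by rewrite (bigD1 k)//= ler_wpDr// sumr_ge0.
Qed.

Lemma ler_sum_inj (I K : finType) (A : pred I) (B : pred K) (g : I -> K)
    (F : I -> R) (G : K -> R) :
  (forall k, 0 <= G k) -> {in A &, injective g} ->
  (forall i, A i -> B (g i)) -> (forall i, A i -> F i = G (g i)) ->
  \sum_(i | A i) F i <= \sum_(k | B k) G k.
Proof.
move=> G0 ginj AB FG; rewrite (eq_bigr _ FG).
rewrite -(big_imset G ginj) /= ler_sum_subset// => k.
by case/imsetP => i Ai ->; exact: AB.
Qed.

Lemma sum_mul_le (I : finType) (a b : I -> R) (x y : R) :
  0 <= x -> 0 <= y ->
  \sum_i a i ^+ 2 <= x ^+ 2 -> \sum_i b i ^+ 2 <= y ^+ 2 ->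
  \sum_i a i * b i <= x * y.
Proof.
move=> x0 y0 ax bY.
have a0 : x = 0 -> \sum_i a i * b i = 0.
  move=> x00; apply: big1 => i _; move: ax; rewrite x00 expr0n /= => ax.
  have : \sum_i a i ^+ 2 = 0.
    by apply/eqP; rewrite eq_le ax sumr_ge0// => j _; exact: sqr_ge0.
  move/eqP; rewrite psumr_eq0 => [/allP/(_ i)|j _]; last exact: sqr_ge0.
  by rewrite mem_index_enum sqrf_eq0 => /(_ isT)/eqP ->; rewrite mul0r.
have b0 : y = 0 -> \sum_i a i * b i = 0.
  move=> y00; apply: big1 => i _; move: bY; rewrite y00 expr0n /= => bY.
  have : \sum_i b i ^+ 2 = 0.
    by apply/eqP; rewrite eq_le bY sumr_ge0// => j _; exact: sqr_ge0.
  move/eqP; rewrite psumr_eq0 => [/allP/(_ i)|j _]; last exact: sqr_ge0.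
  by rewrite mem_index_enum sqrf_eq0 => /(_ isT)/eqP ->; rewrite mulr0.
move: x0; rewrite le_eqVlt => /predU1P[/esym x00|x0]; first by rewrite a0// mulr_ge0// x00.
move: y0; rewrite le_eqVlt => /predU1P[/esym y00|y0].
  by rewrite b0// mulr_ge0// ?y00// ltW.
have : 0 <= \sum_i (a i * y - b i * x) ^+ 2 by apply: sumr_ge0 => i _; exact: sqr_ge0.
have -> : \sum_i (a i * y - b i * x) ^+ 2 =
    (\sum_i a i ^+ 2) * y ^+ 2 + (\sum_i b i ^+ 2) * x ^+ 2 - 2 * (x * y) * \sum_i a i * b i.
  rewrite !mulr_suml mulr_sumr -sumrN -!big_split /=; apply: eq_bigr => i _; ring.
move=> h; rewrite -(ler_pM2l (mulr_gt0 x0 y0)) -(ler_pM2l (ltr0Sn R 1)).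
have := ler_wpM2r (sqr_ge0 y) ax; have := ler_wpM2r (sqr_ge0 x) bY.
move: h; rewrite mulrA; lra.
Qed.

Section Merge.
Context (L J : finType).
Implicit Types (S A : {set J}) (h : {ffun J -> L}) (w : J -> L -> R).

(** [S] collects the coordinates whose weights are controlled in l1. A coordinate outside [S] has
    only an l2 bound, so it must share its value with another one for the sum to be bounded
    independently of [L]. *)
Definition partnered S h :=
  [forall j, (j \in S) || [exists i, (i != j) && (h i == h j)]].

Definition merged_weight (l0 : L) (a : J) A w (j : J) (l : L) : R :=
  if j == a then \prod_(i in A) w i l
  else if j \in A then (l == l0)%:R else w j l.

(* All coordinates in A are equal on the left, so A can be collapsed to the
   single coordinate a, the others being pinned at the dummy point l0. *)
Lemma sum_merge l0 A a w S (Q : pred {ffun J -> L}) :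
  a \in A -> (forall j l, 0 <= w j l) ->
  (forall h h', (forall j, j \notin A -> h j = h' j) -> Q h = Q h') ->
  \sum_(h | Q h && [forall j in A, h j == h a] && partnered S h)
     \prod_j w j (h j) <=
  \sum_(h | Q h && partnered (S :|: A) h)
     \prod_j merged_weight l0 a A w j (h j).
Proof.
move=> aA w0 QA.
pose g h : {ffun J -> L} := [ffun j => if (j \in A) && (j != a) then l0 else h j].
have gout h j : j \notin A -> g h j = h j by move=> jA; rewrite ffunE (negbTE jA).
have ga h : g h a = h a by rewrite ffunE eqxx andbF.
apply: (@ler_sum_inj _ _ _ _ g).
- move=> h; apply: prodr_ge0 => j _; rewrite /merged_weight.
  by case: ifP => _; [apply: prodr_ge0|case: ifP].
- move=> h h' /andP[/andP[_ /forall_inP hA] _] /andP[/andP[_ /forall_inP hA'] _] ghh'.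
  apply/ffunP => j; have [jA|jA] := boolP (j \in A).
    by rewrite (eqP (hA j jA)) (eqP (hA' j jA)) -ga ghh' ga.
  by rewrite -gout// ghh' gout.
- move=> h /andP[/andP[Qh /forall_inP hA] /forallP pSh]; rewrite (QA (g h) h (gout h)) Qh /=.
  apply/forallP => j; rewrite inE; case: (boolP (j \in S)) => //= jS.
  have [//|jA /=] := boolP (j \in A).
  have := pSh j; rewrite (negbTE jS) /= => /existsP[i /andP[ij /eqP hij]].
  apply/existsP; have [iA|iA] := boolP (i \in A).
    exists a; rewrite ga gout// -(eqP (hA i iA)) hij eqxx andbT.
    by apply: contraNneq jA => <-.
  by exists i; rewrite ij !gout// hij /=.
- move=> h /andP[/andP[Qh /forall_inP hA] _].
  rewrite (bigID [in A]) /= [RHS](bigID [in A]) /=; congr (_ * _); last first.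
    apply: eq_bigr => j jA; rewrite /merged_weight gout// (negbTE jA).
    by case: eqP jA => // ->; rewrite aA.
  rewrite [RHS](bigD1 a aA) /= /merged_weight eqxx ga [X in _ = _ * X]big1 ?mulr1.
    by apply: eq_bigr => j jA; rewrite (eqP (hA j jA)).
  move=> j /andP[jA' ja]; have jA : j \in A by []; rewrite (negbTE ja) jA.
  by rewrite ffunE jA ja /= eqxx.
Qed.

Lemma merged_weight_ge0 l0 A a w : (forall j l, 0 <= w j l) ->
  forall j l, 0 <= merged_weight l0 a A w j l.
Proof.
move=> w0 j l; rewrite /merged_weight.
by case: ifP => _; [apply: prodr_ge0|case: ifP].
Qed.

(** Induction on the number of coordinates outside [S]. Such a [j0] is merged with a partner [i]:
    the product weight has l1 norm at most [kappa i * kappa j0], by Cauchy-Schwarz if [i] is outside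
    [S] and by the sup bound on [w j0] otherwise. Each step costs the choice of [i], hence a factor
    [#|J|]. *)
Lemma sum_partnered S w (kappa : J -> R) :
  (forall j l, 0 <= w j l) -> (forall j, 0 <= kappa j) ->
  (forall j, j \in S -> \sum_l w j l <= kappa j) ->
  (forall j, j \notin S -> \sum_l w j l ^+ 2 <= kappa j ^+ 2) ->
  \sum_(h | partnered S h) \prod_j w j (h j) <=
  (#|J| ^ #|~: S|)%:R * \prod_j kappa j.
Proof.
have [n] := ubnP #|~: S|; elim: n S w kappa => // n IH S w kappa nS w0 k0 kS kNS.
have W0 h : 0 <= \prod_j w j (h j) by exact: prodr_ge0.
have [S0|[j0 j0S]] := set_0Vmem (~: S).
  rewrite S0 cards0 expn0 mul1r.
  apply: (@le_trans _ _ (\sum_(h : {ffun J -> L}) \prod_j w j (h j))); first exact: ler_sum_subset.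
  rewrite -bigA_distr_bigA; apply: ler_prod => j _.
  rewrite sumr_ge0//= kS// -(finset.setCK S) S0 finset.setC0 inE//.
have {}j0S : j0 \notin S by rewrite inE in j0S.
have [l0 _|noL] := pickP L; last first.
  rewrite big1 ?mulr_ge0 ?ler0n ?prodr_ge0// => h _.
  by have := noL (h j0).
pose C (i : J) h := (i != j0) && [forall j in [set i; j0], h j == h i] && partnered S h.
apply: (@le_trans _ _ (\sum_(i : J) \sum_(h : {ffun J -> L} | C i h) \prod_j w j (h j))).
  apply: ler_sum_cover => // h /[dup] pSh /forallP /(_ j0).
  rewrite (negbTE j0S) /= => /existsP[i /andP[ij hij]]; exists i.
  rewrite /C ij pSh andbT /=; apply/forall_inP => j.
  by rewrite !inE => /orP[/eqP ->//|/eqP ->]; rewrite eq_sym.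
apply: (@le_trans _ _ (\sum_(i : J) (#|J| ^ #|~: S|.-1)%:R * \prod_j kappa j)); last first.
  rewrite sumr_const -[_ *+ _]mulr_natl mulrA -natrM -expnS prednK//.
  by rewrite card_gt0; apply/set0Pn; exists j0; rewrite inE.
apply: ler_sum => i _.
have [->|ij] := eqVneq i j0.
  by rewrite big1 ?mulr_ge0 ?prodr_ge0 ?ler0n// => h; rewrite /C eqxx.
pose A := [set i; j0]; have iA : i \in A by rewrite !inE eqxx.
have prodA (F : J -> R) : \prod_(j in A) F j = F i * F j0.
  by rewrite /A big_setU1 ?inE//= big_set1.
apply: (@le_trans _ _ (\sum_(h | partnered (S :|: A) h)
    \prod_j merged_weight l0 i A w j (h j))).
  rewrite /C; under eq_bigl do rewrite ij /=.
  exact: (@sum_merge l0 A i w S xpredT iA w0).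
(* The pinned coordinate [j0] has an indicator weight of sum 1, so [i] alone carries the bound of
   the pair and the product of all bounds is unchanged. *)
pose kappa' j := if j == i then kappa i * kappa j0 else if j \in A then 1 else kappa j.
have card_lt : (#|~: (S :|: A)| <= #|~: S|.-1)%N.
  rewrite -ltnS prednK; last by rewrite card_gt0; apply/set0Pn; exists j0; rewrite inE.
  apply/proper_card/properP; split; first by rewrite finset.setCS finset.subsetUl.
  by exists j0; rewrite !inE ?eqxx ?orbT// negbK.
have prodk : \prod_j kappa' j = \prod_j kappa j.
  rewrite (bigID [in A]) /= [RHS](bigID [in A]) /= !prodA.
  rewrite /kappa' eqxx eq_sym (negbTE ij) !inE eqxx orbT mulr1.
  congr (_ * _); apply: eq_bigr => j; rewrite !inE negb_or => /andP[ji jj0].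
  by rewrite (negbTE ji) (negbTE jj0).
apply: (le_trans (IH _ _ kappa' _ _ _ _ _)) => //.
- by rewrite (leq_ltn_trans card_lt)// -ltnS prednK// card_gt0; apply/set0Pn; exists j0; rewrite inE.
- exact: merged_weight_ge0.
- by move=> j; rewrite /kappa'; case: ifP => _; [rewrite mulr_ge0|case: ifP].
- move=> j; rewrite /kappa' /merged_weight; case: eqP => [_ _|/eqP ji].
    under eq_bigr do rewrite prodA.
    have [iS|iS] := boolP (i \in S); last by apply: sum_mul_le => //; apply: kNS.
    apply: (@le_trans _ _ (\sum_l w i l * kappa j0)).
      apply: ler_sum => l _; apply: ler_wpM2l => //.
      rewrite -(@ler_pXn2r _ 2)// ?nnegrE//; apply: le_trans (kNS _ j0S).
      by rewrite (bigD1 l)//= ler_wpDr// sumr_ge0// => l' _; exact: sqr_ge0.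
    by rewrite -mulr_suml ler_wpM2r// kS.
  rewrite !inE (negbTE ji) orFb; case: eqP => [-> _|jj0].
    by rewrite (bigD1 l0)//= eqxx big1 ?addr0// => l /negbTE ->.
  by rewrite orbF => /kS.
- move=> j; rewrite !inE !negb_or => /and3P[jS ji jj0].
  rewrite /kappa' /merged_weight (negbTE ji) !inE (negbTE ji) (negbTE jj0) /=.
  exact: kNS.
- rewrite prodk ler_wpM2r ?prodr_ge0// ler_nat leq_pexp2l//.
  by apply/card_gt0P; exists j0.
Qed.

(** Merging the whole of [A] at once keeps the actual overlap [K] instead of its Cauchy-Schwarz
    bound; [K] is small when it involves coefficients of distant times. The condition [1 <= kappa]
    allows rounding the remaining product up to [kappa ^+ #|J|]. *)
Lemma sum_linked A a w (kappa K : R) :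
  a \in A -> (forall j l, 0 <= w j l) -> 1 <= kappa -> 0 <= K ->
  (forall j, \sum_l w j l ^+ 2 <= kappa ^+ 2) ->
  \sum_l \prod_(i in A) w i l <= K ->
  \sum_(h : {ffun J -> L} | [forall j in A, h j == h a] && partnered finset.set0 h)
     \prod_j w j (h j) <= (#|J| ^ #|J|)%:R * (K * kappa ^+ #|J|).
Proof.
move=> aA w0 k1 K0 wk wK; have k0 : 0 <= kappa by rewrite (le_trans ler01).
have [l0 _|noL] := pickP L; last first.
  by rewrite big1 ?mulr_ge0 ?ler0n ?exprn_ge0// => h _; have := noL (h a).
have := @sum_merge l0 A a w finset.set0 xpredT aA w0 (fun _ _ _ => erefl).
move=> /le_trans; apply.
pose kappa' j := if j == a then K else if j \in A then 1 else kappa.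
have k'0 j : 0 <= kappa' j by rewrite /kappa'; case: ifP => // _; case: ifP.
apply: (@le_trans _ _ ((#|J| ^ #|~: (finset.set0 :|: A)|)%:R * \prod_j kappa' j)).
  apply: sum_partnered => //; first exact: merged_weight_ge0.
    move=> j; rewrite finset.set0U => jA; rewrite /merged_weight /kappa'.
    case: eqP => // _; rewrite jA (bigD1 l0)//= eqxx big1 ?addr0// => l /negbTE ->//.
  move=> j; rewrite finset.set0U => jA; rewrite /merged_weight /kappa'.
  by case: eqP jA => [->|_ /negbTE ->//]; rewrite aA.
apply: ler_pM => //; first exact: prodr_ge0.
  by rewrite ler_nat leq_pexp2l// ?max_card//; apply/card_gt0P; exists a.
rewrite (bigD1 a)//= {1}/kappa' eqxx ler_wpM2l//.
apply: (@le_trans _ _ (\prod_(j | j != a) kappa)).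
  by apply: ler_prod => j /negbTE ja; rewrite k'0 /kappa' ja /=; case: ifP.
rewrite prodr_const ler_weXn2l// max_card//.
Qed.

Lemma sum_linked2 A (B : {set J}) a b w (kappa K K' : R) :
  a \in A -> b \in B -> [disjoint A & B] ->
  (forall j l, 0 <= w j l) -> 1 <= kappa -> 0 <= K -> 0 <= K' ->
  (forall j, \sum_l w j l ^+ 2 <= kappa ^+ 2) ->
  \sum_l \prod_(i in A) w i l <= K ->
  \sum_l \prod_(i in B) w i l <= K' ->
  \sum_(h : {ffun J -> L} | [&& [forall j in A, h j == h a], [forall j in B, h j == h b]
             & partnered finset.set0 h])
     \prod_j w j (h j) <= (#|J| ^ #|J|)%:R * (K * K' * kappa ^+ #|J|).
Proof.
move=> aA bB AB w0 k1 K0 K'0 wk wK wK'.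
have k0 : 0 <= kappa by rewrite (le_trans ler01).
have [l0 _|noL] := pickP L; last first.
  by rewrite big1 ?mulr_ge0 ?ler0n ?exprn_ge0// => h _; have := noL (h a).
have nBA j : j \in B -> j \notin A.
  by move=> jB; apply: contraTN jB => jA; rewrite (disjointFr AB).
have bA : b \notin A := nBA b bB.
have ab : (b == a) = false by apply: contraNF bA => /eqP ->.
(* The constraint on [B] reads only coordinates outside [A], so it survives the merge of [A] and is
   available for a second merge. *)
pose Q (h : {ffun J -> L}) := [forall j in B, h j == h b].
have Qcongr h h' : (forall j, j \notin A -> h j = h' j) -> Q h = Q h'.
  move=> hh'; apply: eq_forallb_in => j jB.
  by rewrite !hh'// nBA.
rewrite (eq_bigl (fun h => Q h && [forall j in A, h j == h a] && partnered finset.set0 h));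
  last by move=> h; rewrite andbA; congr (_ && _); rewrite andbC.
have := @sum_merge l0 A a w finset.set0 Q aA w0 Qcongr.
move=> /le_trans; apply; rewrite finset.set0U.
set w' := merged_weight l0 a A w.
have w'0 := merged_weight_ge0 l0 A a w0 : forall j l, 0 <= w' j l.
have w'B j l : j \in B -> w' j l = w j l.
  move=> jB; rewrite /w' /merged_weight (negbTE (nBA j jB)); case: eqP => // ja.
  by have := nBA j jB; rewrite ja aA.
have := @sum_merge l0 B b w' A xpredT bB w'0 (fun _ _ _ => erefl).
move=> /le_trans; apply.
pose kappa' j := if j == b then K' else if j \in B then 1
                 else if j == a then K else if j \in A then 1 else kappa.
have k'0 j : 0 <= kappa' j by rewrite /kappa'; do 4?case: ifP => //.
apply: (@le_trans _ _ ((#|J| ^ #|~: (A :|: B)|)%:R * \prod_j kappa' j)).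
  apply: sum_partnered => //; first exact: merged_weight_ge0.
    move=> j; rewrite inE /merged_weight /kappa' => jAB.
    case: eqP => _; first by under eq_bigr do under eq_bigr do rewrite w'B//.
    case: ifPn jAB => [_ _|jB]; first by rewrite (bigD1 l0)//= eqxx big1 ?addr0// => l /negbTE ->.
    rewrite orbF => jA; rewrite /w' /merged_weight; case: eqP => // _; rewrite jA.
    by rewrite (bigD1 l0)//= eqxx big1 ?addr0// => l /negbTE ->//.
  move=> j; rewrite inE negb_or /merged_weight /kappa' => /andP[jA jB].
  case: eqP jB => [->|_ jB]; first by rewrite bB.
  rewrite (negbTE jB) /w' /merged_weight (negbTE jA).
  by case: eqP jA => [->|//]; rewrite aA.
apply: ler_pM => //; first exact: prodr_ge0.
  by rewrite ler_nat leq_pexp2l// ?max_card//; apply/card_gt0P; exists a.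
rewrite (bigD1 a)//= (bigD1 b)/=; last by rewrite ab.
rewrite {1}/kappa' eq_sym ab eqxx {1}/kappa' eqxx.
have -> : a \in B = false by apply: contraTF aA => /nBA.
rewrite mulrA ler_wpM2l ?mulr_ge0//.
apply: (@le_trans _ _ (\prod_(j | (j != a) && (j != b)) kappa)).
  apply: ler_prod => j /andP[/negbTE ja /negbTE jb]; rewrite k'0 /kappa' ja jb /=.
  by case: ifP => //; case: ifP.
by rewrite prodr_const ler_weXn2l// max_card.
Qed.

End Merge.
End Combinatorics.

(** * Power sums and discrete convolutions *)

Section PowerSums.
Context (R : realType).
Implicit Types (a b : R) (h l : int) (i m n : nat).

(** A discrete derivative of the power function: take exponentials in
    [ln i + 1 / (i + 1) <= ln (i + 1)]. It drives both power sum estimates below. *)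
Lemma powR_succ b i : 0 <= b -> (0 < i)%N ->
  i%:R `^ b * (1 + b / i.+1%:R) <= i.+1%:R `^ b.
Proof.
move=> b0 i0; have ip : (0 : R) < i%:R by rewrite ltr0n.
have ip1 : (0 : R) < i.+1%:R by rewrite ltr0n.
have lnstep : ln (i%:R : R) + i.+1%:R^-1 <= ln i.+1%:R.
  have h1 : -1 < - (i.+1%:R : R)^-1.
    by rewrite ltrN2 invf_lt1// ltr1n.
  have := le_ln1Dx h1.
  have -> : 1 + - (i.+1%:R : R)^-1 = i%:R / i.+1%:R.
    have ne : (i.+1%:R : R) != 0 by rewrite gt_eqF.
    by apply: (mulIf ne); rewrite mulrDl mul1r mulNr mulVf// divfK// -natr1 addrK.
  by rewrite ln_div ?posrE// lerBlDr [leRHS]addrC lerBrDr.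
rewrite /powR !gt_eqF//.
apply: (@le_trans _ _ (expR (b * ln i%:R) * expR (b / i.+1%:R))).
  by rewrite ler_wpM2l ?expR_ge0// expR_ge1Dx.
by rewrite -expRD ler_expR -mulrDr ler_wpM2l.
Qed.

Lemma sum_powR_le a n : 0 < a < 1 ->
  \sum_(i < n) i.+1%:R `^ (- a) <= 2 / (1 - a) * n%:R `^ (1 - a).
Proof.
move=> /andP[a0 a1]; have b0 : 0 < 1 - a by lra.
elim: n => [|n IH]; first by rewrite big_ord0 mulr_ge0// ?powR_ge0// divr_ge0//; lra.
rewrite big_ord_recr /=; case: n IH => [_|n IH].
  rewrite big_ord0 add0r !powR1 mulr1 ler_pdivlMr//; lra.
apply: (le_trans (lerD IH (lexx _))).
have np : (0 : R) < n.+1%:R by rewrite ltr0n.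
have np2 : (0 : R) < n.+2%:R by rewrite ltr0n.
have := @powR_succ (1 - a) n.+1 (ltW b0) isT.
(* [powR_succ] bounds the increment of the right-hand side from below in terms of [x], while the new
   term is [y / n.+2%:R]; the factor 2 in the constant absorbs [y <= 2 * x]. *)
set x := n.+1%:R `^ (1 - a); set y := n.+2%:R `^ (1 - a) => xy.
have x2 : y / 2 <= x.
  rewrite /x /y ler_pdivrMr//; apply: (@le_trans _ _ ((n.+1%:R * 2) `^ (1 - a))).
    apply: ge0_ler_powR; rewrite ?nnegrE ?mulr_ge0 ?(ltW np2) ?(ltW b0)//.
    by rewrite -natrM ler_nat; lia.
  rewrite powRM ?(ltW np)// ler_wpM2l ?powR_ge0//.
  by rewrite ler1_powR ?ler1n//; lra.
have -> : (n.+2%:R : R) `^ (- a) = y / n.+2%:R.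
  rewrite /y -{3}(powRr1 (ltW np2)) -powRB; last by rewrite (gt_eqF np2) implybT.
  by congr (_ `^ _); lra.
have ba : 2 / (1 - a) * y - 2 / (1 - a) * x - y / n.+2%:R =
   2 / (1 - a) * (y - x * (1 + (1 - a) / n.+2%:R)) + 2 * (x - y / 2) / n.+2%:R.
  by field; rewrite !gt_eqF.
rewrite -subr_ge0; have -> : forall u v w : R, u - (v + w) = u - v - w by move=> *; lra.
by rewrite ba addr_ge0// ?mulr_ge0// ?invr_ge0 ?subr_ge0 ?(ltW b0)// ltW.
Qed.

Lemma sum_powR_tail b n m : 1 < b -> (0 < n)%N ->
  \sum_(n <= i < m) i.+1%:R `^ (- b) <= (b - 1)^-1 * n%:R `^ (1 - b).
Proof.
move=> b1 n0; have b0 : 0 < b - 1 by lra.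
have [mn|nm] := leqP m n.
  by rewrite big_geq// mulr_ge0 ?powR_ge0// invr_ge0 ltW.
suff : \sum_(n <= i < m) i.+1%:R `^ (- b) <=
    (b - 1)^-1 * n%:R `^ (1 - b) - (b - 1)^-1 * m%:R `^ (1 - b).
  move=> /le_trans; apply; rewrite lerBlDr lerDl mulr_ge0 ?powR_ge0// invr_ge0 ltW//.
rewrite -mulrBr -(opprB (m%:R `^ _)).
rewrite -(telescope_sumr (fun i => i%:R `^ (1 - b)) (ltnW nm)).
rewrite -sumrN mulr_sumr big_nat_cond [leRHS]big_nat_cond.
apply: ler_sum => i /andP[/andP[ni _] _].
have i0 : (0 < i)%N by exact: leq_trans ni.
have ip : (0 : R) < i%:R by rewrite ltr0n.
have ip1 : (0 : R) < i.+1%:R by rewrite ltr0n.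
have := powR_succ (ltW b0) i0.
have -> : 1 - b = - (b - 1) by lra.
rewrite !powRN; set x := i%:R `^ _; set y := i.+1%:R `^ (b - 1) => xy.
have x0 : 0 < x by rewrite powR_gt0.
have y0 : 0 < y by rewrite powR_gt0.
have -> : i.+1%:R `^ b = y * i.+1%:R.
  by rewrite mulrC mulr_powRB1 ?ltW//; lra.
rewrite -subr_ge0.
have -> : (b - 1)^-1 * - (y^-1 - x^-1) - (y * i.+1%:R)^-1 =
  (y - x * (1 + (b - 1) / i.+1%:R)) / (x * y * (b - 1)).
  by field; rewrite !gt_eqF.
by rewrite divr_ge0 ?subr_ge0// ltW// !mulr_gt0.
Qed.

(** An absolute value is attained by at most two integers. *)
Lemma sum_absz_le (S : seq int) (g : nat -> R) n :
  uniq S -> (forall l, l \in S -> (`|l| < n)%N) -> (forall i, 0 <= g i) ->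
  \sum_(l <- S) g `|l|%N <= 2 * \sum_(i < n) g i.
Proof.
move=> uS Sn g0.
have -> : \sum_(l <- S) g `|l|%N = \sum_(i < n) \sum_(l <- S | `|l|%N == i) g i.
  rewrite (exchange_big_dep xpredT)//= big_seq [RHS]big_seq.
  apply: eq_bigr => l lS; rewrite (bigD1 (Ordinal (Sn l lS)))//= big1 ?addr0//.
  move=> i /andP[/eqP li ni]; exfalso; move/negP: ni; apply.
  by apply/eqP/val_inj; rewrite /= li.
rewrite mulr_sumr ler_sum// => i _.
rewrite big_const_seq iter_addr_0 -[_ *+ count _ _]mulr_natl ler_wpM2r// ler_nat.
rewrite -size_filter -[2%N]/(size [:: i%:Z; - i%:Z]).
apply: uniq_leq_size; first exact: filter_uniq.
by move=> l; rewrite mem_filter !inE => /andP[/eqP li _]; lia.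
Qed.

Lemma absz_bounded (S : seq int) : exists n, forall l, l \in S -> (`|l| < n)%N.
Proof.
exists (\max_(l <- S) `|l|).+1 => l lS; rewrite ltnS.
exact: (@leq_bigmax_seq _ S xpredT (fun l : int => `|l|%N)).
Qed.

(** The shift by one makes negative powers meaningful at [l = 0]. *)
Definition brak (l : int) : R := `|l|.+1%:R.

Lemma brak_gt0 l : 0 < brak l. Proof. by rewrite ltr0n. Qed.

Lemma brak_ge1 l : 1 <= brak l. Proof. by rewrite ler1n. Qed.

Lemma sum_brak_le b : 1 < b -> exists2 C, 0 < C &
  forall S, uniq S -> \sum_(l <- S) brak l `^ (- b) <= C.
Proof.
move=> b1; have b0 : 0 < (b - 1)^-1 by rewrite invr_gt0; lra.
exists (2 * (1 + (b - 1)^-1)) => [|S uS]; first by rewrite mulr_gt0// addr_gt0.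
have [n Sn] := absz_bounded S.
apply: le_trans (sum_absz_le uS Sn (fun i => powR_ge0 i.+1%:R (- b))) _.
rewrite ler_wpM2l//.
rewrite -(big_mkord xpredT (fun i => i.+1%:R `^ (- b))).
case: n {Sn} => [|n]; first by rewrite big_geq// addr_ge0// ltW.
rewrite big_nat_recl// powR1 lerD2l.
rewrite -(big_add1 _ _ 0 n.+1 xpredT (fun i => i.+1%:R `^ (- b))).
by apply: le_trans (sum_powR_tail _ b1 (ltnSn 0)) _; rewrite powR1 mulr1.
Qed.

Lemma powR_half b (u v : R) : 0 <= b <= 1 -> 0 < u -> 0 < v -> v <= 2 * u ->
  u `^ (- b) <= 2 * v `^ (- b).
Proof.
move=> /andP[b0 b1] u0 v0 vu; rewrite !powRN ler_pdivlMr ?powR_gt0//.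
rewrite mulrC ler_pdivrMr ?powR_gt0//.
apply: (@le_trans _ _ ((2 * u) `^ b)).
  by apply: ge0_ler_powR; rewrite ?nnegrE ?mulr_ge0// ltW.
by rewrite powRM ?(ltW u0)// ler_wpM2r ?powR_ge0// ler1_powR// ler1n.
Qed.

(** On the half where [l] is closer to 0 than [l + h], the second factor is at most twice
    [brak h ^ (- b)] while [|l| <= |h|]; beyond that the product is at most [brak l ^ (- (a + b))],
    a summable power. The other half reduces to this one by the shift [l + h]. *)
Lemma sum_brak_conv_half a b : 0 < a < 1 -> 0 < b < 1 -> 1 < a + b ->
  exists2 C, 0 < C & forall S h, uniq S ->
  \sum_(l <- S | (`|l| <= `|(l + h)%R|)%N) brak l `^ (- a) * brak (l + h) `^ (- b)
    <= C * brak h `^ (1 - a - b).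
Proof.
move=> a01 b01 ab; have ab0 : 0 < (a + b - 1)^-1 by rewrite invr_gt0; lra.
have a0 : 0 < 2 / (1 - a) by rewrite divr_gt0//; lra.
exists (2 * (2 * (2 / (1 - a)) + (a + b - 1)^-1)) => [|S h uS].
  by rewrite mulr_gt0// addr_gt0// mulr_gt0.
have [n Sn] := absz_bounded S.
set H := `|h|.+1.
pose g i : R := if (i < H)%N then 2 * H%:R `^ (- b) * i.+1%:R `^ (- a)
           else i.+1%:R `^ (- (a + b)).
have g0 i : 0 <= g i.
  by rewrite /g; case: ifP => _; rewrite ?mulr_ge0 ?powR_ge0.
have H0 : (0 : R) < H%:R by rewrite ltr0n.
apply: (@le_trans _ _ (\sum_(l <- S) g `|l|%N)).
  rewrite big_mkcond; apply: ler_sum => l _; case: ifP => // lh.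
  rewrite /g; case: ifP => lH.
    rewrite mulrC ler_wpM2r ?powR_ge0//; apply: powR_half => //.
      by case/andP: b01 => /ltW-> /ltW.
    by rewrite /brak -natrM ler_nat /H; lia.
  rewrite opprD powRD; last by rewrite pnatr_eq0 implybT.
  rewrite ler_wpM2l ?powR_ge0// !powRN lef_pV2 ?posrE ?powR_gt0 ?brak_gt0//.
  apply: ge0_ler_powR; rewrite ?nnegrE ?ler0n//; first by case/andP: b01 => /ltW.
  by rewrite ler_nat.
apply: le_trans (sum_absz_le uS Sn g0) _.
rewrite -[leRHS]mulrA ler_wpM2l//.
have HH : (H%:R : R) `^ (1 - a - b) = H%:R `^ (1 - a) * H%:R `^ (- b).
  by rewrite -powRD // pnatr_eq0 implybT.
have HH' : (H%:R : R) `^ (1 - a - b) = H%:R `^ (1 - (a + b)).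
  by congr (_ `^ _); lra.
apply: (@le_trans _ _ (\sum_(i < H) 2 * H%:R `^ (- b) * i.+1%:R `^ (- a) +
   \sum_(H <= i < n) i.+1%:R `^ (- (a + b)))).
  rewrite -(big_mkord xpredT g) -(big_mkord xpredT (fun i => 2 * H%:R `^ (- b) * i.+1%:R `^ (- a))).
  have [nH|Hn] := leqP n H.
    rewrite [X in _ <= _ + X]big_geq// addr0 [leRHS](big_cat_nat (leq0n _) nH)//= ler_wpDr//.
      by rewrite sumr_ge0// => i _; rewrite !mulr_ge0 ?powR_ge0.
    rewrite big_nat_cond [leRHS]big_nat_cond ler_sum// => i /andP[/andP[_ iN] _].
    by rewrite /g (leq_trans iN nH).
  rewrite (big_cat_nat (leq0n _) (ltnW Hn))//= lerD//.
    rewrite big_nat_cond [leRHS]big_nat_cond ler_sum// => i /andP[/andP[_ iN] _].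
    by rewrite /g iN.
  rewrite big_nat_cond [leRHS]big_nat_cond ler_sum// => i /andP[/andP[iN _] _].
  by rewrite /g ltnNge iN.
rewrite [leRHS]mulrDl lerD//.
  rewrite -mulr_sumr /brak -/H HH -mulrA -[leRHS]mulrA ler_wpM2l//.
  rewrite mulrA [leRHS]mulrC ler_wpM2l ?powR_ge0// .
  exact: sum_powR_le.
by rewrite HH' sum_powR_tail.
Qed.

Lemma sum_brak_conv a b : 0 < a < 1 -> 0 < b < 1 -> 1 < a + b ->
  exists2 C, 0 < C & forall S h, uniq S ->
  \sum_(l <- S) brak l `^ (- a) * brak (l + h) `^ (- b)
    <= C * brak h `^ (1 - a - b).
Proof.
move=> a01 b01 ab.
have [C C0 HC] := sum_brak_conv_half a01 b01 ab.
have [D D0 HD] := sum_brak_conv_half b01 a01 (eq_rect _ (fun x => 1 < x) ab _ (addrC a b)).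
exists (C + D) => [|S h uS]; first exact: addr_gt0.
rewrite (bigID (fun l => (`|l| <= `|(l + h)%R|)%N)) /= mulrDl lerD ?HC//.
have uS' : uniq [seq (l + h)%R | l <- S] by rewrite map_inj_uniq// => x y /addIr.
have := HD _ (- h) uS'; rewrite big_map.
have -> : brak (- h) = brak h by rewrite /brak abszN.
have -> : 1 - b - a = 1 - a - b by lra.
apply: le_trans; rewrite big_mkcond [leRHS]big_mkcond ler_sum// => l _.
rewrite addrK -ltnNge mulrC; case: ifP => [/ltnW ->//|_].
by case: ifP => // _; rewrite mulr_ge0 ?powR_ge0.
Qed.

(* Variance of a stationary process with covariance of order |h|^(b - 2). *)
Lemma sum_brak_window b : 1 < b < 2 -> exists2 C, 0 < C & forall m n,
  \sum_(m <= k < m + n) \sum_(m <= k' < m + n) brak (k%:Z - k'%:Z) `^ (b - 2)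
    <= C * n%:R `^ b.
Proof.
move=> /andP[b1 b2].
exists (2 * (2 / (b - 1))) => [|m n]; first by rewrite mulr_gt0// divr_gt0//; lra.
have [->|n0] := posnP n.
  by rewrite addn0 big_geq// mulr_ge0 ?powR_ge0// mulr_ge0// divr_ge0//; lra.
apply: (@le_trans _ _ (\sum_(m <= k < m + n) 2 * (2 / (b - 1)) * n%:R `^ (b - 1))).
  rewrite big_nat_cond [leRHS]big_nat_cond; apply: ler_sum => k /andP[/andP[mk kmn] _].
  have uS : uniq [seq k%:Z - k'%:Z | k' <- index_iota m (m + n)].
    by rewrite map_inj_uniq ?iota_uniq// => x y /addrI/oppr_inj[].
  have := @sum_absz_le _ (fun i => i.+1%:R `^ (b - 2)) n uS _ (fun i => powR_ge0 _ _).
  rewrite big_map => /(_ _)/le_trans; apply.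
    by move=> l /mapP[k']; rewrite mem_index_iota => ? ->; lia.
  rewrite -mulrA ler_wpM2l//.
  have := @sum_powR_le (2 - b) n; rewrite opprB => /(_ _)/le_trans; apply.
    by apply/andP; split; lra.
  by have -> : 1 + (b - 2) = b - 1 by lra.
rewrite big_const_nat iter_addr_0 addKn -[leLHS]mulr_natl mulrC -[leLHS]mulrA ler_wpM2l//.
  by rewrite mulr_ge0// divr_ge0//; lra.
by rewrite mulrC mulr_powRB1//; lra.
Qed.

End PowerSums.

(** * Pairs of index functions *)

Section Fibres.
Context (s : nat) (L : finType).
Implicit Types (f g : {ffun 'I_s -> L}) (l : L) (B : {set 'I_s}).

Definition fibre f l : {set 'I_s} := [set r | f r == l].

(* A block is heavy when the second moment of the corresponding product of
   innovations is not controlled by the moments of order max(s, 2). *)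
Definition heavy B := (1 < #|B|)%N && (s < 2 * #|B|)%N.

(** A combined fibre of size 1 contributes a single centred coordinate as an independent factor, so
    the mixed moment of the two terms vanishes. *)
Definition no_singleton f g := [forall l, (#|fibre f l| + #|fibre g l| != 1)%N].

Definition linked f g := [exists r, exists r', f r == g r'].

Lemma sum_card_fibre f : (\sum_l #|fibre f l|)%N = s.
Proof.
rewrite -[RHS]card_ord -sum1_card (partition_big f xpredT)//=.
by apply: eq_bigr => l _; rewrite -sum1_card; apply: eq_bigl => r; rewrite inE.
Qed.

(** Two heavy fibres would contain more than [s] indices together. *)
Lemma heavy_unique f l l' : heavy (fibre f l) -> heavy (fibre f l') -> l = l'.
Proof.
move=> /andP[_ hl] /andP[_ hl']; apply/eqP; apply: contraT => ll'.
have := sum_card_fibre f; rewrite (bigD1 l)//= (bigD1 l')/=; last by rewrite eq_sym.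
move: hl hl'; move: (\sum_(_ | _) _)%N #|fibre f l| #|fibre f l'| => a b c; lia.
Qed.

(** Two index functions become one function on the disjoint union, to which the merging lemmas
    apply. *)
Definition pair_ffun f g : {ffun 'I_s + 'I_s -> L} :=
  [ffun j => match j with inl r => f r | inr r => g r end].

Lemma no_singletonP f g : no_singleton f g -> partnered finset.set0 (pair_ffun f g).
Proof.
move=> /forallP ns; apply/forallP => j; rewrite inE /=.
apply/existsP.
case: j => r.
  have := ns (f r).
  have rf : r \in fibre f (f r) by rewrite inE.
  rewrite (cardsD1 r) rf /= add1n addSn eqSS addn_eq0 negb_and !cards_eq0.
  case/orP => /set0Pn[r']; rewrite !inE.
    by move=> /andP[rr' fr']; exists (inl r'); rewrite !ffunE (inj_eq (@inl_inj _ _)) rr'.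
  by move=> gr'; exists (inr r'); rewrite !ffunE gr' andbT.
have := ns (g r).
have rg : r \in fibre g (g r) by rewrite inE.
rewrite addnC (cardsD1 r) rg /= add1n addSn eqSS addn_eq0 negb_and !cards_eq0.
case/orP => /set0Pn[r']; rewrite !inE.
  by move=> /andP[rr' fr']; exists (inr r'); rewrite !ffunE (inj_eq (@inr_inj _ _)) rr'.
by move=> gr'; exists (inl r'); rewrite !ffunE gr' andbT.
Qed.

End Fibres.

(** * Sums over correlated pairs of index functions *)

Section PairSums.
Context (R : realFieldType) (s : nat) (L : finType).
Context (u v : 'I_s -> L -> R) (kappa : R).
Context (u0 : forall r l, 0 <= u r l) (v0 : forall r l, 0 <= v r l)
  (k1 : 1 <= kappa)
  (uk : forall r, \sum_l u r l ^+ 2 <= kappa ^+ 2)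
  (vk : forall r, \sum_l v r l ^+ 2 <= kappa ^+ 2).
Implicit Types (f g : {ffun 'I_s -> L}) (l : L).
Local Notation J := ('I_s + 'I_s)%type.

Definition pair_weight (j : J) (l : L) : R :=
  match j with inl r => u r l | inr r => v r l end.

Definition pair_sum (adm : rel {ffun 'I_s -> L}) : R :=
  \sum_f \sum_(g | adm f g) (\prod_r u r (f r)) * \prod_r v r (g r).

Lemma pair_weight_ge0 j l : 0 <= pair_weight j l.
Proof. by case: j => r; [exact: u0|exact: v0]. Qed.

Lemma pair_weight_sq j : \sum_l pair_weight j l ^+ 2 <= kappa ^+ 2.
Proof. by case: j => r; [exact: uk|exact: vk]. Qed.

Lemma pair_sum_le (adm : rel {ffun 'I_s -> L}) (Q : pred {ffun J -> L}) :
  (forall f g, adm f g -> Q (pair_ffun f g)) ->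
  pair_sum adm <= \sum_(h : {ffun J -> L} | Q h) \prod_j pair_weight j (h j).
Proof.
move=> admQ; rewrite /pair_sum pair_big_dep /=.
apply: (@ler_sum_inj _ _ _ _ _ (fun fg => pair_ffun fg.1 fg.2)).
- by move=> h; apply: prodr_ge0 => j _; exact: pair_weight_ge0.
- move=> [f g] [f' g'] _ _ /= /ffunP H; congr (_, _); apply/ffunP => r.
    by have := H (inl r); rewrite !ffunE.
  by have := H (inr r); rewrite !ffunE.
- by move=> [f g] /= /admQ.
- move=> [f g] _ /=; rewrite big_sumType /=; congr (_ * _).
    by apply: eq_bigr => r _; rewrite ffunE.
  by apply: eq_bigr => r _; rewrite ffunE.
Qed.

Definition pair_const : R := (#|{: J}| ^ #|{: J}|)%:R * kappa ^+ #|{: J}|.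

Lemma pair_const_ge0 : 0 <= pair_const.
Proof. by rewrite mulr_ge0// exprn_ge0// (le_trans ler01). Qed.

Definition overlap (A : {set J}) : R := \sum_l \prod_(i in A) pair_weight i l.

Lemma overlap_ge0 A : 0 <= overlap A.
Proof.
by apply: sumr_ge0 => l _; apply: prodr_ge0 => j _; exact: pair_weight_ge0.
Qed.

Lemma sum_one_link (A : {set J}) a : a \in A ->
  \sum_(h : {ffun J -> L} | [forall j in A, h j == h a] && partnered finset.set0 h)
     \prod_j pair_weight j (h j) <= pair_const * overlap A.
Proof.
move=> aA; have := @sum_linked R L _ A a pair_weight kappa (overlap A) aA
  pair_weight_ge0 k1 (overlap_ge0 A) pair_weight_sq (lexx _).
by move=> /le_trans; apply; rewrite /pair_const mulrA mulrAC.
Qed.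

Lemma sum_two_links (A B : {set J}) a b :
  a \in A -> b \in B -> [disjoint A & B] ->
  \sum_(h : {ffun J -> L} | [&& [forall j in A, h j == h a],
        [forall j in B, h j == h b] & partnered finset.set0 h])
     \prod_j pair_weight j (h j) <= pair_const * (overlap A * overlap B).
Proof.
move=> aA bB AB; have := @sum_linked2 R L _ A B a b pair_weight kappa (overlap A)
  (overlap B) aA bB AB pair_weight_ge0 k1 (overlap_ge0 A) (overlap_ge0 B)
  pair_weight_sq (lexx _) (lexx _).
by move=> /le_trans; apply; rewrite /pair_const mulrA mulrAC.
Qed.

(** The bounds are kept separate for each coordinate: convergence in mean of the finite products
    relies on the gain from a single small coordinate. *)
Lemma pair_sum_no_singleton (ku kv : 'I_s -> R) :
  (forall r, 0 <= ku r) -> (forall r, 0 <= kv r) ->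
  (forall r, \sum_l u r l ^+ 2 <= ku r ^+ 2) ->
  (forall r, \sum_l v r l ^+ 2 <= kv r ^+ 2) ->
  pair_sum (@no_singleton s L) <=
  (#|{: J}| ^ #|{: J}|)%:R * ((\prod_r ku r) * \prod_r kv r).
Proof.
move=> ku0 kv0 uku vkv.
apply: (le_trans (@pair_sum_le _ (partnered finset.set0) _)).
  by move=> f g; exact: no_singletonP.
have := @sum_partnered R L J finset.set0 pair_weight
  (fun j => match j with inl r => ku r | inr r => kv r end) pair_weight_ge0.
rewrite finset.setC0 cardsT big_sumType /=; apply.
- by case=> r; [exact: ku0|exact: kv0].
- by move=> j; rewrite inE.
- by case=> r _; [exact: uku|exact: vkv].
Qed.

Lemma pair_sum_cover (K : finType) (adm : rel {ffun 'I_s -> L})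
    (C : K -> pred {ffun J -> L}) :
  (forall f g, adm f g -> exists k, C k (pair_ffun f g)) ->
  pair_sum adm <=
    \sum_k \sum_(h : {ffun J -> L} | C k h) \prod_j pair_weight j (h j).
Proof.
move=> admC.
apply: le_trans (@pair_sum_le adm (fun h => [exists k, C k h]) _) _.
  by move=> f g /admC[k Ck]; apply/existsP; exists k.
apply: ler_sum_cover => [h|h /existsP//].
by apply: prodr_ge0 => j _; exact: pair_weight_ge0.
Qed.

Lemma overlap2 r r' : overlap [set inl r; inr r'] = \sum_l u r l * v r' l.
Proof. by apply: eq_bigr => l _; rewrite big_setU1 ?inE//= big_set1. Qed.

Lemma overlap3l r1 r2 r' : r1 != r2 ->
  overlap [set inl r1; inl r2; inr r'] = \sum_l u r1 l * u r2 l * v r' l.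
Proof.
move=> r12; apply: eq_bigr => l _; rewrite -finset.setUA big_setU1 /=; last first.
  by rewrite !inE (inj_eq (@inl_inj _ _)) (negbTE r12).
by rewrite big_setU1 ?inE//= big_set1 mulrA.
Qed.

Lemma overlap3r r r1' r2' : r1' != r2' ->
  overlap [set inl r; inr r1'; inr r2'] = \sum_l u r l * (v r1' l * v r2' l).
Proof.
move=> r12; apply: eq_bigr => l _; rewrite -finset.setUA big_setU1 /=; last by rewrite !inE.
by rewrite big_setU1 /= ?big_set1// !inE (inj_eq (@inr_inj _ _)) (negbTE r12).
Qed.

Lemma overlap4 r1 r2 r1' r2' : r1 != r2 -> r1' != r2' ->
  overlap [set inl r1; inl r2; inr r1'; inr r2'] =
  \sum_l u r1 l * u r2 l * (v r1' l * v r2' l).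
Proof.
move=> r12 r12'; apply: eq_bigr => l _; rewrite -!finset.setUA big_setU1 /=; last first.
  by rewrite !inE (inj_eq (@inl_inj _ _)) (negbTE r12).
rewrite big_setU1 /=; last by rewrite !inE.
rewrite big_setU1 /=; last by rewrite !inE (inj_eq (@inr_inj _ _)) (negbTE r12').
by rewrite big_set1 !mulrA.
Qed.

Lemma pair_sum_linked :
  pair_sum (fun f g => no_singleton f g && linked f g) <=
  pair_const * \sum_r \sum_r' \sum_l u r l * v r' l.
Proof.
rewrite pair_bigA mulr_sumr /=.
pose A (k : 'I_s * 'I_s) : {set J} := [set inl k.1; inr k.2].
pose C (k : 'I_s * 'I_s) (h : {ffun J -> L}) :=
  [forall j in A k, h j == h (inl k.1)] && partnered finset.set0 h.
apply: le_trans (@pair_sum_cover _ _ C _) _.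
  move=> f g /andP[/no_singletonP ns /existsP[r /existsP[r' /eqP fg]]].
  exists (r, r'); rewrite /C ns andbT /=; apply/forall_inP => j.
  by rewrite !inE => /orP[]/eqP->; rewrite !ffunE ?fg.
apply: ler_sum => -[r r'] _; rewrite -overlap2.
by apply: sum_one_link; rewrite !inE eqxx.
Qed.

Definition even_fibres f g := [forall l, ~~ odd (#|fibre f l| + #|fibre g l|)%N].

Lemma even_no_singleton f g : even_fibres f g -> no_singleton f g.
Proof. by move=> /forallP e; apply/forallP => l; apply: contraNneq (e l) => ->. Qed.

Lemma two_in_fibre f l : (1 < #|fibre f l|)%N ->
  exists r1 r2, [/\ r1 != r2, f r1 = l & f r2 = l].
Proof.
move=> /card_gt1P[r1 [r2 [r1f r2f r12]]]; exists r1, r2.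
by move: r1f r2f; rewrite !inE => /eqP -> /eqP ->.
Qed.

Lemma one_in_fibre f l : fibre f l != finset.set0 -> exists r, f r = l.
Proof. by case/set0Pn => r; rewrite inE => /eqP; exists r. Qed.

Definition link4 (k : ('I_s * 'I_s) * ('I_s * 'I_s)) (h : {ffun J -> L}) :=
  [forall j in [set inl k.1.1; inl k.1.2; inr k.2.1; inr k.2.2], h j == h (inl k.1.1)].

Definition link2 (k : ('I_s * 'I_s) * ('I_s * 'I_s)) (h : {ffun J -> L}) :=
  (h (inl k.1.1) == h (inr k.2.1)) && (h (inl k.1.2) == h (inr k.2.2)).

Definition distinct2 (k : ('I_s * 'I_s) * ('I_s * 'I_s)) :=
  (k.1.1 != k.1.2) && (k.2.1 != k.2.2).

Lemma sum_link4 k : distinct2 k ->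
  \sum_(h | link4 k h && partnered finset.set0 h) \prod_j pair_weight j (h j) <=
  pair_const * \sum_l u k.1.1 l * u k.1.2 l * (v k.2.1 l * v k.2.2 l).
Proof.
move=> /andP[k1' k2']; rewrite -overlap4//.
by apply: sum_one_link; rewrite !inE eqxx.
Qed.

Lemma sum_link2 k : distinct2 k ->
  \sum_(h | link2 k h && partnered finset.set0 h) \prod_j pair_weight j (h j) <=
  pair_const * ((\sum_l u k.1.1 l * v k.2.1 l) * \sum_l u k.1.2 l * v k.2.2 l).
Proof.
move=> /andP[k1' k2']; rewrite -!overlap2.
pose A : {set J} := [set inl k.1.1; inr k.2.1].
pose B : {set J} := [set inl k.1.2; inr k.2.2].
have AB : [disjoint A & B].
  apply/pred0P => j /=; rewrite !inE; apply/negbTE; rewrite negb_and.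
  by case: j => r; rewrite ?orbF ?orFb ?(inj_eq (@inl_inj _ _)) ?(inj_eq (@inr_inj _ _)) -negb_and;
    apply/negP => /andP[/eqP -> ]; apply/negP.
apply: le_trans (@sum_two_links A B (inl k.1.1) (inl k.1.2) _ _ AB).
- apply: ler_sum_subset => h; first by apply: prodr_ge0 => j _; exact: pair_weight_ge0.
  move=> /andP[/andP[h1 h2] ->]; rewrite andbT; apply/andP; split.
    by apply/forall_inP => j; rewrite !inE => /orP[]/eqP-> //; rewrite eq_sym.
  by apply/forall_inP => j; rewrite !inE => /orP[]/eqP-> //; rewrite eq_sym.
- by rewrite !inE eqxx.
- by rewrite !inE eqxx.
Qed.

(** Parity forces a second link. If the fibres of [f] and [g] at the common value [l] are even, each
    has at least two elements and four coordinates agree. If they are odd, then, as [s] is even,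
    some other value [l'] has an odd fibre under [f], hence also under [g], and the terms meet again
    at [l']. *)
Lemma pair_sum_even : ~~ odd s ->
  pair_sum (fun f g => even_fibres f g && linked f g) <=
  pair_const * \sum_(k | distinct2 k)
    ((\sum_l u k.1.1 l * u k.1.2 l * (v k.2.1 l * v k.2.2 l)) +
     (\sum_l u k.1.1 l * v k.2.1 l) * \sum_l u k.1.2 l * v k.2.2 l).
Proof.
move=> s_even.
pose C k (h : {ffun J -> L}) :=
  distinct2 k && (link4 k h || link2 k h) && partnered finset.set0 h.
apply: le_trans (@pair_sum_cover _ _ C _) _.
  move=> f g /andP[/[dup] /even_no_singleton/no_singletonP ns /forallP ev].
  move=> /existsP[r /existsP[r' /eqP fg]].
  set l := f r in fg.
  have fl0 : (0 < #|fibre f l|)%N by apply/card_gt0P; exists r; rewrite inE.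
  have gl0 : (0 < #|fibre g l|)%N by apply/card_gt0P; exists r'; rewrite inE fg.
  have := ev l; rewrite oddD; case fo: (odd #|fibre f l|) => /=; last first.
    move=> go; have [|r1 [r2 [r12 f1 f2]]] := @two_in_fibre f l.
      by case: #|fibre f l| fl0 fo => [//|[]].
    have [|r1' [r2' [r12' g1 g2]]] := @two_in_fibre g l.
      by case: #|fibre g l| gl0 go => [//|[]].
    exists ((r1, r2), (r1', r2')); rewrite /C ns /distinct2 /= r12 r12' andbT.
    apply/orP; left; apply/forall_inP => j; rewrite !inE -!orbA.
    by case/or4P => /eqP ->; rewrite !ffunE ?f1 ?f2 ?g1 ?g2.
  rewrite negbK => go.
  have [l' l'l fo'] : exists2 l', l' != l & odd #|fibre f l'|.
    have := sum_card_fibre f; rewrite (bigD1 l)//= => sE.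
    apply: contrapT => none; move: s_even; rewrite -sE oddD fo addTb negbK; apply/negP.
    apply: (big_ind (fun n => ~~ odd n)) => //.
      by move=> a b /negbTE ae /negbTE be; rewrite oddD ae be.
    by move=> l' l'l; apply/negP => fo'; apply: none; exists l'.
  have go' : odd #|fibre g l'| by have := ev l'; rewrite oddD fo' negbK.
  have [r2 r2l'] : exists r, f r = l'.
    by apply: one_in_fibre; rewrite -cards_eq0; case: #|_| fo'.
  have [r2' r2'l'] : exists r, g r = l'.
    by apply: one_in_fibre; rewrite -cards_eq0; case: #|_| go'.
  exists ((r, r2), (r', r2')); rewrite /C ns /distinct2 andbT /=.
  apply/andP; split.
    apply/andP; split; apply: contraNneq l'l => E; apply/eqP.
      by rewrite -r2l' -E.
    by rewrite -r2'l' -E.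
  by apply/orP; right; rewrite /link2 !ffunE /= -fg r2l' r2'l' !eqxx.
rewrite mulr_sumr [leRHS]big_mkcond ler_sum// => k _.
case: ifPn => [kd|kd]; last by rewrite big_pred0// => h; rewrite /C (negbTE kd).
rewrite mulrDr; apply: le_trans (lerD (sum_link4 kd) (sum_link2 kd)).
have W0 (h : {ffun J -> L}) : 0 <= \prod_j pair_weight j (h j).
  by apply: prodr_ge0 => j _; exact: pair_weight_ge0.
rewrite (bigID (link4 k)) /= lerD//; apply: ler_sum_subset => // h.
  by move=> /andP[/andP[_ ->] ->].
by rewrite /C kd /= => /andP[/andP[/orP[->//|->] ->]].
Qed.

(** Heavy blocks are centred in the truncated part, so a heavy fibre of one term that misses the
    other term makes the mixed moment vanish. *)
Definition heavy_linked f g :=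
  [&& no_singleton f g,
      [exists l, heavy (fibre f l) && (fibre g l != finset.set0)] &
      [exists l, heavy (fibre g l) && (fibre f l != finset.set0)]].

Definition triple2 := (('I_s * 'I_s * 'I_s) * ('I_s * 'I_s * 'I_s))%type.

Definition distinct3 (k : triple2) :=
  [&& k.1.1.1 != k.1.1.2, k.2.1.1 != k.2.1.2,
      (k.2.2 != k.1.1.1) && (k.2.2 != k.1.1.2) &
      (k.1.2 != k.2.1.1) && (k.1.2 != k.2.1.2)].

Definition link3 (k : triple2) (h : {ffun J -> L}) :=
  [forall j in [set inl k.1.1.1; inl k.1.1.2; inr k.1.2], h j == h (inl k.1.1.1)] &&
  [forall j in [set inl k.2.2; inr k.2.1.1; inr k.2.1.2], h j == h (inl k.2.2)].

Lemma sum_link3 k : distinct3 k ->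
  \sum_(h | link3 k h && partnered finset.set0 h) \prod_j pair_weight j (h j) <=
  pair_const * ((\sum_l u k.1.1.1 l * u k.1.1.2 l * v k.1.2 l) *
                \sum_l u k.2.2 l * (v k.2.1.1 l * v k.2.1.2 l)).
Proof.
case/and4P => k1' k2' /andP[/negbTE t1 /negbTE t2] /andP[/negbTE t3 /negbTE t4].
rewrite -overlap3l// -overlap3r//.
under eq_bigl do rewrite -andbA.
apply: sum_two_links; rewrite ?inE ?eqxx//.
apply/pred0P => j /=; rewrite !inE; apply/negbTE.
case: j => r; rewrite ?orbF ?orFb ?(inj_eq (@inl_inj _ _)) ?(inj_eq (@inr_inj _ _)).
  by apply/negP => /andP[/orP[]/eqP ->]; rewrite eq_sym ?t1 ?t2.
by apply/negP => /andP[/eqP ->]; rewrite t3 t4.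
Qed.

(** If the heavy fibres of [f] and [g] sit at the same value, four coordinates coincide. Otherwise
    there are two disjoint triples, each made of two coordinates of a heavy fibre and one of the
    other function. *)
Lemma pair_sum_heavy :
  pair_sum heavy_linked <=
  pair_const * (\sum_(k | distinct2 k)
      (\sum_l u k.1.1 l * u k.1.2 l * (v k.2.1 l * v k.2.2 l)) +
    \sum_(k | distinct3 k)
     ((\sum_l u k.1.1.1 l * u k.1.1.2 l * v k.1.2 l) *
      \sum_l u k.2.2 l * (v k.2.1.1 l * v k.2.1.2 l))).
Proof.
pose C (k : (('I_s * 'I_s) * ('I_s * 'I_s)) + triple2) (h : {ffun J -> L}) :=
  match k with inl k => distinct2 k && link4 k h | inr k => distinct3 k && link3 k h end
   && partnered finset.set0 h.
apply: le_trans (@pair_sum_cover _ _ C _) _.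
  move=> f g /and3P[/no_singletonP ns /existsP[l /andP[hf gl]] /existsP[l' /andP[hg fl]]].
  have [r1 [r2 [r12 f1 f2]]] := two_in_fibre (proj1 (andP hf)).
  have [r1' [r2' [r12' g1 g2]]] := two_in_fibre (proj1 (andP hg)).
  have [ll'|ll'] := eqVneq l l'.
    exists (inl ((r1, r2), (r1', r2'))); rewrite /C ns /distinct2 /= r12 r12' andbT.
    apply/forall_inP => j; rewrite !inE -!orbA.
    by case/or4P => /eqP ->; rewrite !ffunE ?f1 ?f2 ?g1 ?g2 ll'.
  have [r' gr'] := one_in_fibre gl; have [t ft] := one_in_fibre fl.
  exists (inr ((r1, r2, r'), (r1', r2', t))); rewrite /C ns /distinct3 /= r12 r12' andbT /=.
  apply/andP; split.
    rewrite -!andbA; apply/and4P; split; apply: contraNneq ll' => E; apply/eqP.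
    - by rewrite -f1 -ft E.
    - by rewrite -f2 -ft E.
    - by rewrite -gr' -g1 E.
    - by rewrite -gr' -g2 E.
  apply/andP; split; apply/forall_inP => j; rewrite !inE -!orbA.
    by case/or3P => /eqP ->; rewrite !ffunE ?f1 ?f2 ?gr'.
  by case/or3P => /eqP ->; rewrite !ffunE ?g1 ?g2 ?ft.
rewrite big_sumType /= mulrDr lerD//.
  rewrite mulr_sumr [leRHS]big_mkcond ler_sum// => k _.
  case: ifPn => kd; last by rewrite big_pred0// => h; rewrite /C (negbTE kd).
  by under eq_bigl do rewrite /C kd /=; exact: sum_link4.
rewrite mulr_sumr [leRHS]big_mkcond ler_sum// => k _.
case: ifPn => kd; last by rewrite big_pred0// => h; rewrite /C (negbTE kd).
by under eq_bigl do rewrite /C kd /=; exact: sum_link3.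
Qed.

End PairSums.

(** * Summation over a time window *)

Section WindowSums.
Context (R : realType) (s : nat) (c : int -> 'I_s -> R) (kappa : R).
Context (k1 : 1 <= kappa)
  (ck : forall r (S : seq int), uniq S -> \sum_(l <- S) c l r ^+ 2 <= kappa ^+ 2).
Context (L : finType) (iota : L -> int) (iota_inj : injective iota).
Implicit Types (k : nat) (r : 'I_s) (l : L).

Definition shifted k r l : R := c (k%:Z - iota l) r.
Local Notation wt k := (fun r l => `|shifted k r l|).

Let k0 : 0 <= kappa. Proof. exact: le_trans k1. Qed.

Lemma shifted_sq k r : \sum_l shifted k r l ^+ 2 <= kappa ^+ 2.
Proof.
rewrite /shifted.
have uS : uniq [seq k%:Z - iota l | l <- index_enum L].
  by rewrite map_inj_uniq ?index_enum_uniq// => x y /addrI/oppr_inj/iota_inj.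
by have := ck r uS; rewrite big_map.
Qed.

Lemma wt_sq k r : \sum_l wt k r l ^+ 2 <= kappa ^+ 2.
Proof.
by under eq_bigr do rewrite real_normK ?num_real//; exact: shifted_sq.
Qed.

Lemma window_sq m n r l : \sum_(m <= k < n) wt k r l ^+ 2 <= kappa ^+ 2.
Proof.
under eq_bigr do rewrite real_normK ?num_real//.
have uS : uniq [seq k%:Z - iota l | k <- index_iota m n].
  by rewrite map_inj_uniq ?iota_uniq// => x y /addIr[].
by have := ck r uS; rewrite big_map.
Qed.

Lemma sum_wt2 k r1 r2 : \sum_l wt k r1 l * wt k r2 l <= kappa ^+ 2.
Proof. by rewrite expr2; apply: sum_mul_le => //; exact: wt_sq. Qed.

Lemma window_wt2 m n r1 r2 l :
  \sum_(m <= k < n) wt k r1 l * wt k r2 l <= kappa ^+ 2.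
Proof.
apply: (@le_trans _ _ (\sum_(m <= k < n) 2^-1 * (wt k r1 l ^+ 2 + wt k r2 l ^+ 2))).
  apply: ler_sum => k _; have := sqr_ge0 (wt k r1 l - wt k r2 l); rewrite sqrrB; lra.
rewrite -mulr_sumr big_split /=.
by have := window_sq m n r1 l; have := window_sq m n r2 l; lra.
Qed.

(** Summing over [k'] first leaves a bounded weight at each [l], and the sum over [l] is then
    bounded for each of the [n] values of [k]. Only square summability enters, no rate of decay. *)
Lemma window_quadruple m n r1 r2 r1' r2' :
  \sum_(m <= k < m + n) \sum_(m <= k' < m + n)
    \sum_l wt k r1 l * wt k r2 l * (wt k' r1' l * wt k' r2' l) <=
  n%:R * (kappa ^+ 2 * kappa ^+ 2).
Proof.
apply: (@le_trans _ _ (\sum_(m <= k < m + n) kappa ^+ 2 * kappa ^+ 2)).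
  apply: ler_sum => k _; rewrite exchange_big /=.
  apply: (@le_trans _ _ (\sum_l wt k r1 l * wt k r2 l * kappa ^+ 2)).
    by apply: ler_sum => l _; rewrite -mulr_sumr ler_wpM2l ?mulr_ge0 ?window_wt2.
  by rewrite -mulr_suml ler_wpM2r ?sqr_ge0 ?sum_wt2.
by rewrite big_const_nat iter_addr_0 addKn -[leLHS]mulr_natl.
Qed.

Lemma weighted_sq_le (I : finType) (b x : I -> R) : (forall i, 0 <= b i) ->
  (\sum_i b i * x i) ^+ 2 <= (\sum_i b i) * \sum_i b i * x i ^+ 2.
Proof.
move=> b0; have : 0 <= \sum_i \sum_j b i * b j * (x i - x j) ^+ 2.
  by do 2!(apply: sumr_ge0 => ? _); rewrite mulr_ge0 ?sqr_ge0// mulr_ge0.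
have -> : \sum_i \sum_j b i * b j * (x i - x j) ^+ 2 =
  2 * ((\sum_i b i) * \sum_i b i * x i ^+ 2) - 2 * (\sum_i b i * x i) ^+ 2.
  rewrite expr2 !big_distrlr /=.
  rewrite [in RHS](_ : 2 * \sum_i \sum_j b i * (b j * x j ^+ 2) =
    \sum_i \sum_j b i * (b j * x j ^+ 2) + \sum_i \sum_j b j * (b i * x i ^+ 2)); last first.
    by rewrite [X in _ = _ + X]exchange_big /= [LHS]mulr_natl mulr2n.
  rewrite mulr_sumr -!sumrN -!big_split /=; apply: eq_bigr => i _.
  rewrite mulr_sumr -!sumrN -!big_split /=; apply: eq_bigr => j _; ring.
lra.
Qed.

(** Jensen's inequality for the weights [wt k r1 l * wt k r2 l], of total mass at most [kappa ^+ 2],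
    puts the square on the last factor, which is then summed over [k']. *)
Lemma window_triple_sq k m n r1 r2 r' :
  \sum_(m <= k' < n) (\sum_l wt k r1 l * wt k r2 l * wt k' r' l) ^+ 2 <= kappa ^+ 6.
Proof.
apply: (@le_trans _ _ (\sum_(m <= k' < n) kappa ^+ 2 *
    \sum_l wt k r1 l * wt k r2 l * wt k' r' l ^+ 2)).
  apply: ler_sum => k' _; apply: le_trans (weighted_sq_le _ _) _.
    by move=> l; rewrite mulr_ge0.
  rewrite ler_wpM2r ?sum_wt2//.
  by apply: sumr_ge0 => l _; rewrite mulr_ge0 ?mulr_ge0 ?sqr_ge0.
rewrite -mulr_sumr (_ : kappa ^+ 6 = kappa ^+ 2 * (kappa ^+ 2 * kappa ^+ 2)); last by ring.
rewrite ler_wpM2l ?sqr_ge0// exchange_big /=.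
apply: (@le_trans _ _ (\sum_l wt k r1 l * wt k r2 l * kappa ^+ 2)).
  by apply: ler_sum => l _; rewrite -mulr_sumr ler_wpM2l ?mulr_ge0 ?window_sq.
by rewrite -mulr_suml ler_wpM2r ?sqr_ge0 ?sum_wt2.
Qed.

(** The product is at most half the sum of the squares, and each square is summed first over the
    time that enters its triple through a single coefficient. *)
Lemma window_triple m n r1 r2 r' t t1' t2' :
  \sum_(m <= k < m + n) \sum_(m <= k' < m + n)
   ((\sum_l wt k r1 l * wt k r2 l * wt k' r' l) *
    \sum_l wt k t l * (wt k' t1' l * wt k' t2' l)) <= n%:R * kappa ^+ 6.
Proof.
set A := fun k k' => \sum_l wt k r1 l * wt k r2 l * wt k' r' l.
set B := fun k k' => \sum_l wt k t l * (wt k' t1' l * wt k' t2' l).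
apply: (@le_trans _ _ (\sum_(m <= k < m + n) \sum_(m <= k' < m + n)
   2^-1 * (A k k' ^+ 2 + B k k' ^+ 2))).
  do 2!apply: ler_sum => ? _; rewrite -/(A _ _) -/(B _ _).
  by move: (A _ _) (B _ _) => x y; have := sqr_ge0 (x - y); rewrite sqrrB; lra.
under eq_bigr do rewrite -mulr_sumr big_split /=.
rewrite -mulr_sumr big_split /= [X in _ + X]exchange_big /=.
have cst : \sum_(m <= k < m + n) kappa ^+ 6 = n%:R * kappa ^+ 6.
  by rewrite big_const_nat iter_addr_0 addKn -[LHS]mulr_natl.
have hA : \sum_(m <= k < m + n) \sum_(m <= k' < m + n) A k k' ^+ 2 <= n%:R * kappa ^+ 6.
  by rewrite -cst; apply: ler_sum => k _; exact: window_triple_sq.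
have hB : \sum_(m <= k' < m + n) \sum_(m <= k < m + n) B k k' ^+ 2 <= n%:R * kappa ^+ 6.
  rewrite -cst; apply: ler_sum => k' _; rewrite /B.
  under eq_bigr do under eq_bigr do rewrite mulrC.
  exact: window_triple_sq.
lra.
Qed.

Local Notation J := ('I_s + 'I_s)%type.

Let D := pair_const s kappa.
Let D0 : 0 <= D. Proof. exact: pair_const_ge0. Qed.

Definition window_heavy_const : R :=
  D * (#|{: ('I_s * 'I_s) * ('I_s * 'I_s)}|%:R * (kappa ^+ 2 * kappa ^+ 2) +
   #|{: triple2 s}|%:R * kappa ^+ 6).

Lemma window_heavy_const_ge0 : 0 <= window_heavy_const.
Proof. by rewrite mulr_ge0// addr_ge0// mulr_ge0// ?mulr_ge0 ?exprn_ge0. Qed.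

Lemma window_pair_sum_heavy m n :
  \sum_(m <= k < m + n) \sum_(m <= k' < m + n)
    pair_sum (wt k) (wt k') (@heavy_linked s L) <= window_heavy_const * n%:R.
Proof.
apply: (@le_trans _ _ (\sum_(m <= k < m + n) \sum_(m <= k' < m + n)
  D * (\sum_(j : ('I_s * 'I_s) * ('I_s * 'I_s))
      (\sum_l wt k j.1.1 l * wt k j.1.2 l * (wt k' j.2.1 l * wt k' j.2.2 l)) +
    \sum_(j : triple2 s)
     ((\sum_l wt k j.1.1.1 l * wt k j.1.1.2 l * wt k' j.1.2 l) *
      \sum_l wt k j.2.2 l * (wt k' j.2.1.1 l * wt k' j.2.1.2 l))))).
  do 2!apply: ler_sum => ? _; apply: le_trans (pair_sum_heavy _ _ k1 _ _) _ => //.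
  - exact: wt_sq.
  - exact: wt_sq.
  rewrite ler_wpM2l// lerD//; apply: ler_sum_subset => // j.
    by apply: sumr_ge0 => l _; rewrite !mulr_ge0.
  by apply: mulr_ge0; apply: sumr_ge0 => l _; rewrite !mulr_ge0.
under eq_bigr do rewrite -mulr_sumr.
rewrite -mulr_sumr -[leRHS]mulrA ler_wpM2l// [leRHS]mulrDl.
under eq_bigr do rewrite big_split /=.
rewrite big_split /= lerD//.
  under eq_bigr do rewrite exchange_big /=.
  rewrite exchange_big /=.
  apply: (@le_trans _ _ (\sum_(j : ('I_s * 'I_s) * ('I_s * 'I_s)) n%:R * (kappa ^+ 2 * kappa ^+ 2))).
    by apply: ler_sum => j _; exact: window_quadruple.
  by rewrite sumr_const -[leLHS]mulr_natl -[leRHS]mulrA ler_wpM2l// [leRHS]mulrC.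
under eq_bigr do rewrite exchange_big /=.
rewrite exchange_big /=.
apply: (@le_trans _ _ (\sum_(j : triple2 s) n%:R * kappa ^+ 6)).
  by apply: ler_sum => j _; exact: window_triple.
by rewrite sumr_const -[leLHS]mulr_natl -[leRHS]mulrA ler_wpM2l// [leRHS]mulrC.
Qed.

Context (gamma : 'I_s -> 'I_s -> int -> R).
Context (cgamma : forall r r' h (S : seq int), uniq S ->
  \sum_(x <- S) `|c x r| * `|c (x + h) r'| <= gamma r r' h).
Context (b Cw G : R) (b12 : 1 < b < 2) (Cw0 : 0 < Cw) (G0 : 0 <= G).
Context (HCw : forall m n,
  \sum_(m <= k < m + n) \sum_(m <= k' < m + n) brak R (k%:Z - k'%:Z) `^ (b - 2)
    <= Cw * n%:R `^ b).

Let wt_gamma k k' r r' : \sum_l wt k r l * wt k' r' l <= gamma r r' (k'%:Z - k%:Z).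
Proof.
have uS : uniq [seq k%:Z - iota l | l <- index_enum L].
  by rewrite map_inj_uniq ?index_enum_uniq// => x y /addrI/oppr_inj/iota_inj.
have := cgamma r r' (k'%:Z - k%:Z) uS; rewrite big_map.
apply: le_trans; apply: ler_sum => l _.
by have -> : k%:Z - iota l + (k'%:Z - k%:Z) = k'%:Z - iota l by ring.
Qed.

Let wt_wt0 k k' r r' : 0 <= \sum_l wt k r l * wt k' r' l.
Proof. by apply: sumr_ge0 => l _; rewrite mulr_ge0. Qed.

Let brakC (k k' : nat) : brak R (k'%:Z - k%:Z) = brak R (k%:Z - k'%:Z).
Proof. by rewrite /brak -abszN opprB. Qed.

Lemma window_pair_sum_linked m n :
  (forall r r' h, gamma r r' h <= G * brak R h `^ (b - 2)) ->
  \sum_(m <= k < m + n) \sum_(m <= k' < m + n)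
    pair_sum (wt k) (wt k') (fun f g : {ffun 'I_s -> L} => no_singleton f g && linked f g)
  <= D * (s%:R * s%:R * G) * Cw * n%:R `^ b.
Proof.
move=> Hg.
apply: (@le_trans _ _ (\sum_(m <= k < m + n) \sum_(m <= k' < m + n)
  D * (s%:R * s%:R * G) * brak R (k%:Z - k'%:Z) `^ (b - 2))).
  apply: ler_sum => k _; apply: ler_sum => k' _.
  apply: le_trans (pair_sum_linked _ _ k1 _ _) _ => //; try exact: wt_sq.
  rewrite -[leRHS]mulrA ler_wpM2l//.
  apply: (@le_trans _ _ (\sum_(r : 'I_s) \sum_(r' : 'I_s) G * brak R (k%:Z - k'%:Z) `^ (b - 2))).
    do 2!(apply: ler_sum => ? _); apply: le_trans (wt_gamma _ _ _ _) _.
    by apply: le_trans (Hg _ _ _) _; rewrite brakC.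
  rewrite !sumr_const !card_ord -mulrnA -[leLHS]mulr_natl natrM -!mulrA//.
under eq_bigr do rewrite -mulr_sumr.
rewrite -mulr_sumr -[leRHS]mulrA ler_wpM2l//.
by rewrite mulr_ge0// mulr_ge0.
Qed.

Lemma window_pair_sum_even m n : ~~ odd s ->
  (forall r1 r2 r1' r2' h, r1 != r2 -> r1' != r2' ->
     gamma r1 r1' h * gamma r2 r2' h <= G * brak R h `^ (b - 2)) ->
  \sum_(m <= k < m + n) \sum_(m <= k' < m + n)
    pair_sum (wt k) (wt k') (fun f g : {ffun 'I_s -> L} => even_fibres f g && linked f g)
  <= D * (#|{: ('I_s * 'I_s) * ('I_s * 'I_s)}|%:R *
       (kappa ^+ 2 * kappa ^+ 2 + G * Cw)) * n%:R `^ b.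
Proof.
move=> s_even Hg.
apply: (@le_trans _ _ (\sum_(m <= k < m + n) \sum_(m <= k' < m + n)
  D * \sum_(j : ('I_s * 'I_s) * ('I_s * 'I_s))
     ((\sum_l wt k j.1.1 l * wt k j.1.2 l * (wt k' j.2.1 l * wt k' j.2.2 l)) +
       G * brak R (k%:Z - k'%:Z) `^ (b - 2)))).
  apply: ler_sum => k _; apply: ler_sum => k' _.
  apply: le_trans (pair_sum_even _ _ k1 _ _ s_even) _ => //; try exact: wt_sq.
  rewrite ler_wpM2l// big_mkcond; apply: ler_sum => j _.
  case: ifPn => [/andP[j1 j2]|_]; last first.
    rewrite addr_ge0 ?mulr_ge0 ?powR_ge0//.
    by apply: sumr_ge0 => l _; rewrite !mulr_ge0.
  rewrite lerD2l; apply: (@le_trans _ _ (gamma j.1.1 j.2.1 (k'%:Z - k%:Z) *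
      gamma j.1.2 j.2.2 (k'%:Z - k%:Z))); first by apply: ler_pM.
  by apply: le_trans (Hg _ _ _ _ _ j1 j2) _; rewrite brakC.
under eq_bigr do rewrite -mulr_sumr.
rewrite -mulr_sumr -[leRHS]mulrA ler_wpM2l//.
under eq_bigr do rewrite exchange_big /=.
rewrite exchange_big /=.
apply: (@le_trans _ _ (\sum_(j : ('I_s * 'I_s) * ('I_s * 'I_s))
   (kappa ^+ 2 * kappa ^+ 2 + G * Cw) * n%:R `^ b)); last first.
  by rewrite sumr_const -[leLHS]mulr_natl mulrA.
apply: ler_sum => j _.
under eq_bigr do rewrite big_split /=.
rewrite big_split /= mulrDl lerD//.
  (* The four-fold overlap grows only linearly in [n], which [n ^ beta] absorbs because
     [beta > 1]. *)
  apply: le_trans (window_quadruple _ _ _ _ _ _) _.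
  rewrite mulrC ler_wpM2l ?mulr_ge0 ?exprn_ge0//.
  case: n => [|n]; first by rewrite powR_ge0.
  by rewrite le1r_powR ?ler1n//; case/andP: b12 => /ltW.
under eq_bigr do rewrite -mulr_sumr.
by rewrite -mulr_sumr -mulrA ler_wpM2l.
Qed.

End WindowSums.

Local Open Scope classical_set_scope.

(** * Expectation and independence *)

Section WeightedIntegral.
Local Open Scope ereal_scope.
Context d d' (T : measurableType d) (T' : measurableType d') (R : realType)
  (P : {measure set T -> \bar R}).
Import HBNNSimple.

Lemma integral_simple_weighted (f : {nnsfun T' >-> R}) (X : T -> T') (G : T -> R) :
  measurable_fun setT X -> measurable_fun setT G -> (forall w, 0 <= G w)%R ->
  \int[P]_w (f (X w) * G w)%:E =
  \sum_(k \in range f) k%:E * \int[P]_w (\1_(f @^-1` [set k]) (X w) * G w)%:E.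
Proof.
move=> mX mG G0.
have mind k : measurable_fun setT (EFin \o (fun w => \1_(f @^-1` [set k]) (X w) * G w : R)%R).
  apply/measurable_EFinP/measurable_funM => //.
  by apply: (measurableT_comp (f := \1_(f @^-1` [set k]) : T' -> R)).
transitivity (\int[P]_w \sum_(k \in range f) (k%:E * (\1_(f @^-1` [set k]) (X w) * G w)%:E)).
  apply: eq_integral => w _.
  rewrite EFinM fimfunE -fsumEFin// ge0_mule_fsuml; last first.
    by move=> k; rewrite lee_fin; exact: nnfun_muleindic_ge0.
  by apply: eq_fsbigr => k _; rewrite -!EFinM mulrA.
rewrite ge0_integral_fsum//.
- apply: eq_fsbigr => k; rewrite inE => -[x _ <-].
  rewrite ge0_integralZl//; [exact: mind| |by rewrite lee_fin].
  by move=> w _; rewrite lee_fin mulr_ge0.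
- by move=> k; apply: measurable_funeM; exact: mind.
- move=> k w _; rewrite -EFinM lee_fin mulrA mulr_ge0//.
  by rewrite -lee_fin; exact: nnfun_muleindic_ge0.
Qed.

(** Approximation of [f] by simple functions and monotone convergence. The weights stand for the
    other factors of a product, so that one factor at a time can be turned from an indicator into a
    general function. *)
Lemma ge0_integral_weighted_ext (X Y : T -> T') (G H : T -> R) :
  measurable_fun setT X -> measurable_fun setT G -> (forall w, 0 <= G w)%R ->
  measurable_fun setT Y -> measurable_fun setT H -> (forall w, 0 <= H w)%R ->
  (forall B, measurable B -> \int[P]_w (\1_B (X w) * G w)%:E =
                             \int[P]_w (\1_B (Y w) * H w)%:E) ->
  forall f : T' -> R, measurable_fun setT f -> (forall x, 0 <= f x)%R ->
  \int[P]_w (f (X w) * G w)%:E = \int[P]_w (f (Y w) * H w)%:E.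
Proof.
move=> mX mG G0 mY mH H0 XY f mf f0.
have mEf : measurable_fun setT (EFin \o f) by exact/measurable_EFinP.
pose f_ := nnsfun_approx measurableT mEf.
have limf (Z : T -> T') (W : T -> R) :
    measurable_fun setT Z -> measurable_fun setT W -> (forall w, 0 <= W w)%R ->
    \int[P]_w (f (Z w) * W w)%:E = limn (fun n => \int[P]_w (f_ n (Z w) * W w)%:E).
  move=> mZ mW W0; rewrite -monotone_convergence//.
  - apply: eq_integral => w _; apply/esym/cvg_lim => //.
    under eq_fun do rewrite EFinM.
    rewrite EFinM; apply: cvgeZr => //.
    by apply: cvg_nnsfun_approx => // x _; rewrite lee_fin.
  - move=> n; apply/measurable_EFinP/measurable_funM => //.
    exact: measurableT_comp.
  - by move=> n w _; rewrite lee_fin mulr_ge0.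
  - move=> w _ m n mn; rewrite lee_fin ler_wpM2r//.
    exact/lefP/nd_nnsfun_approx.
rewrite !limf//; congr (limn _); apply/funext => n.
rewrite !integral_simple_weighted//; apply: eq_fsbigr => k _.
by rewrite XY.
Qed.

End WeightedIntegral.

Section Expectation.
Context d (T : measurableType d) (R : realType) (P : probability T R).
Implicit Types (X Y : T -> R) (a : R).

Definition L1 X := P.-integrable [set: T] (EFin \o X).
Definition Ex X : R := Rintegral P [set: T] X.

Lemma L1_measurable X : L1 X -> measurable_fun [set: T] X.
Proof. by move=> /integrableP[/measurable_EFinP]. Qed.

Lemma ExE X : L1 X -> (\int[P]_w (X w)%:E = (Ex X)%:E)%E.
Proof. by move=> iX; rewrite /Ex /Rintegral fineK//; exact: integrable_fin_num iX. Qed.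

Lemma L1_cst a : L1 (fun=> a).
Proof. exact: finite_measure_integrable_cst. Qed.

Lemma L1D X Y : L1 X -> L1 Y -> L1 (fun w => X w + Y w).
Proof. by move=> iX iY; have := integrableD measurableT iX iY. Qed.

Lemma L1Z a X : L1 X -> L1 (fun w => a * X w).
Proof. by move=> iX; have := integrableZl measurableT a iX. Qed.

Lemma L1N X : L1 X -> L1 (fun w => - X w).
Proof.
by move=> /(L1Z (- 1)); congr L1; apply/funext => w; rewrite mulN1r.
Qed.

Lemma L1B X Y : L1 X -> L1 Y -> L1 (fun w => X w - Y w).
Proof. by move=> iX /L1N iY; exact: L1D. Qed.

Lemma L1_sum (I : Type) (r : seq I) (Q : pred I) (X : I -> T -> R) :
  (forall i, Q i -> L1 (X i)) -> L1 (fun w => \sum_(i <- r | Q i) X i w).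
Proof.
move=> iX; have := integrable_sum measurableT r iX; congr (_.-integrable _ _).
by apply/funext => w /=; rewrite sumEFin.
Qed.

Lemma L1_abs X : L1 X -> L1 (fun w => `|X w|).
Proof. exact: integrable_norm. Qed.

Lemma L1_le X Y : measurable_fun [set: T] X ->
  (forall w, `|X w| <= Y w) -> L1 Y -> L1 X.
Proof.
move=> mX XY; apply: le_integrable => //; first exact/measurable_EFinP.
by move=> w _ /=; rewrite lee_fin (le_trans (XY w))// ler_norm.
Qed.

Lemma Ex_cst a : Ex (fun=> a) = a.
Proof.
rewrite /Ex Rintegral_cst//.
by have /= -> := probability_setT P; rewrite mulr1.
Qed.

Lemma ExD X Y : L1 X -> L1 Y -> Ex (fun w => X w + Y w) = Ex X + Ex Y.
Proof. exact: RintegralD. Qed.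

Lemma ExZ a X : L1 X -> Ex (fun w => a * X w) = a * Ex X.
Proof. exact: RintegralZl. Qed.

Lemma ExN X : L1 X -> Ex (fun w => - X w) = - Ex X.
Proof.
move=> iX; rewrite -mulN1r -ExZ//; congr Ex.
by apply/funext => w; rewrite mulN1r.
Qed.

Lemma ExB X Y : L1 X -> L1 Y -> Ex (fun w => X w - Y w) = Ex X - Ex Y.
Proof. exact: RintegralB. Qed.

Lemma Ex_sum (I : Type) (r : seq I) (Q : pred I) (X : I -> T -> R) :
  (forall i, Q i -> L1 (X i)) ->
  Ex (fun w => \sum_(i <- r | Q i) X i w) = \sum_(i <- r | Q i) Ex (X i).
Proof.
move=> iX; elim: r => [|i r IH].
  by rewrite big_nil -[RHS](Ex_cst 0); congr Ex; apply/funext => w; rewrite big_nil.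
rewrite big_cons; case: ifPn => Qi; last first.
  by rewrite -IH; congr Ex; apply/funext => w; rewrite big_cons (negbTE Qi).
rewrite -IH -ExD; [|exact: iX|exact: L1_sum].
by congr Ex; apply/funext => w; rewrite big_cons Qi.
Qed.

Lemma Ex_ge0 X : (forall w, 0 <= X w) -> 0 <= Ex X.
Proof. by move=> X0; exact: Rintegral_ge0. Qed.

Lemma Ex_le X Y : L1 X -> L1 Y -> (forall w, X w <= Y w) -> Ex X <= Ex Y.
Proof. by move=> iX iY XY; apply: le_Rintegral. Qed.

Lemma normr_Ex_le X : L1 X -> `|Ex X| <= Ex (fun w => `|X w|).
Proof. by move=> iX; exact: le_normr_Rintegral. Qed.

Definition L2 X := measurable_fun [set: T] X /\ L1 (fun w => X w ^+ 2).

Lemma L2_L1M X Y : L2 X -> L2 Y -> L1 (fun w => X w * Y w).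
Proof.
move=> [mX iX] [mY iY].
apply: L1_le (L1D iX iY); first exact: measurable_funM.
move=> w; rewrite normrM -(real_normK (num_real (X w))) -(real_normK (num_real (Y w))).
move: `|X w| `|Y w| (normr_ge0 (X w)) (normr_ge0 (Y w)) => x y x0 y0; nra.
Qed.

Lemma L2_cst a : L2 (fun=> a).
Proof. by split; [exact: measurable_cst|exact: L1_cst]. Qed.

Lemma L2_L1 X : L2 X -> L1 X.
Proof.
move=> /L2_L1M/(_ (L2_cst 1)); congr L1.
by apply/funext => w; rewrite mulr1.
Qed.

Lemma L2Z a X : L2 X -> L2 (fun w => a * X w).
Proof.
move=> [mX iX]; split; first exact: measurable_funM.
by have := L1Z (a ^+ 2) iX; congr L1; apply/funext => w; rewrite exprMn.
Qed.

Lemma L2D X Y : L2 X -> L2 Y -> L2 (fun w => X w + Y w).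
Proof.
move=> X2 Y2; case: (X2) (Y2) => [mX iX] [mY iY]; split; first exact: measurable_funD.
have := L1D (L1D iX iY) (L1Z 2 (L2_L1M X2 Y2)); congr L1.
by apply/funext => w; ring.
Qed.

Lemma L2B X Y : L2 X -> L2 Y -> L2 (fun w => X w - Y w).
Proof.
move=> X2 /(L2Z (-1)) Y2; have := L2D X2 Y2; congr L2.
by apply/funext => w; rewrite mulN1r.
Qed.

Lemma L2_sum (I : Type) (r : seq I) (Q : pred I) (X : I -> T -> R) :
  (forall i, Q i -> L2 (X i)) -> L2 (fun w => \sum_(i <- r | Q i) X i w).
Proof.
move=> iX; elim: r => [|i r IH].
  by under eq_fun do rewrite big_nil; exact: L2_cst.
case Qi: (Q i); under eq_fun do rewrite big_cons Qi.
  by apply: L2D => //; exact: iX.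
exact: IH.
Qed.

(** With a common bound on the two second moments, [2 x y <= x ^ 2 + y ^ 2] replaces
    Cauchy-Schwarz. *)
Lemma Ex_mul_le X Y K : L2 X -> L2 Y ->
  Ex (fun w => X w ^+ 2) <= K -> Ex (fun w => Y w ^+ 2) <= K ->
  `|Ex (fun w => X w * Y w)| <= K.
Proof.
move=> X2 Y2 XK YK; have iXY := L2_L1M X2 Y2.
case: (X2) (Y2) => [mX iX] [mY iY].
apply: le_trans (normr_Ex_le iXY) _.
apply: (@le_trans _ _ (Ex (fun w => 2^-1 * (X w ^+ 2 + Y w ^+ 2)))).
  apply: Ex_le; [exact: L1_abs|exact/L1Z/L1D|].
  move=> w; rewrite normrM -(real_normK (num_real (X w))) -(real_normK (num_real (Y w))).
  move: `|X w| `|Y w| => x y; have := sqr_ge0 (x - y); nra.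
rewrite ExZ ?ExD//; last exact: L1D.
by lra.
Qed.

(** The elementary bound [2 b |x| <= x ^ 2 + b ^ 2] avoids square roots. *)
Lemma Ex_abs_le X (b : R) : L2 X -> 0 < b ->
  Ex (fun w => X w ^+ 2) <= b ^+ 2 -> Ex (fun w => `|X w|) <= b.
Proof.
move=> X2 b0 XK; have iX := L2_L1 X2; case: (X2) => mX iX2.
apply: (@le_trans _ _ (Ex (fun w => (2 * b)^-1 * (X w ^+ 2 + b ^+ 2)))).
  apply: Ex_le; [exact: L1_abs|exact/L1Z/L1D/L1_cst|].
  move=> w; rewrite ler_pdivlMl ?mulr_gt0// -(real_normK (num_real (X w))).
  move: `|X w| => x; have := sqr_ge0 (x - b); nra.
rewrite ExZ ?ExD ?Ex_cst//; [|exact: L1_cst|exact/L1D/L1_cst].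
rewrite ler_pdivrMl ?mulr_gt0//; nra.
Qed.

End Expectation.

Lemma measurable_bigprod d (T : measurableType d) (R : realType) (I : eqType)
    (r : seq I) (Q : pred I) (h : I -> T -> R) :
  (forall i, Q i -> measurable_fun [set: T] (h i)) ->
  measurable_fun [set: T] (fun w => \prod_(i <- r | Q i) h i w).
Proof.
move=> mh; under eq_fun do rewrite -big_filter.
by apply: measurable_prod => i; rewrite mem_filter => /andP[/mh].
Qed.

Section Independence.
Context d d' (T : measurableType d) (T' : measurableType d') (R : realType)
  (P : probability T R) (I : choiceType) (X : I -> {RV P >-> T'})
  (indepX : independent X) (L : finType) (iota : L -> I)
  (iota_inj : injective iota).
Local Notation L1 := (L1 P).
Local Notation Ex := (Ex P).

Let mindic (B : set T') i : measurable B ->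
  measurable_fun [set: T] (fun w => \1_B (X i w) : R).
Proof. by move=> mB; apply: (measurableT_comp (f := \1_B : T' -> R)). Qed.

Let Ex_indic_comp i (B : set T') : measurable B ->
  L1 (fun w => \1_B (X i w)) /\ Ex (fun w => \1_B (X i w)) = fine (P (X i @^-1` B)).
Proof.
move=> mB; have mXB : measurable (X i @^-1` B) by rewrite -[_ @^-1` _]setTI; exact: measurable_funP.
have -> : (fun w => \1_B (X i w) : R) = \1_(X i @^-1` B) by [].
split; first exact: integrable_indic.
by rewrite /Ex /Rintegral integral_indic// setIT.
Qed.

Let indep_indic (B : L -> set T') : (forall l, measurable (B l)) ->
  (\int[P]_w (\prod_l \1_(B l) (X (iota l) w))%:E)%E =
  (\prod_l Ex (fun w => \1_(B l) (X (iota l) w)))%:E.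
Proof.
move=> mB.
pose A (i : I) : set T' := if [pick l | iota l == i] is Some l then B l else [set: T'].
have AE l : A (iota l) = B l.
  rewrite /A; case: pickP => [l' /eqP/iota_inj -> //|/(_ l)].
  by rewrite eqxx.
have mA i : measurable (A i) by rewrite /A; case: pickP.
have uL : uniq [seq iota l | l <- index_enum L] by rewrite map_inj_uniq// index_enum_uniq.
have := indepX uL mA; rewrite big_map.
have -> : (\prod_(l : L) P (X (iota l) @^-1` A (iota l)))%E =
    (\prod_l Ex (fun w => \1_(B l) (X (iota l) w)))%:E.
  rewrite -prodEFin; apply: eq_bigr => l _; rewrite AE (Ex_indic_comp _ (mB l)).2 fineK//.
  apply: fin_num_measure.
  by rewrite -[_ @^-1` _]setTI; exact: measurable_funP.
move=> <-.
rewrite -[X in P X]setIT -integral_indic//; last first.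
  apply: fin_bigcap_measurable; first exact: finite_seq.
  by move=> i _; rewrite -[_ @^-1` _]setTI; exact: measurable_funP.
apply: eq_integral => w _; congr EFin.
rewrite indicE; case: (boolP (w \in _)) => [|nA].
  rewrite inE => wA; apply: big1 => l _; rewrite indicE mem_set//.
  rewrite -AE; apply: (wA (iota l)) => /=.
  by apply: map_f; rewrite mem_index_enum.
have [l nB] : exists l, ~ B l (X (iota l) w).
  apply: contrapT => h; move/negP: nA; apply; rewrite inE => i /= /mapP[l _ ->].
  by rewrite /= AE; apply: contrapT => nB; apply: h; exists l.
by apply/eqP/prodf_eq0; exists l => //; rewrite indicE memNset.
Qed.

(** For indicators this is the definition of independence; they are replaced by general nonnegative
    functions one index at a time, [A] being the set of indices already treated. *)
Let indep_mixed (A : {set L}) (phi : L -> T' -> R) (B : L -> set T') :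
  (forall l, measurable_fun [set: T'] (phi l)) -> (forall l x, 0 <= phi l x) ->
  (forall l, L1 (fun w => phi l (X (iota l) w))) ->
  (forall l, measurable (B l)) ->
  (\int[P]_w (\prod_l (if l \in A then phi l else \1_(B l)) (X (iota l) w))%:E)%E =
  (\prod_l Ex (fun w => (if l \in A then phi l else \1_(B l)) (X (iota l) w)))%:E.
Proof.
move=> mphi phi0 iphi; have [n] := ubnP #|A|.
elim: n A B => // n IH A B nA mB.
have [->|[l0 l0A]] := set_0Vmem A.
  under eq_integral do under eq_bigr do rewrite inE.
  by under [in RHS]eq_bigr do rewrite inE; exact: indep_indic.
pose A' := A :\ l0.
have nA' : (#|A'| < n)%N by move: nA; rewrite (cardsD1 l0 A) l0A.
pose psi (l : L) (x : T') : R := (if l \in A then phi l else \1_(B l)) x.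
have psi0 l x : 0 <= psi l x by rewrite /psi; case: ifP.
have mpsi l : measurable_fun [set: T] (fun w => psi l (X (iota l) w)).
  rewrite /psi; case: ifP => _; last exact: mindic.
  exact: measurableT_comp.
pose c := \prod_(l | l != l0) Ex (fun w => psi l (X (iota l) w)).
have c0 : 0 <= c by apply: prodr_ge0 => l _; exact: Ex_ge0.
pose G w := \prod_(l | l != l0) psi l (X (iota l) w).
have G0 w : 0 <= G w by apply: prodr_ge0.
have mG : measurable_fun [set: T] G by apply: measurable_bigprod.
have upd C l x : (if l \in A' then phi l else \1_(if l == l0 then C else B l)) x =
    if l == l0 then \1_C x else psi l x.
  by rewrite !inE; case: eqP => //= ->.
(* With an indicator at [l0] the induction hypothesis applies: against every event of the variable
   at [l0], the product [G] of the other factors integrates like the constant [c]. The weighted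
   extension then reaches [phi l0]. *)
have key C : measurable C ->
    (\int[P]_w (\1_C (X (iota l0) w) * G w)%:E =
     \int[P]_w (\1_C (X (iota l0) w) * c)%:E)%E.
  move=> mC.
  have mB' l : measurable (if l == l0 then C else B l) by case: ifP.
  have := IH A' _ nA' mB'.
  have -> : (fun w => (\prod_l (if l \in A' then phi l
        else \1_(if l == l0 then C else B l)) (X (iota l) w))%:E) =
      (fun w => (\1_C (X (iota l0) w) * G w)%:E).
    apply/funext => w; rewrite (bigD1 l0)//= upd eqxx; congr (_ * _)%:E.
    by apply: eq_bigr => l /negbTE ll0; rewrite upd ll0.
  move=> ->; rewrite (bigD1 l0)//=.
  have -> : (fun w => (if l0 \in A' then phi l0
      else \1_(if l0 == l0 then C else B l0)) (X (iota l0) w)) =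
      (fun w => \1_C (X (iota l0) w)) by apply/funext => w; rewrite upd eqxx.
  have [iC _] := Ex_indic_comp (iota l0) mC.
  under [in RHS]eq_integral do rewrite mulrC.
  rewrite ExE; last exact: L1Z.
  rewrite ExZ// mulrC; congr (_ * _)%:E.
  apply: eq_bigr => l /negbTE ll0; congr Ex; apply/funext => w.
  by rewrite upd ll0.
have := @ge0_integral_weighted_ext _ _ _ _ _ P (X (iota l0)) (X (iota l0)) G (cst c)
  (measurable_funPT _) mG G0 (measurable_funPT _) (measurable_cst _) (fun _ => c0) key
  (phi l0) (mphi l0) (phi0 l0).
have -> : (fun w => (phi l0 (X (iota l0) w) * G w)%:E) =
   (fun w => (\prod_l (if l \in A then phi l else \1_(B l)) (X (iota l) w))%:E).
  by apply/funext => w; rewrite [in RHS](bigD1 l0)//= l0A.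
move=> ->; under eq_integral do rewrite /= mulrC.
rewrite ExE; last exact/L1Z/iphi.
by rewrite ExZ// [in RHS](bigD1 l0)//= l0A mulrC.
Qed.

Lemma ge0_indep_prod (phi : L -> T' -> R) :
  (forall l, measurable_fun [set: T'] (phi l)) -> (forall l x, 0 <= phi l x) ->
  (forall l, L1 (fun w => phi l (X (iota l) w))) ->
  L1 (fun w => \prod_l phi l (X (iota l) w)) /\
  Ex (fun w => \prod_l phi l (X (iota l) w)) =
    \prod_l Ex (fun w => phi l (X (iota l) w)).
Proof.
move=> mphi phi0 iphi.
have := @indep_mixed finset.setT phi (fun=> setT) mphi phi0 iphi (fun=> measurableT).
under eq_integral do under eq_bigr do rewrite inE.
under [in RHS]eq_bigr do rewrite inE.
move=> h; split.
  apply/integrableP; split.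
    apply/measurable_EFinP/measurable_bigprod => l _.
    by apply: measurableT_comp => //; exact: measurable_funPT.
  under eq_integral do rewrite /= ger0_norm ?prodr_ge0//.
  by rewrite h ltry.
by rewrite /Ex /Rintegral h.
Qed.

(** Induction on the set of indices where the sign is not controlled: at one of them the function is
    split into its positive and negative parts. *)
Lemma indep_prod (phi : L -> T' -> R) :
  (forall l, measurable_fun [set: T'] (phi l)) ->
  (forall l, L1 (fun w => phi l (X (iota l) w))) ->
  L1 (fun w => \prod_l phi l (X (iota l) w)) /\
  Ex (fun w => \prod_l phi l (X (iota l) w)) =
    \prod_l Ex (fun w => phi l (X (iota l) w)).
Proof.
suff H (A : {set L}) : forall psi : L -> T' -> R,
  (forall l, measurable_fun [set: T'] (psi l)) ->
  (forall l, L1 (fun w => psi l (X (iota l) w))) ->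
  (forall l, l \notin A -> forall x, 0 <= psi l x) ->
  L1 (fun w => \prod_l psi l (X (iota l) w)) /\
  Ex (fun w => \prod_l psi l (X (iota l) w)) =
    \prod_l Ex (fun w => psi l (X (iota l) w)).
  by move=> mphi iphi; apply: (H finset.setT) => // l; rewrite inE.
have [n] := ubnP #|A|; elim: n A => // n IH A nA psi mpsi ipsi psi0.
have [A0|[l0 l0A]] := set_0Vmem A.
  by apply: ge0_indep_prod => // l x; apply: psi0; rewrite A0 inE.
have nA' : (#|A :\ l0| < n)%N by move: nA; rewrite (cardsD1 l0 A) l0A.
pose upd (g : T' -> R) l := if l == l0 then g else psi l.
have IHg (g : T' -> R) : measurable_fun [set: T'] g ->
    L1 (fun w => g (X (iota l0) w)) -> (forall x, 0 <= g x) ->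
    L1 (fun w => g (X (iota l0) w) * \prod_(l | l != l0) psi l (X (iota l) w)) /\
    Ex (fun w => g (X (iota l0) w) * \prod_(l | l != l0) psi l (X (iota l) w)) =
    Ex (fun w => g (X (iota l0) w)) * \prod_(l | l != l0) Ex (fun w => psi l (X (iota l) w)).
  move=> mg ig g0.
  have [||l|] := IH _ nA' (upd g).
  - by move=> l; rewrite /upd; case: ifP.
  - by move=> l; rewrite /upd; case: eqP => // ->.
  - by rewrite /upd !inE negb_and negbK; case: eqP => //= _ /psi0.
  have -> : (fun w => \prod_l upd g l (X (iota l) w)) =
     (fun w => g (X (iota l0) w) * \prod_(l | l != l0) psi l (X (iota l) w)).
    apply/funext => w; rewrite (bigD1 l0)//= {1}/upd eqxx; congr (_ * _).
    by apply: eq_bigr => l /negbTE ll0; rewrite /upd ll0.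
  move=> ? ->; split => //; rewrite (bigD1 l0)//= {1}/upd eqxx; congr (_ * _).
  by apply: eq_bigr => l /negbTE ll0; rewrite /upd ll0.
pose gp x := Num.max (psi l0 x) 0; pose gn x := Num.max (- psi l0 x) 0.
have gp0 x : 0 <= gp x by rewrite le_max lexx orbT.
have gn0 x : 0 <= gn x by rewrite le_max lexx orbT.
have gE x : psi l0 x = gp x - gn x.
  rewrite /gp /gn; have /orP[h|h] := le_total 0 (psi l0 x).
    by rewrite max_l// max_r ?subr0// oppr_le0.
  by rewrite max_r// max_l ?sub0r ?opprK// oppr_ge0.
have mgp : measurable_fun [set: T'] gp by apply: measurable_maxr => //; exact: measurable_cst.
have mgn : measurable_fun [set: T'] gn.
  by apply: measurable_maxr; [exact: measurable_funN|exact: measurable_cst].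
have mX : measurable_fun [set: T] (X (iota l0)) by exact: measurable_funPT.
have i0 := ipsi l0.
have igp : L1 (fun w => gp (X (iota l0) w)).
  apply: L1_le (L1_abs i0); first exact: measurableT_comp.
  by move=> w; rewrite ger0_norm// /gp ge_max ler_norm normr_ge0.
have ign : L1 (fun w => gn (X (iota l0) w)).
  apply: L1_le (L1_abs i0); first exact: measurableT_comp.
  by move=> w; rewrite ger0_norm// /gn ge_max -normrN ler_norm normr_ge0.
have [ip Ep] := IHg gp mgp igp gp0; have [iN En] := IHg gn mgn ign gn0.
have -> : (fun w => \prod_l psi l (X (iota l) w)) =
  (fun w => gp (X (iota l0) w) * \prod_(l | l != l0) psi l (X (iota l) w) -
            gn (X (iota l0) w) * \prod_(l | l != l0) psi l (X (iota l) w)).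
  by apply/funext => w; rewrite (bigD1 l0)//= gE mulrBl.
split; first exact: L1B.
rewrite ExB// Ep En -mulrBl -ExB// [in RHS](bigD1 l0)//=; congr (Ex _ * _).
by apply/funext => w; rewrite -gE.
Qed.

End Independence.

Section SameDistribution.
Context d d' (T : measurableType d) (T' : measurableType d') (R : realType)
  (P : probability T R) (X Y : T -> T').

Lemma same_distribution_Ex (phi : T' -> R) :
  measurable_fun [set: T] X -> measurable_fun [set: T] Y ->
  same_distribution P X Y -> measurable_fun [set: T'] phi ->
  L1 P (fun w => phi (X w)) ->
  L1 P (fun w => phi (Y w)) /\ Ex P (fun w => phi (Y w)) = Ex P (fun w => phi (X w)).
Proof.
move=> mX mY XY mphi iX.
have H (f : T' -> R) : measurable_fun setT f -> (forall x, 0 <= f x) ->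
    (\int[P]_w (f (X w))%:E = \int[P]_w (f (Y w))%:E)%E.
  move=> mf f0.
  have one (g : T' -> R) (Z : T -> T') : (fun w => (g (Z w) * cst 1 w)%:E) = (fun w => (g (Z w))%:E).
    by apply/funext => w /=; rewrite mulr1.
  have := @ge0_integral_weighted_ext _ _ _ _ _ P X Y (cst 1) (cst 1)
    mX (measurable_cst _) (fun _ => ler01) mY (measurable_cst _) (fun _ => ler01) _ f mf f0.
  rewrite !one; apply => B mB; rewrite !one.
  have ind (Z : T -> T') : measurable_fun setT Z ->
      (\int[P]_w (\1_B (Z w))%:E = P (Z @^-1` B))%E.
    move=> mZ; transitivity (\int[P]_w (\1_(Z @^-1` B) w)%:E)%E => //.
    by rewrite integral_indic ?setIT// -[_ @^-1` _]setTI; exact: mZ.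
  by rewrite !ind//; exact: XY.
have mabs : measurable_fun setT (fun x => `|phi x|) by exact: measurableT_comp.
have iY : L1 P (fun w => phi (Y w)).
  have /integrableP[_ fX] := iX; apply/integrableP; split.
    exact/measurable_EFinP/measurableT_comp.
  by move: fX; rewrite /= (H _ mabs (fun x => normr_ge0 _)).
split => //.
have mdiff : measurable_fun setT (fun x => `|phi x| - phi x) by exact: measurable_funB.
have diff0 x : 0 <= `|phi x| - phi x by rewrite subr_ge0 ler_norm.
have E Z : L1 P (fun w => phi (Z w)) -> Ex P (fun w => phi (Z w)) =
    Ex P (fun w => `|phi (Z w)|) - Ex P (fun w => `|phi (Z w)| - phi (Z w)).
  move=> iZ; rewrite -ExB; [|exact: L1_abs|exact/L1B/iZ/L1_abs].
  by congr Ex; apply/funext => w; rewrite subKr.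
rewrite !E// /Ex /Rintegral; congr (fine _ - fine _).
  by rewrite (H _ mabs (fun x => normr_ge0 _)).
by rewrite (H _ mdiff diff0).
Qed.

End SameDistribution.

Lemma prodr_exp_sum (R : comPzSemiRingType) (I : finType) (x : R) (F : I -> nat) :
  \prod_i x ^+ F i = x ^+ (\sum_i F i)%N.
Proof. by elim/big_rec2: _ => [|i n y _ ->]; rewrite ?expr0// exprD. Qed.

Lemma measurable_bigsum d (T : measurableType d) (R : realType) (I : Type)
    (r : seq I) (Q : pred I) (h : I -> T -> R) :
  (forall i, Q i -> measurable_fun [set: T] (h i)) ->
  measurable_fun [set: T] (fun w => \sum_(i <- r | Q i) h i w).
Proof.
move=> mh; elim: r => [|i r IH].
  by under eq_fun do rewrite big_nil; exact: measurable_cst.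
case Qi: (Q i); under eq_fun do rewrite big_cons Qi.
  by apply: measurable_funD => //; exact: mh.
exact: IH.
Qed.

(** * Moments of products over fibres *)

Section QuadraticForm.
Context d (T : measurableType d) (R : realType) (P : probability T R)
  (s : nat) (L : finType) (Z : {ffun 'I_s -> L} -> T -> R)
  (c : nat -> 'I_s -> L -> R) (K : R) (adm : rel {ffun 'I_s -> L}).
Context (Z2 : forall f, L2 P (Z f)) (ZK : forall f, Ex P (fun w => Z f w ^+ 2) <= K)
  (Zadm : forall f g, ~~ adm f g -> Ex P (fun w => Z f w * Z g w) = 0).

(** After expanding the square, every mixed moment is at most [K] in absolute value and only
    admissible pairs contribute. Absolute values of the coefficients are taken only once the
    orthogonality has been used. *)
Lemma Ex_quadratic_form (I : seq nat) :
  let S w := \sum_(k <- I) \sum_(f : {ffun 'I_s -> L}) (\prod_r c k r (f r)) * Z f w in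
  L2 P S /\
  Ex P (fun w => S w ^+ 2) <=
    K * \sum_(k <- I) \sum_(k' <- I)
      pair_sum (fun r l => `|c k r l|) (fun r l => `|c k' r l|) adm.
Proof.
move=> S.
have SL2 : L2 P S by do 2!apply: L2_sum => ? _; exact: L2Z.
split => //.
pose a (f : {ffun 'I_s -> L}) := \sum_(k <- I) \prod_r c k r (f r).
have SE : S = fun w => \sum_f a f * Z f w.
  apply/funext => w; rewrite /S exchange_big /=; apply: eq_bigr => f _.
  by rewrite mulr_suml.
have iZZ f g : L1 P (fun w => Z f w * Z g w) by exact: L2_L1M.
have -> : Ex P (fun w => S w ^+ 2) = \sum_f \sum_g a f * a g * Ex P (fun w => Z f w * Z g w).
  have -> : (fun w => S w ^+ 2) = (fun w => \sum_f \sum_g a f * a g * (Z f w * Z g w)).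
    apply/funext => w; rewrite SE expr2 mulr_suml; apply: eq_bigr => f _.
    by rewrite mulr_sumr; apply: eq_bigr => g _; ring.
  rewrite Ex_sum => [|f _]; last by apply: L1_sum => g _; exact: L1Z.
  apply: eq_bigr => f _; rewrite Ex_sum => [|g _]; last exact: L1Z.
  by apply: eq_bigr => g _; rewrite ExZ.
have Zfg f g : `|Ex P (fun w => Z f w * Z g w)| <= K by exact: Ex_mul_le.
have K0 (f : {ffun 'I_s -> L}) : 0 <= K by exact: le_trans (normr_ge0 _) (Zfg f f).
pose b k (f : {ffun 'I_s -> L}) := \prod_r `|c k r (f r)|.
apply: (@le_trans _ _ (\sum_f \sum_(g | adm f g) K * (\sum_(k <- I) b k f) * \sum_(k <- I) b k g)).
  apply: ler_sum => f _; rewrite [leRHS]big_mkcond; apply: ler_sum => g _.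
  case: ifPn => [fg|/Zadm ->]; last by rewrite mulr0.
  apply: le_trans (ler_norm _) _; rewrite !normrM mulrC -mulrA.
  have ab h : `|a h| <= \sum_(k <- I) b k h.
    apply: le_trans (ler_norm_sum _ _ _) _; apply: ler_sum => k _.
    by rewrite normr_prod.
  by apply: ler_pM => //; rewrite ?mulr_ge0// ler_pM.
rewrite mulr_sumr.
under eq_bigr do under eq_bigr do rewrite -mulrA big_distrlr /= mulr_sumr.
under eq_bigr do rewrite exchange_big /=.
rewrite exchange_big /=; apply: ler_sum => k _.
under eq_bigr do under eq_bigr do rewrite mulr_sumr.
under eq_bigr do rewrite exchange_big /=.
rewrite exchange_big /= mulr_sumr; apply: ler_sum => k' _.
rewrite /pair_sum mulr_sumr; apply: ler_sum => f _.
by rewrite mulr_sumr; apply: ler_sum => g _.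
Qed.

End QuadraticForm.

Section Blocks.
Context d (T : measurableType d) (R : realType) (P : probability T R)
  (s : nat) (L : finType) (X1 : T -> s.-tuple R) (X : L -> T -> s.-tuple R).
Context (mX : forall l, measurable_fun [set: T] (X l)).
Local Notation L1 := (L1 P).
Local Notation L2 := (L2 P).
Local Notation Ex := (Ex P).
Context (prodX : forall phi : L -> s.-tuple R -> R,
  (forall l, measurable_fun [set: s.-tuple R] (phi l)) ->
  (forall l, L1 (fun w => phi l (X1 w))) ->
  L1 (fun w => \prod_l phi l (X l w)) /\
  Ex (fun w => \prod_l phi l (X l w)) = \prod_l Ex (fun w => phi l (X1 w))).
Implicit Types (f g : {ffun 'I_s -> L}) (l : L) (B : {set 'I_s})
  (phi psi : {set 'I_s} -> s.-tuple R -> R).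

(** [phi] attaches to each block the variable that stands for the product of innovations over it:
    the product itself, its truncated mean or its centred truncation. The empty block must give 1
    since most fibres are empty, and the powers of [K] multiply to [K ^+ s] along the fibres. *)
Definition block_bound (K V : R) phi :=
  [/\ phi finset.set0 = (fun=> 1),
      forall B, measurable_fun [set: s.-tuple R] (phi B),
      forall B, L2 (fun w => phi B (X1 w)) &
      forall B, Ex (fun w => phi B (X1 w) ^+ 2) <=
                K ^+ #|B| * (if heavy B then V else 1)].

Definition block_prod phi f w := \prod_l phi (fibre f l) (X l w).

Lemma block_prod_measurable K V phi f : block_bound K V phi ->
  measurable_fun [set: T] (block_prod phi f).
Proof.
case=> _ mphi _ _; apply: measurable_bigprod => l _.
exact: measurableT_comp.
Qed.

Lemma block_prod_mean K V phi f : block_bound K V phi ->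
  L1 (block_prod phi f) /\
  Ex (block_prod phi f) = \prod_l Ex (fun w => phi (fibre f l) (X1 w)).
Proof.
case=> _ mphi iphi _; apply: (prodX (phi := fun l => phi (fibre f l))) => // l.
exact: L2_L1.
Qed.

Lemma block_prod_mul K V K' V' phi psi f g :
  block_bound K V phi -> block_bound K' V' psi ->
  L1 (fun w => block_prod phi f w * block_prod psi g w) /\
  Ex (fun w => block_prod phi f w * block_prod psi g w) =
  \prod_l Ex (fun w => phi (fibre f l) (X1 w) * psi (fibre g l) (X1 w)).
Proof.
case=> _ mphi iphi _ [_ mpsi ipsi _].
have -> : (fun w => block_prod phi f w * block_prod psi g w) =
   (fun w => \prod_l (phi (fibre f l) (X l w) * psi (fibre g l) (X l w))).
  by apply/funext => w; rewrite /block_prod big_split.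
apply: (prodX (phi := fun l x => phi (fibre f l) x * psi (fibre g l) x)) => l.
  exact: measurable_funM.
exact: L2_L1M.
Qed.

Lemma block_prod_L2 K V phi f : 1 <= V -> 0 <= K -> block_bound K V phi ->
  L2 (block_prod phi f) /\ Ex (fun w => block_prod phi f w ^+ 2) <= K ^+ s * V.
Proof.
move=> V1 K0 bphi; have [i E] := block_prod_mul f f bphi bphi.
have sq : (fun w => block_prod phi f w ^+ 2) =
    (fun w => block_prod phi f w * block_prod phi f w).
  by apply/funext => w; rewrite expr2.
split; first by split; [exact: block_prod_measurable bphi|rewrite sq].
rewrite sq E; case: bphi => _ _ _ bphi.
apply: (@le_trans _ _ (\prod_l (K ^+ #|fibre f l| * (if heavy (fibre f l) then V else 1)))).
  apply: ler_prod => l _; apply/andP; split.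
    by apply: Ex_ge0 => w; rewrite -expr2 sqr_ge0.
  by under [X in Ex X]eq_fun do rewrite -expr2; exact: bphi.
rewrite big_split /= prodr_exp_sum sum_card_fibre ler_wpM2l ?exprn_ge0//.
(* At most one fibre is heavy, so [V] enters at most once. *)
have [l hl|no] := pickP (fun l => heavy (fibre f l)).
  rewrite (bigD1 l)//= hl big1 ?mulr1// => l' ll'.
  by case: ifP => // hl'; rewrite (heavy_unique hl hl') eqxx in ll'.
by rewrite big1// => l _; rewrite no.
Qed.

Let Ex_one : Ex (fun=> 1) = 1. Proof. exact: Ex_cst. Qed.

(** The product of the means vanishes together with the mixed moment, so that centring the terms
    preserves orthogonality. *)
Lemma block_prod_orthogonal K V phi f g : block_bound K V phi ->
  (forall r, Ex (fun w => phi [set r]%SET (X1 w)) = 0) -> ~~ no_singleton f g ->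
  Ex (fun w => block_prod phi f w * block_prod phi g w) = 0 /\
  Ex (block_prod phi f) * Ex (block_prod phi g) = 0.
Proof.
move=> bphi single /forallPn[l]; rewrite negbK => /eqP fg1.
have [_ ->] := block_prod_mul f g bphi bphi.
have [_ ->] := block_prod_mean f bphi; have [_ ->] := block_prod_mean g bphi.
case: bphi => phi0 _ _ _.
have [[f1 g0]|[f0 g1]] : (#|fibre f l| = 1%N /\ #|fibre g l| = 0%N) \/
    (#|fibre f l| = 0%N /\ #|fibre g l| = 1%N).
- by move: fg1; case: #|fibre f l| => [|[|n]] fg1; [right; split; lia|left; split; lia|exfalso; lia].
- move/eqP: f1 => /cards1P[r fr]; move/eqP: g0; rewrite cards_eq0 => /eqP g0.
  have E : Ex (fun w => phi (fibre f l) (X1 w)) = 0 by rewrite fr single.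
  split; last by rewrite (bigD1 l)//= E !mul0r.
  apply/eqP/prodf_eq0; exists l => //; rewrite g0 phi0.
  by under [X in Ex X]eq_fun do rewrite mulr1; rewrite E.
- move/eqP: g1 => /cards1P[r gr]; move/eqP: f0; rewrite cards_eq0 => /eqP f0.
  have E : Ex (fun w => phi (fibre g l) (X1 w)) = 0 by rewrite gr single.
  split; last by rewrite [X in _ * X](bigD1 l)//= E !mul0r mulr0.
  apply/eqP/prodf_eq0; exists l => //; rewrite f0 phi0.
  by under [X in Ex X]eq_fun do rewrite mul1r; rewrite E.
Qed.

Lemma block_prod_parity K V phi f g : block_bound K V phi ->
  (forall B B', odd (#|B| + #|B'|)%N -> Ex (fun w => phi B (X1 w) * phi B' (X1 w)) = 0) ->
  ~~ even_fibres f g ->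
  Ex (fun w => block_prod phi f w * block_prod phi g w) = 0 /\
  Ex (block_prod phi f) * Ex (block_prod phi g) = 0.
Proof.
move=> bphi par /forallPn[l]; rewrite negbK => fgo.
have [_ ->] := block_prod_mul f g bphi bphi.
have [_ ->] := block_prod_mean f bphi; have [_ ->] := block_prod_mean g bphi.
case: bphi => phi0 _ _ _.
have par1 B : odd #|B| -> Ex (fun w => phi B (X1 w)) = 0.
  move=> oB; have := par B finset.set0; rewrite cards0 addn0 => /(_ oB).
  by under eq_fun do rewrite phi0 mulr1.
split; first by apply/eqP/prodf_eq0; exists l => //; apply/eqP/par.
rewrite -big_split /=; apply/eqP/prodf_eq0; exists l => //.
move: fgo; rewrite oddD; case fo: (odd #|fibre f l|) => /= go.
  by rewrite par1// mul0r.
by rewrite [X in _ * X]par1// mulr0.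
Qed.

(** At every site one of the two fibres is empty and contributes 1, so the expectation factorizes
    site by site. *)
Lemma block_prod_unlinked K V phi f g : block_bound K V phi -> ~~ linked f g ->
  Ex (fun w => block_prod phi f w * block_prod phi g w) =
  Ex (block_prod phi f) * Ex (block_prod phi g).
Proof.
move=> bphi nl.
have [_ ->] := block_prod_mul f g bphi bphi.
have [_ ->] := block_prod_mean f bphi; have [_ ->] := block_prod_mean g bphi.
case: bphi => phi0 _ _ _.
rewrite -big_split /=; apply: eq_bigr => l _.
have [->|[r fr]] := set_0Vmem (fibre f l).
  by rewrite phi0 Ex_one mul1r; under eq_fun do rewrite mul1r.
have [->|[r' gr']] := set_0Vmem (fibre g l).
  by rewrite phi0 Ex_one mulr1; under eq_fun do rewrite mulr1.
case/negP: nl; apply/existsP; exists r; apply/existsP; exists r'.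
by move: fr gr'; rewrite !inE => /eqP -> /eqP ->.
Qed.

Lemma Ex_centered_form K phi (c : nat -> 'I_s -> L -> R) (I : seq nat)
    (adm : rel {ffun 'I_s -> L}) :
  0 <= K -> block_bound K 1 phi ->
  (forall f g, ~~ adm f g ->
    Ex (fun w => block_prod phi f w * block_prod phi g w) = 0 /\
    Ex (block_prod phi f) * Ex (block_prod phi g) = 0) ->
  let S w := \sum_(k <- I) \sum_(f : {ffun 'I_s -> L})
    (\prod_r c k r (f r)) * (block_prod phi f w - Ex (block_prod phi f)) in
  L2 S /\ Ex (fun w => S w ^+ 2) <= K ^+ s *
    \sum_(k <- I) \sum_(k' <- I) pair_sum (fun r l => `|c k r l|)
      (fun r l => `|c k' r l|) (fun f g => adm f g && linked f g).
Proof.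
move=> K0 bphi Hadm.
have Y2 f := block_prod_L2 f (lexx 1) K0 bphi.
have iY f := L2_L1 (Y2 f).1.
have iYY f g := L2_L1M (Y2 f).1 (Y2 g).1.
have cov f g : Ex (fun w => (block_prod phi f w - Ex (block_prod phi f)) *
      (block_prod phi g w - Ex (block_prod phi g))) =
    Ex (fun w => block_prod phi f w * block_prod phi g w) -
    Ex (block_prod phi f) * Ex (block_prod phi g).
  set a := Ex (block_prod phi f); set b := Ex (block_prod phi g).
  have -> : (fun w => (block_prod phi f w - a) * (block_prod phi g w - b)) =
    (fun w => block_prod phi f w * block_prod phi g w -
      (b * block_prod phi f w + (a * block_prod phi g w - a * b))).
    by apply/funext => w; ring.
  rewrite ExB//; last by apply/L1D/L1B/L1_cst; exact: L1Z.
  rewrite ExD; [|exact: L1Z|by apply/L1B/L1_cst; exact: L1Z].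
  rewrite ExB; [|exact: L1Z|exact: L1_cst].
  by rewrite (ExZ _ (iY f)) (ExZ _ (iY g)) Ex_cst -/a -/b; ring.
apply: Ex_quadratic_form => [f|f|f g].
- by apply: L2B; [exact: (Y2 f).1|exact: L2_cst].
- under [X in Ex X]eq_fun do rewrite expr2.
  rewrite cov; apply: (@le_trans _ _ (Ex (fun w => block_prod phi f w ^+ 2))).
    under [X in _ <= Ex X]eq_fun do rewrite expr2.
    by rewrite lerBlDr lerDl -expr2 sqr_ge0.
  by have [_] := Y2 f; rewrite mulr1.
- rewrite negb_and cov => /orP[/Hadm[-> ->]|/(block_prod_unlinked bphi) ->].
    by rewrite subr0.
  by rewrite subrr.
Qed.

Lemma Ex_form K V phi (c : 'I_s -> L -> R) :
  0 <= K -> 1 <= V -> block_bound K V phi ->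
  (forall r, Ex (fun w => phi [set r]%SET (X1 w)) = 0) ->
  let S w := \sum_(f : {ffun 'I_s -> L}) (\prod_r c r (f r)) * block_prod phi f w in
  L2 S /\ Ex (fun w => S w ^+ 2) <= K ^+ s * V *
     pair_sum (fun r l => `|c r l|) (fun r l => `|c r l|) (@no_singleton s L).
Proof.
move=> K0 V1 bphi single.
have Y2 f := block_prod_L2 f V1 K0 bphi.
have := @Ex_quadratic_form _ _ _ P s L (block_prod phi) (fun=> c) (K ^+ s * V)
  (@no_singleton s L) (fun f => (Y2 f).1) (fun f => (Y2 f).2)
  (fun f g ns => (block_prod_orthogonal bphi single ns).1) [:: 0%N].
rewrite !big_seq1 /=.
by under [X in L2 X /\ _]eq_fun do rewrite big_seq1;
  under [X in _ /\ Ex X <= _]eq_fun do rewrite big_seq1.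
Qed.

Definition has_heavy f := [exists l, heavy (fibre f l)].

Lemma Ex_heavy_form K V phi (c : nat -> 'I_s -> L -> R) (I : seq nat) :
  0 <= K -> 1 <= V -> block_bound K V phi ->
  (forall r, Ex (fun w => phi [set r]%SET (X1 w)) = 0) ->
  (forall B, heavy B -> Ex (fun w => phi B (X1 w)) = 0) ->
  let S w := \sum_(k <- I) \sum_(f : {ffun 'I_s -> L})
     (\prod_r c k r (f r)) * ((has_heavy f)%:R * block_prod phi f w) in
  L2 S /\ Ex (fun w => S w ^+ 2) <= K ^+ s * V *
    \sum_(k <- I) \sum_(k' <- I) pair_sum (fun r l => `|c k r l|)
      (fun r l => `|c k' r l|) (@heavy_linked s L).
Proof.
move=> K0 V1 bphi single hmean.
have Y2 f := block_prod_L2 f V1 K0 bphi.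
have KV0 : 0 <= K ^+ s * V by rewrite mulr_ge0 ?exprn_ge0// (le_trans ler01).
apply: Ex_quadratic_form => [f|f|f g].
- exact/L2Z/(Y2 f).1.
- case: has_heavy.
    by under eq_fun do rewrite mul1r; exact: (Y2 f).2.
  by under eq_fun do rewrite mul0r expr0n; rewrite Ex_cst.
- have iYY := L2_L1M (Y2 f).1 (Y2 g).1.
  have -> : (fun w => (has_heavy f)%:R * block_prod phi f w *
      ((has_heavy g)%:R * block_prod phi g w)) =
     (fun w => ((has_heavy f)%:R * (has_heavy g)%:R) *
       (block_prod phi f w * block_prod phi g w)).
    by apply/funext => w; ring.
  rewrite ExZ//.
  case hf: (has_heavy f); last by rewrite !mul0r.
  case hg: (has_heavy g); last by rewrite mulr0 mul0r.
  rewrite !mul1r !negb_and => /or3P[ns|fl|gl].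
  + by have [] := block_prod_orthogonal bphi single ns.
  + have [_ ->] := block_prod_mul f g bphi bphi.
    move/existsP: hf => [l hl]; move/existsPn: fl => /(_ l); rewrite hl /= negbK => /eqP g0.
    apply/eqP/prodf_eq0; exists l => //; rewrite g0; case: bphi => -> _ _ _.
    by under eq_fun do rewrite mulr1; rewrite hmean.
  + have [_ ->] := block_prod_mul f g bphi bphi.
    move/existsP: hg => [l hl]; move/existsPn: gl => /(_ l); rewrite hl /= negbK => /eqP f0.
    apply/eqP/prodf_eq0; exists l => //; rewrite f0; case: bphi => -> _ _ _.
    by under eq_fun do rewrite mul1r; rewrite hmean.
Qed.

Lemma Ex_site l (phi : s.-tuple R -> R) : measurable_fun [set: s.-tuple R] phi ->
  L1 (fun w => phi (X1 w)) ->
  L1 (fun w => phi (X l w)) /\ Ex (fun w => phi (X l w)) = Ex (fun w => phi (X1 w)).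
Proof.
move=> mphi iphi.
pose ph l' x := if l' == l then phi x else 1.
have [l'|l'|i E] := prodX (phi := ph).
- by rewrite /ph; case: eqP.
- by rewrite /ph; case: eqP => // _; exact: L1_cst.
have -> : (fun w => phi (X l w)) = (fun w => \prod_l' ph l' (X l' w)).
  apply/funext => w; rewrite (bigD1 l)//= {1}/ph eqxx big1 ?mulr1// => l' /negbTE ll'.
  by rewrite /ph ll'.
split => //; rewrite E (bigD1 l)//= {1}/ph eqxx big1 ?mulr1// => l' /negbTE ll'.
by rewrite /ph ll'.
Qed.

(** * L1 bound for the truncation remainder *)

Section Remainder.
Context (K rho : R) (zr : {set 'I_s} -> s.-tuple R -> R) (c : 'I_s -> L -> R)
  (kappa : 'I_s -> R).
Context (K1 : 1 <= K) (rho0 : 0 <= rho) (zr0 : zr finset.set0 = (fun=> 1))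
  (mzr : forall B, measurable_fun [set: s.-tuple R] (zr B))
  (light2 : forall B, ~~ heavy B -> L2 (fun w => zr B (X1 w)))
  (lightK : forall B, ~~ heavy B -> Ex (fun w => zr B (X1 w) ^+ 2) <= K ^+ #|B|)
  (heavy1 : forall B, heavy B -> L1 (fun w => zr B (X1 w)))
  (heavyrho : forall B, heavy B -> Ex (fun w => `|zr B (X1 w)|) <= rho)
  (single : forall r, Ex (fun w => zr [set r]%SET (X1 w)) = 0)
  (kappa0 : forall r, 0 < kappa r)
  (ckappa : forall r, \sum_l c r l ^+ 2 <= kappa r ^+ 2).

Let C0 : R := (#|{: 'I_s + 'I_s}| ^ #|{: 'I_s + 'I_s}|)%:R.

Let K0 : 0 <= K. Proof. exact: le_trans K1. Qed.

Section OneHeavyFibre.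
Context (l : L) (B : {set 'I_s}) (hB : heavy B).

(** With the fibre over [l] fixed to be [B], a term factors into its heavy block at [l] and products
    of light blocks at the other sites, which are independent of it; [G] collects the latter with
    their coefficients. *)
Let rest f w := \prod_(l' | l' != l) zr (fibre f l') (X l' w).
Let m f := \prod_(r | r \notin B) c r (f r).
Let G w := \sum_(f : {ffun 'I_s -> L} | fibre f l == B) m f * rest f w.
Let ku r := if r \in B then 1 else kappa r.

Let light_off f l' : fibre f l == B -> l' != l -> ~~ heavy (fibre f l').
Proof.
move=> /eqP fB; apply: contraNN => hl'.
by apply/eqP/(@heavy_unique _ _ f) => //; rewrite fB.
Qed.

Let ku0 r : 0 < ku r. Proof. by rewrite /ku; case: ifP. Qed.

Let Ex_term f g : fibre f l == B -> fibre g l == B ->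
  L1 (fun w => `|zr B (X l w)| * (rest f w * rest g w)) /\
  `|Ex (fun w => `|zr B (X l w)| * (rest f w * rest g w))| <=
    rho * K ^+ (s + s) * (no_singleton f g)%:R.
Proof.
move=> fB gB.
pose ph l' x := if l' == l then `|zr B x| else zr (fibre f l') x * zr (fibre g l') x.
have mabs : measurable_fun setT (fun x => `|zr B x|) by exact: measurableT_comp.
have [l'|l'|i E] := prodX (phi := ph).
- by rewrite /ph; case: eqP => // _; exact: measurable_funM.
- rewrite /ph; case: eqP => [_|/eqP ll']; first exact/L1_abs/heavy1.
  by apply: L2_L1M; apply: light2; exact: light_off.
have e : (fun w => `|zr B (X l w)| * (rest f w * rest g w)) =
    (fun w => \prod_l' ph l' (X l' w)).
  apply/funext => w; rewrite (bigD1 l)//= {1}/ph eqxx; congr (_ * _).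
  rewrite /rest -big_split; apply: eq_bigr => l' /negbTE ll'.
  by rewrite /ph ll'.
rewrite e; split => //; rewrite E (bigD1 l)//= {1}/ph eqxx.
have -> : \prod_(l' | l' != l) Ex (fun w => ph l' (X1 w)) =
   \prod_(l' | l' != l) Ex (fun w => zr (fibre f l') (X1 w) * zr (fibre g l') (X1 w)).
  by apply: eq_bigr => l' /negbTE ll'; rewrite /ph ll'.
case: (boolP (no_singleton f g)) => [_|/forallPn[l1]].
  rewrite mulr1 normrM.
  rewrite ler_pM// ?normr_ge0//.
    by rewrite ger0_norm ?heavyrho// Ex_ge0.
  have -> : K ^+ (s + s) = \prod_l' (K ^+ #|fibre f l'| * K ^+ #|fibre g l'|).
    by rewrite big_split /= !prodr_exp_sum !sum_card_fibre exprD.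
  rewrite normr_prod.
  rewrite [leRHS](bigD1 l)//= [leLHS]big_mkcond/= [leLHS](bigD1 l)//= eqxx /=.
  apply: ler_pM => //.
  + by apply: prodr_ge0 => l' _; case: ifP.
  + by rewrite -exprD exprn_ege1.
  apply: ler_prod => l' ll'; rewrite ll' normr_ge0 /=.
  apply: Ex_mul_le; [exact/light2/light_off|exact/light2/light_off| |].
    apply: le_trans (lightK (light_off fB ll')) _.
    by rewrite ler_peMr ?exprn_ge0 ?exprn_ege1.
  apply: le_trans (lightK (light_off gB ll')) _.
  by rewrite ler_peMl ?exprn_ge0 ?exprn_ege1.
rewrite negbK mulr0 => /eqP fg1.
(* Both fibres at [l] equal [B], of combined size at least 4; the singleton therefore sits at
   another site, where the factor has mean zero. *)
have l1l : l1 != l.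
  apply: contra_eqN fg1 => /eqP ->; rewrite (eqP fB) (eqP gB).
  by move: hB => /andP[]; move: #|B| => n; lia.
have sz (A A' : {set 'I_s}) : (#|A| + #|A'|)%N = 1%N ->
    Ex (fun w => zr A (X1 w) * zr A' (X1 w)) = 0.
  move=> AA1; have [[f1 g0]|[f0 g1]] : (#|A| = 1%N /\ #|A'| = 0%N) \/ (#|A| = 0%N /\ #|A'| = 1%N).
  - by move: AA1; case: #|A| => [|[|n]] h; [right; split; lia|left; split; lia|exfalso; lia].
  - move/eqP: f1 => /cards1P[r ->]; move/eqP: g0; rewrite cards_eq0 => /eqP ->.
    by rewrite zr0; under eq_fun do rewrite mulr1; exact: single.
  - move/eqP: g1 => /cards1P[r ->]; move/eqP: f0; rewrite cards_eq0 => /eqP ->.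
    by rewrite zr0; under eq_fun do rewrite mul1r; exact: single.
by rewrite [X in _ * X](bigD1 l1)//= sz// mul0r mulr0 normr0.
Qed.

Let H w := `|zr B (X l w)| * G w ^+ 2.

Let HE : H = fun w => \sum_(f : {ffun 'I_s -> L} | fibre f l == B)
  \sum_(g : {ffun 'I_s -> L} | fibre g l == B)
    m f * m g * (`|zr B (X l w)| * (rest f w * rest g w)).
Proof.
apply/funext => w; rewrite /H expr2 {1}/G mulr_suml mulr_sumr; apply: eq_bigr => f _.
by rewrite /G !mulr_sumr; apply: eq_bigr => g _; ring.
Qed.

Let Ex_H : L1 H /\ Ex H <= rho * K ^+ (s + s) * (C0 * (\prod_r ku r) ^+ 2).
Proof.
have iH : L1 H.
  rewrite HE; apply: L1_sum => f fB; apply: L1_sum => g gB; apply: L1Z.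
  by have [] := Ex_term fB gB.
split => //; rewrite HE Ex_sum => [|f fB]; last first.
  by apply: L1_sum => g gB; apply: L1Z; have [] := Ex_term fB gB.
(* Indicator weights pin the coordinates of [B] at [l], so the sum over functions with fibre [B]
   there becomes part of an unrestricted pair sum. *)
pose u (r : 'I_s) (l' : L) : R := if r \in B then (l' == l)%:R else `|c r l'|.
have u0 r l' : 0 <= u r l' by rewrite /u; case: ifP.
have uk r : \sum_l' u r l' ^+ 2 <= ku r ^+ 2.
  rewrite /u /ku; case: ifP => _.
    by rewrite (bigD1 l)//= eqxx big1 ?addr0// => l' /negbTE ->; rewrite expr0n.
  by under eq_bigr do rewrite real_normK ?num_real//; exact: ckappa.
have um f : fibre f l == B -> \prod_r u r (f r) = `|m f|.
  move=> /eqP fB; rewrite normr_prod (bigID [in B]) /= big1 ?mul1r => [|r rB].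
    by apply: eq_bigr => r /negbTE rB; rewrite /u rB.
  by rewrite /u rB; move: rB; rewrite -fB inE => ->.
have uu0 f : 0 <= \prod_r u r (f r) by exact: prodr_ge0.
have ns := @pair_sum_no_singleton R s L u u u0 u0 ku ku
  (fun r => ltW (ku0 r)) (fun r => ltW (ku0 r)) uk uk.
rewrite -expr2 -/C0 in ns.
have rK : 0 <= rho * K ^+ (s + s) by rewrite mulr_ge0 ?exprn_ge0.
apply: le_trans (ler_wpM2l rK ns); rewrite /pair_sum mulr_sumr big_mkcond.
apply: ler_sum => f _; case: ifP => fB; last first.
  by rewrite mulr_ge0// sumr_ge0// => g _; rewrite mulr_ge0.
rewrite Ex_sum => [|g gB]; last by apply: L1Z; have [] := Ex_term fB gB.
rewrite mulr_sumr big_mkcond [leRHS]big_mkcond; apply: ler_sum => g _.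
case: ifP => gB; last first.
  by case: ifP => // _; apply: mulr_ge0 => //; apply: mulr_ge0.
have [it Et] := Ex_term fB gB; rewrite ExZ//.
apply: le_trans (ler_norm _) _; rewrite !normrM.
rewrite -(um f fB) -(um g gB) in Et *.
case: ifP Et => ns'; rewrite ?mulr1 ?mulr0 => Et.
  by rewrite [leLHS]mulrC; apply: ler_pM => //; exact: mulr_ge0.
by rewrite mulr_ge0_le0//; exact: mulr_ge0.
Qed.

Let a := \prod_(r in B) c r l.

(** The heavy factor is only integrable, so it serves as a weight:
    [|G| <= (lam + lam^-1 * G ^ 2) / 2] is integrated against [|zr B|], with [lam] the product of
    the l2 bounds that controls the size of [G]. *)
Lemma Ex_one_heavy_fibre :
  let F w := \sum_(f : {ffun 'I_s -> L} | fibre f l == B)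
    (\prod_r c r (f r)) * block_prod zr f w in
  L1 F /\ Ex (fun w => `|F w|) <=
    `|a| * (\prod_r ku r) * (rho * (1 + K ^+ (s + s) * C0)).
Proof.
move=> F.
have FE w : F w = a * (zr B (X l w) * G w).
  rewrite /F /G !mulr_sumr; apply: eq_bigr => f /eqP fB.
  rewrite /block_prod (bigD1 l)//= fB (bigID [in B])/=.
  have -> : \prod_(r in B) c r (f r) = a.
    by apply: eq_bigr => r; rewrite -fB inE => /eqP ->.
  by rewrite /m /rest; ring.
have [iH EH] := Ex_H.
set lam := \prod_r ku r.
have lam0 : 0 < lam by apply: prodr_gt0.
have [iz Ez] := Ex_site l (measurableT_comp (@normr_measurable R setT) (mzr B)) (L1_abs (heavy1 hB)).
have mG : measurable_fun [set: T] G.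
  apply: measurable_bigsum => f _; apply: measurable_funM => //.
  by apply: measurable_bigprod => l' _; exact: measurableT_comp.
have iB : L1 (fun w => `|a| * (2^-1 * (lam * `|zr B (X l w)| + lam^-1 * H w))).
  by do 2!apply: L1Z; apply: L1D; exact: L1Z.
have Fle w : `|F w| <= `|a| * (2^-1 * (lam * `|zr B (X l w)| + lam^-1 * H w)).
  rewrite FE !normrM ler_wpM2l// /H -(real_normK (num_real (G w))).
  move: `|G w| (normr_ge0 (G w)) => y y0.
  have -> : 2^-1 * (lam * `|zr B (X l w)| + lam^-1 * (`|zr B (X l w)| * y ^+ 2)) =
    `|zr B (X l w)| * ((lam^-1 * (y - lam) ^+ 2) / 2 + y).
    by field; rewrite gt_eqF.
  rewrite ler_wpM2l// lerDr mulr_ge0// mulr_ge0 ?sqr_ge0// invr_ge0 ltW//.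
have mF : measurable_fun [set: T] F.
  by rewrite (funext FE); apply/measurable_funM/measurable_funM => //; exact: measurableT_comp.
have iF : L1 F by apply: L1_le Fle iB.
split => //; apply: le_trans (Ex_le (L1_abs iF) iB Fle) _.
rewrite !ExZ ?ExD; try by do ?[apply: L1Z|apply: L1D].
rewrite !ExZ// Ez -mulrA ler_wpM2l//.
have zrho := heavyrho hB.
apply: (@le_trans _ _ (2^-1 * (lam * rho + lam^-1 * (rho * K ^+ (s + s) * (C0 * lam ^+ 2))))).
  by rewrite ler_wpM2l// lerD// ler_wpM2l// ?invr_ge0 ltW.
have -> : 2^-1 * (lam * rho + lam^-1 * (rho * K ^+ (s + s) * (C0 * lam ^+ 2))) =
  2^-1 * (lam * (rho * (1 + K ^+ (s + s) * C0))) by field; rewrite gt_eqF.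
have : 0 <= lam * (rho * (1 + K ^+ (s + s) * C0)).
  apply: mulr_ge0; first exact: ltW.
  by apply: mulr_ge0 => //; rewrite addr_ge0// mulr_ge0 ?exprn_ge0// ler0n.
lra.
Qed.

End OneHeavyFibre.

Lemma Ex_remainder :
  let S w := \sum_(f : {ffun 'I_s -> L} | has_heavy f)
    (\prod_r c r (f r)) * block_prod zr f w in
  L1 S /\ Ex (fun w => `|S w|) <=
    #|{set 'I_s}|%:R * (\prod_r kappa r) * (rho * (1 + K ^+ (s + s) * C0)).
Proof.
move=> S.
pose F l B w := \sum_(f : {ffun 'I_s -> L} | fibre f l == B)
    (\prod_r c r (f r)) * block_prod zr f w.
(* A function has at most one heavy fibre, so grouping by its location and its set counts each
   function once. *)
have SE w : S w = \sum_(B | heavy B) \sum_l F l B w.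
  rewrite exchange_big /=.
  transitivity (\sum_l \sum_(f : {ffun 'I_s -> L} | heavy (fibre f l))
    (\prod_r c r (f r)) * block_prod zr f w).
    rewrite (exchange_big_dep has_heavy) /=; last first.
      by move=> l f _ hf; apply/existsP; exists l.
    apply: eq_bigr => f /existsP[l hl].
    rewrite [RHS](bigD1 l)//= [X in _ + X]big1 ?addr0//.
    by move=> l' /andP[hl']; rewrite (heavy_unique hl' hl) eqxx.
  apply: eq_bigr => l _; rewrite (partition_big (fun f => fibre f l) (@heavy s))//=.
  apply: eq_bigr => B hB; apply: eq_bigl => f.
  by apply: andb_idl => /eqP ->.
have iF l B : heavy B -> L1 (F l B) by move=> hB; have [] := @Ex_one_heavy_fibre l B hB.
have cle r l : `|c r l| <= kappa r.
  rewrite -(@ler_pXn2r _ 2)// ?nnegrE ?(ltW (kappa0 r))// real_normK ?num_real//.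
  apply: le_trans (ckappa r); rewrite (bigD1 l)//= ler_wpDr// sumr_ge0// => l' _.
  exact: sqr_ge0.
rewrite (funext SE); split.
  by apply: L1_sum => B hB; apply: L1_sum => l _; exact: iF.
set D := rho * (1 + K ^+ (s + s) * C0).
have D0 : 0 <= D by apply: mulr_ge0 => //; rewrite addr_ge0// mulr_ge0 ?exprn_ge0// ler0n.
have pk : 0 <= \prod_r kappa r by apply: prodr_ge0 => r _; exact: ltW.
apply: (@le_trans _ _ (\sum_(B | heavy B) \sum_l Ex (fun w => `|F l B w|))).
  have -> : \sum_(B | heavy B) \sum_l Ex (fun w => `|F l B w|) =
      Ex (fun w => \sum_(B | heavy B) \sum_l `|F l B w|).
    rewrite Ex_sum => [|B hB]; last by apply: L1_sum => l _; exact/L1_abs/iF.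
    apply: eq_bigr => B hB; rewrite Ex_sum => [//|l _]; exact/L1_abs/iF.
  apply: Ex_le.
  - by apply/L1_abs/L1_sum => B hB; apply: L1_sum => l _; exact: iF.
  - by apply: L1_sum => B hB; apply: L1_sum => l _; exact/L1_abs/iF.
  - move=> w; apply: le_trans (ler_norm_sum _ _ _) _.
    by apply: ler_sum => B _; exact: ler_norm_sum.
apply: (@le_trans _ _ (\sum_(B : {set 'I_s}) (\prod_r kappa r) * D)); last first.
  by rewrite sumr_const -[leLHS]mulr_natl mulrA.
rewrite big_mkcond; apply: ler_sum => B _; case: ifPn => hB; last exact: mulr_ge0.
apply: (@le_trans _ _ (\sum_l `|\prod_(r in B) c r l| *
    (\prod_r (if r \in B then 1 else kappa r)) * D)).
  by apply: ler_sum => l _; have [] := @Ex_one_heavy_fibre l B hB.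
rewrite -!mulr_suml ler_wpM2r//.
have -> : \prod_r kappa r = (\prod_(r in B) kappa r) *
    \prod_r (if r \in B then 1 else kappa r).
  rewrite (bigID [in B])/=; congr (_ * _).
  rewrite [RHS](bigID [in B])/= [X in _ = X * _]big1 ?mul1r; last by move=> r ->.
  by apply: eq_bigr => r /negbTE ->.
rewrite ler_wpM2r//; first by apply: prodr_ge0 => r _; case: ifP => // _; exact: ltW.
(* The prefactors are summable over [l] because a heavy block has two distinct elements:
   Cauchy-Schwarz for these two, the sup bound for the others. *)
have /andP[/card_gt1P[r1 [r2 [r1B r2B r12]]] _] := hB.
have splitB (h : 'I_s -> R) : \prod_(r in B) h r =
    h r1 * h r2 * \prod_(r in B | (r != r1) && (r != r2)) h r.
  rewrite (bigD1 r1)//= (bigD1 r2)/=; last by rewrite r2B eq_sym.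
  by rewrite mulrA; congr (_ * _); apply: eq_bigl => r; rewrite andbA.
rewrite splitB.
apply: (@le_trans _ _ (\sum_l `|c r1 l| * `|c r2 l| *
   \prod_(r in B | (r != r1) && (r != r2)) kappa r)).
  apply: ler_sum => l _; rewrite splitB !normrM ler_wpM2l ?mulr_ge0// normr_prod.
  by apply: ler_prod => r _; rewrite normr_ge0 cle.
rewrite -mulr_suml ler_wpM2r//; first by apply: prodr_ge0 => r _; exact: ltW.
apply: sum_mul_le; rewrite ?(ltW (kappa0 _))//.
  by under eq_bigr do rewrite real_normK ?num_real//.
by under eq_bigr do rewrite real_normK ?num_real//.
Qed.

End Remainder.
End Blocks.

(** * Truncation of the heavy block *)

Section Truncation.
Context (R : realType).
Implicit Types (M x q : R).

Definition trunc M x : R := if `|x| <= M then x else 0.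

Lemma measurable_trunc M : measurable_fun [set: R] (trunc M).
Proof.
apply: measurable_fun_ifT => //.
by apply: measurable_fun_ler => //; exact: measurableT_comp.
Qed.

Lemma normr_trunc M x : `|trunc M x| <= `|x|.
Proof. by rewrite /trunc; case: ifP => // _; rewrite normr0. Qed.

Lemma normr_trunc_le M x : 0 <= M -> `|trunc M x| <= M.
Proof. by rewrite /trunc; case: ifP => // _ M0; rewrite normr0. Qed.

(** Oddness of the truncation lets the symmetry of the innovations pass to the truncated means. *)
Lemma truncN M x : trunc M (- x) = - trunc M x.
Proof. by rewrite /trunc normrN; case: ifP => // _; rewrite oppr0. Qed.

Lemma sqr_trunc_le M q x : 0 < M -> 0 < q <= 2 ->
  trunc M x ^+ 2 <= M `^ (2 - q) * `|x| `^ q.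
Proof.
move=> M0 /andP[q0 q2]; rewrite /trunc; case: ifP => xM; last first.
  by rewrite expr0n mulr_ge0 ?powR_ge0.
rewrite -(real_normK (num_real x)) -powR_mulrn//.
have -> : `|x| `^ 2 = `|x| `^ (2 - q) * `|x| `^ q.
  by rewrite -powRD subrK// pnatr_eq0.
rewrite ler_wpM2r ?powR_ge0// ge0_ler_powR ?nnegrE ?(ltW M0)//; lra.
Qed.

Lemma sub_trunc_le M q x : 0 < M -> 1 <= q ->
  `|x - trunc M x| <= M `^ (1 - q) * `|x| `^ q.
Proof.
move=> M0 q1; rewrite /trunc; case: ifPn => xM.
  by rewrite subrr normr0 mulr_ge0 ?powR_ge0.
rewrite subr0; move: xM; rewrite -ltNge => Mx.
have x0 : 0 < `|x| by exact: lt_trans Mx.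
have -> : 1 - q = - (q - 1) by lra.
rewrite powRN ler_pdivlMl ?powR_gt0// mulrC -[X in _ <= X]mulr_powRB1//; last lra.
by rewrite ler_wpM2l// ge0_ler_powR ?nnegrE ?(ltW M0) ?(ltW x0) ?(ltW Mx)//; lra.
Qed.

End Truncation.

Section TruncatedBlocks.
Context d (T : measurableType d) (R : realType) (P : probability T R)
  (s : nat) (X1 : T -> s.-tuple R).
Local Notation L1 := (L1 P).
Local Notation L2 := (L2 P).
Local Notation Ex := (Ex P).
Implicit Types (B : {set 'I_s}) (x : s.-tuple R).

Definition zeta B x : R := \prod_(r in B) tnth x r.

Lemma measurable_zeta B : measurable_fun [set: s.-tuple R] (zeta B).
Proof. by apply: measurable_bigprod => r _; exact: measurable_tnth. Qed.

Lemma zeta0 : zeta finset.set0 = (fun=> 1).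
Proof. by apply/funext => x; rewrite /zeta big_set0. Qed.

Lemma heavy0 : heavy (finset.set0 : {set 'I_s}) = false.
Proof. by rewrite /heavy cards0. Qed.

Lemma heavy1 r : heavy [set r : 'I_s]%SET = false.
Proof. by rewrite /heavy cards1. Qed.

Definition moments (K q : R) :=
  [/\ 1 <= K,
      forall B, L1 (fun w => zeta B (X1 w)) /\ Ex (fun w => `|zeta B (X1 w)|) <= K,
      forall B, ~~ heavy B -> L2 (fun w => zeta B (X1 w)) /\
        Ex (fun w => zeta B (X1 w) ^+ 2) <= K,
      forall B, heavy B -> L1 (fun w => `|zeta B (X1 w)| `^ q) /\
        Ex (fun w => `|zeta B (X1 w)| `^ q) <= K &
      forall r, Ex (fun w => zeta [set r]%SET (X1 w)) = 0].

Definition trunc_mean M B : R := Ex (fun w => trunc M (zeta B (X1 w))).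

(** On a heavy block the three variants add up to [zeta B]; on a light block each of them is
    [zeta B]. Singletons are light, so all three keep the single coordinates centred. *)
Definition zeta_light M B x : R :=
  if heavy B then trunc_mean M B else zeta B x.
Definition zeta_trunc M B x : R :=
  if heavy B then trunc M (zeta B x) - trunc_mean M B else zeta B x.
Definition zeta_tail M B x : R :=
  if heavy B then zeta B x - trunc M (zeta B x) else zeta B x.

Context (K q M : R) (HK : moments K q) (q12 : 1 < q < 2) (M1 : 1 <= M)
  (mX1 : measurable_fun [set: T] X1).

Let K1 : 1 <= K. Proof. by case: HK. Qed.
Let K0 : 0 <= K. Proof. exact: le_trans K1. Qed.
Let M0 : 0 < M. Proof. exact: lt_le_trans M1. Qed.

Let mz B : measurable_fun [set: T] (fun w => zeta B (X1 w)).
Proof. by apply: measurableT_comp => //; exact: measurable_zeta. Qed.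

Let mt B : measurable_fun [set: T] (fun w => trunc M (zeta B (X1 w))).
Proof. by apply: (measurableT_comp (measurable_trunc M)). Qed.

Let t2 B : L2 (fun w => trunc M (zeta B (X1 w))).
Proof.
split => //; apply: L1_le (L1_cst P (M ^+ 2)) => [|w].
  exact: measurable_funX.
by rewrite normrX lerXn2r ?nnegrE ?(ltW M0)// normr_trunc_le// ltW.
Qed.

Let KleX B : heavy B -> K <= K ^+ #|B|.
Proof.
by move=> /andP[B1 _]; rewrite -{1}(expr1 K) ler_weXn2l// ltnW.
Qed.

Let lightKX B : ~~ heavy B -> Ex (fun w => zeta B (X1 w) ^+ 2) <= K ^+ #|B|.
Proof.
move=> lB; have [->|/set0Pn[r rB]] := eqVneq B finset.set0.
  rewrite zeta0 cards0 expr0; under eq_fun do rewrite expr1n.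
  by rewrite Ex_cst.
case: HK => _ _ /(_ B lB)[_ /le_trans +] _ _; apply.
by rewrite -{1}(expr1 K) ler_weXn2l// card_gt0; apply/set0Pn; exists r.
Qed.

Lemma trunc_mean_le B : `|trunc_mean M B| <= K.
Proof.
have [_ /(_ B)[i1 E1] _ _ _] := HK.
apply: le_trans (normr_Ex_le (L2_L1 (t2 B))) _; apply: le_trans E1.
by apply: Ex_le; [exact/L1_abs/L2_L1|exact: L1_abs|move=> w; exact: normr_trunc].
Qed.

Lemma zeta_light_bound : block_bound P X1 K 1 (zeta_light M).
Proof.
split.
- by apply/funext => x; rewrite /zeta_light heavy0 zeta0.
- move=> B; rewrite /zeta_light; case: heavy; first exact: measurable_cst.
  exact: measurable_zeta.
- move=> B; rewrite /zeta_light; case: (boolP (heavy B)) => lB; first exact: L2_cst.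
  by case: HK => _ _ /(_ B lB)[].
- move=> B; rewrite /zeta_light if_same mulr1; case: (boolP (heavy B)) => lB; last exact: lightKX.
  rewrite Ex_cst -(real_normK (num_real _)); apply: (@le_trans _ _ (K ^+ 2)).
    by rewrite lerXn2r ?nnegrE ?trunc_mean_le.
  by rewrite ler_weXn2l//; case/andP: lB.
Qed.

(** Centring only lowers the second moment, and below the level a square costs [M ^ (2 - q)] times
    the moment of order [q]. *)
Lemma zeta_trunc_bound : block_bound P X1 K (M `^ (2 - q)) (zeta_trunc M).
Proof.
split.
- by apply/funext => x; rewrite /zeta_trunc heavy0 zeta0.
- move=> B; rewrite /zeta_trunc; case: heavy; last exact: measurable_zeta.
  apply: measurable_funB; last exact: measurable_cst.
  by apply: (measurableT_comp (measurable_trunc M)); exact: measurable_zeta.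
- move=> B; rewrite /zeta_trunc; case: (boolP (heavy B)) => lB; last by case: HK => _ _ /(_ B lB)[].
  by apply: L2B => //; exact: L2_cst.
- move=> B; rewrite /zeta_trunc; case: (boolP (heavy B)) => lB; last by rewrite mulr1; exact: lightKX.
  have [_ _ _ /(_ B lB)[iq Eq] _] := HK.
  have [_ it2] := t2 B; have it := L2_L1 (t2 B).
  set m := trunc_mean M B.
  have -> : (fun w => (trunc M (zeta B (X1 w)) - m) ^+ 2) =
     (fun w => trunc M (zeta B (X1 w)) ^+ 2 +
       (- (2 * m) * trunc M (zeta B (X1 w)) + m ^+ 2)).
    by apply/funext => w; ring.
  rewrite ExD//; last by apply: L1D; [exact: L1Z|exact: L1_cst].
  rewrite ExD; [|exact: L1Z|exact: L1_cst].
  rewrite ExZ// Ex_cst -/(trunc_mean M B) -/m.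
  apply: (@le_trans _ _ (Ex (fun w => trunc M (zeta B (X1 w)) ^+ 2))).
    by have := sqr_ge0 m; rewrite expr2; lra.
  apply: (@le_trans _ _ (Ex (fun w => M `^ (2 - q) * `|zeta B (X1 w)| `^ q))).
    apply: Ex_le => //; first exact: L1Z.
    by move=> w; apply: sqr_trunc_le => //; case/andP: q12 => ? ?; apply/andP; split; lra.
  rewrite ExZ// mulrC ler_wpM2r ?powR_ge0//.
  exact: le_trans Eq (KleX lB).
Qed.

Lemma zeta_trunc_mean B : heavy B -> Ex (fun w => zeta_trunc M B (X1 w)) = 0.
Proof.
move=> hB; rewrite /zeta_trunc hB ExB; [|exact: L2_L1|exact: L1_cst].
by rewrite Ex_cst subrr.
Qed.

Lemma zeta_tail_bound B : heavy B ->
  L1 (fun w => zeta_tail M B (X1 w)) /\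
  Ex (fun w => `|zeta_tail M B (X1 w)|) <= K * M `^ (1 - q).
Proof.
move=> hB; have [_ /(_ B)[i1 _] _ /(_ B hB)[iq Eq] _] := HK.
have it := L2_L1 (t2 B).
rewrite /zeta_tail hB; split; first exact: L1B.
apply: (@le_trans _ _ (Ex (fun w => M `^ (1 - q) * `|zeta B (X1 w)| `^ q))).
  apply: Ex_le; [exact/L1_abs/L1B|exact: L1Z|move=> w].
  by apply: sub_trunc_le => //; case/andP: q12 => /ltW.
by rewrite ExZ// mulrC ler_wpM2r ?powR_ge0.
Qed.

End TruncatedBlocks.

(** * Splitting of finite products of linear forms *)

Section Decomposition.
Context d (T : measurableType d) (R : realType) (P : probability T R)
  (s : nat) (L : finType) (X1 : T -> s.-tuple R) (X : L -> T -> s.-tuple R).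
Local Notation L1 := (L1 P).
Local Notation L2 := (L2 P).
Local Notation Ex := (Ex P).
Context (mX1 : measurable_fun [set: T] X1)
  (mX : forall l, measurable_fun [set: T] (X l))
  (prodX : forall phi : L -> s.-tuple R -> R,
  (forall l, measurable_fun [set: s.-tuple R] (phi l)) ->
  (forall l, L1 (fun w => phi l (X1 w))) ->
  L1 (fun w => \prod_l phi l (X l w)) /\
  Ex (fun w => \prod_l phi l (X l w)) = \prod_l Ex (fun w => phi l (X1 w)))
  (K q : R) (HK : moments P X1 K q) (q12 : 1 < q < 2).
Implicit Types (f : {ffun 'I_s -> L}) (c : 'I_s -> L -> R).

Definition linear_product c w := \prod_r \sum_l c r l * tnth (X l w) r.

Let K1 : 1 <= K. Proof. by case: HK. Qed.
Let K0 : 0 <= K. Proof. exact: le_trans K1. Qed.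

Local Notation bprod := (block_prod X).
Local Notation coef c f := (\prod_r c r (f r)).

Lemma linear_productE c w :
  linear_product c w =
  \sum_(f : {ffun 'I_s -> L}) coef c f * bprod (@zeta R s) f w.
Proof.
rewrite /linear_product bigA_distr_bigA /=; apply: eq_bigr => f _.
rewrite big_split /=; congr (_ * _).
rewrite (partition_big f xpredT)//=; apply: eq_bigr => l _.
rewrite /zeta [RHS](eq_bigl (fun r => f r == l)); last by move=> r; rewrite inE.
by apply: eq_bigr => r /eqP ->.
Qed.

(** The unique heavy fibre carries the splitting. Without one the whole term is light, hence the
    indicator in front of the other two parts. *)
Lemma block_prod_split M f w :
  bprod (@zeta R s) f w = bprod (zeta_light P X1 M) f w +
    ((has_heavy f)%:R * bprod (zeta_trunc P X1 M) f w +
     (has_heavy f)%:R * bprod (zeta_tail M) f w).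
Proof.
rewrite /block_prod; case: (boolP (has_heavy f)) => [/existsP[l hl]|nh].
  rewrite !mul1r (bigD1 l)//= [in RHS](bigD1 l)//=.
  rewrite [X in _ = _ + (X + _)](bigD1 l)//= [X in _ = _ + (_ + X)](bigD1 l)//=.
  have E (phi : {set 'I_s} -> s.-tuple R -> R) :
      (forall B, ~~ heavy B -> phi B = zeta B) ->
      \prod_(l' | l' != l) phi (fibre f l') (X l' w) =
      \prod_(l' | l' != l) zeta (fibre f l') (X l' w).
    move=> phiE; apply: eq_bigr => l' ll'; rewrite phiE//.
    by apply: contraNN ll' => hl'; apply/eqP/(heavy_unique hl' hl).
  rewrite !E //; try by move=> B /negbTE hB; apply/funext => x;
    rewrite /zeta_light /zeta_trunc /zeta_tail hB.
  by rewrite /zeta_light /zeta_trunc /zeta_tail hl; ring.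
rewrite (_ : false%:R = 0 :> R)// !mul0r !addr0; apply: eq_bigr => l _.
by move/existsPn: nh => /(_ l) /negbTE hl; rewrite /zeta_light hl.
Qed.

Definition light_form M c w :=
  \sum_(f : {ffun 'I_s -> L}) coef c f * bprod (zeta_light P X1 M) f w.
Definition trunc_form M c w :=
  \sum_(f : {ffun 'I_s -> L}) coef c f * ((has_heavy f)%:R * bprod (zeta_trunc P X1 M) f w).
Definition tail_form M c w :=
  \sum_(f : {ffun 'I_s -> L} | has_heavy f) coef c f * bprod (zeta_tail M) f w.

Lemma linear_product_split M c w :
  linear_product c w = light_form M c w + (trunc_form M c w + tail_form M c w).
Proof.
rewrite linear_productE /tail_form [X in _ + (_ + X)]big_mkcond -!big_split /=.
apply: eq_bigr => f _; rewrite (block_prod_split M); case: has_heavy.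
  by rewrite /=; ring.
by rewrite (_ : false%:R = 0 :> R)//; ring.
Qed.

Let single0 phi : (forall B, ~~ heavy B -> phi B = @zeta R s B) ->
  forall r, Ex (fun w => phi [set r]%SET (X1 w)) = 0.
Proof. by move=> phiE r; rewrite phiE ?heavy1//; case: HK. Qed.

Let lightE M B : ~~ heavy B -> zeta_light P X1 M B = zeta B.
Proof. by move=> /negbTE hB; apply/funext => x; rewrite /zeta_light hB. Qed.
Let truncE M B : ~~ heavy B -> zeta_trunc P X1 M B = zeta B.
Proof. by move=> /negbTE hB; apply/funext => x; rewrite /zeta_trunc hB. Qed.
Let tailE M B : ~~ heavy B -> zeta_tail M B = @zeta R s B.
Proof. by move=> /negbTE hB; apply/funext => x; rewrite /zeta_tail hB. Qed.

Let C0 : R := (#|{: 'I_s + 'I_s}| ^ #|{: 'I_s + 'I_s}|)%:R.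

Definition tail_const : R := #|{set 'I_s}|%:R * (1 + K ^+ (s + s) * C0).

Lemma tail_const_ge0 : 0 <= tail_const.
Proof. by rewrite mulr_ge0// addr_ge0// mulr_ge0 ?exprn_ge0. Qed.

Lemma tail_form_bound M c (kappa : 'I_s -> R) : 1 <= M ->
  (forall r, 0 < kappa r) -> (forall r, \sum_l c r l ^+ 2 <= kappa r ^+ 2) ->
  L1 (tail_form M c) /\
  Ex (fun w => `|tail_form M c w|) <=
    tail_const * \prod_r kappa r * (K * M `^ (1 - q)).
Proof.
move=> M1 k0 ck.
have := @Ex_remainder _ _ _ P s L X1 X mX prodX K (K * M `^ (1 - q)) (zeta_tail M) c kappa.
case=> //.
- by rewrite mulr_ge0 ?powR_ge0.
- by rewrite tailE ?zeta0// heavy0.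
- move=> B; case: (boolP (heavy B)) => hB; last by rewrite tailE//; exact: measurable_zeta.
  rewrite /zeta_tail hB; apply: measurable_funB; first exact: measurable_zeta.
  by apply: (measurableT_comp (measurable_trunc M)); exact: measurable_zeta.
- by move=> B lB; rewrite tailE//; case: HK => _ _ /(_ B lB)[].
- move=> B lB; rewrite tailE//; have := zeta_light_bound HK M1 mX1.
  by case=> _ _ _ /(_ B); rewrite lightE// if_same mulr1.
- by move=> B hB; have [] := zeta_tail_bound HK q12 M1 mX1 hB.
- by move=> B hB; have [] := zeta_tail_bound HK q12 M1 mX1 hB.
- by apply: single0 => B; exact: tailE.
move=> i E; split => //; apply: le_trans E _.
by rewrite /tail_const -!mulrA [X in _ * X <= _]mulrCA [X in _ <= _ * X]mulrCA
  ler_wpM2l// mulrCA [X in _ <= X]mulrCA; rewrite le_eqVlt; apply/orP; left; apply/eqP; ring.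
Qed.

Definition L1_const : R := 2 * (K ^+ s * C0 + 1) + tail_const * K.

Lemma L1_const_ge0 : 0 <= L1_const.
Proof.
rewrite addr_ge0 ?mulr_ge0 ?tail_const_ge0// addr_ge0// mulr_ge0// exprn_ge0//.
Qed.

(** Truncation at level 1 is enough for an L1 bound. Since the bound is a product of the l2 bounds
    of the coefficient families, one small family makes the whole product small. *)
Lemma L1_linear_product c (kappa : 'I_s -> R) :
  (forall r, 0 < kappa r) -> (forall r, \sum_l c r l ^+ 2 <= kappa r ^+ 2) ->
  L1 (linear_product c) /\
  Ex (fun w => `|linear_product c w|) <= L1_const * \prod_r kappa r.
Proof.
move=> k0 ck; have M1 : (1 : R) <= 1 by [].
have pk0 : 0 < \prod_r kappa r by exact: prodr_gt0.
have bl := zeta_light_bound HK M1 mX1.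
have bt := zeta_trunc_bound HK q12 M1 mX1; rewrite powR1 in bt.
have [iR ER] := tail_form_bound M1 k0 ck; rewrite powR1 mulr1 in ER.
have cabs r : \sum_l `|c r l| ^+ 2 <= kappa r ^+ 2.
  by under eq_bigr do rewrite real_normK ?num_real//; exact: ck.
have psns : pair_sum (fun r l => `|c r l|) (fun r l => `|c r l|) (@no_singleton s L) <=
    C0 * (\prod_r kappa r) ^+ 2.
  by rewrite expr2; apply: pair_sum_no_singleton => // r; exact: ltW.
have psh : pair_sum (fun r l => `|c r l|) (fun r l => `|c r l|) (@heavy_linked s L) <=
    pair_sum (fun r l => `|c r l|) (fun r l => `|c r l|) (@no_singleton s L).
  apply: ler_sum => f _; apply: ler_sum_subset => g.
    by apply: mulr_ge0; apply: prodr_ge0.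
  by case/and3P.
(* The added 1 makes the square of [K ^+ s * C0 + 1] dominate [K ^+ s * C0], so no square root is
   needed. *)
set b := (K ^+ s * C0 + 1) * \prod_r kappa r.
have KC0 : 0 <= K ^+ s * C0 by rewrite mulr_ge0 ?exprn_ge0.
have b0 : 0 < b by rewrite mulr_gt0// ltr_wpDl.
have bsq : K ^+ s * (C0 * (\prod_r kappa r) ^+ 2) <= b ^+ 2.
  rewrite /b mulrA exprMn ler_wpM2r ?sqr_ge0//; move: KC0; move: (K ^+ s * C0) => y; nra.
have [L2l El] := @Ex_form _ _ _ P s L X1 X mX prodX K 1 _ c K0 M1 bl
  (single0 (@lightE 1)).
have [L2t Et] := @Ex_heavy_form _ _ _ P s L X1 X mX prodX K 1 _ (fun=> c) [:: 0%N] K0 M1 bt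
  (single0 (@truncE 1)) (fun B => @zeta_trunc_mean _ _ _ P s X1 _ M1 mX1 B).
rewrite !big_seq1 in Et.
have {}L2t : L2 (trunc_form 1 c).
  by move: L2t; congr L2; apply/funext => w; rewrite big_seq1.
have {}Et : Ex (fun w => trunc_form 1 c w ^+ 2) <= K ^+ s * 1 *
    pair_sum (fun r l => `|c r l|) (fun r l => `|c r l|) (@heavy_linked s L).
  apply: le_trans Et; rewrite le_eqVlt; apply/orP; left; apply/eqP; congr Ex.
  by apply/funext => w; rewrite big_seq1.
have El' : Ex (fun w => `|light_form 1 c w|) <= b.
  apply: Ex_abs_le => //; apply: le_trans El _; rewrite mulr1; apply: le_trans bsq.
  by rewrite ler_wpM2l ?exprn_ge0.
have Et' : Ex (fun w => `|trunc_form 1 c w|) <= b.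
  apply: Ex_abs_le => //; apply: le_trans Et _; rewrite mulr1; apply: le_trans bsq.
  by rewrite ler_wpM2l ?exprn_ge0//; exact: le_trans psh _.
have il := L2_L1 L2l; have it := L2_L1 L2t.
have -> : linear_product c = fun w => light_form 1 c w + (trunc_form 1 c w + tail_form 1 c w).
  by apply/funext => w; exact: linear_product_split.
split; first by apply: L1D => //; exact: L1D.
apply: (@le_trans _ _ (Ex (fun w => `|light_form 1 c w| +
   (`|trunc_form 1 c w| + `|tail_form 1 c w|)))).
  apply: Ex_le.
  - by apply/L1_abs/L1D => //; exact: L1D.
  - by apply: L1D; [exact: L1_abs|apply: L1D; exact: L1_abs].
  - by move=> w; apply: le_trans (ler_normD _ _) _; rewrite lerD2l ler_normD.
rewrite ExD; [|exact: L1_abs|by apply: L1D; exact: L1_abs].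
rewrite ExD; [|exact: L1_abs|exact: L1_abs].
have -> : L1_const * \prod_r kappa r = b + (b + tail_const * \prod_r kappa r * K).
  by rewrite /L1_const /b; ring.
by rewrite lerD// lerD.
Qed.

Context (adm : rel {ffun 'I_s -> L})
  (Hadm : forall M, 1 <= M -> forall f g, ~~ adm f g ->
    Ex (fun w => bprod (zeta_light P X1 M) f w * bprod (zeta_light P X1 M) g w) = 0 /\
    Ex (bprod (zeta_light P X1 M) f) * Ex (bprod (zeta_light P X1 M) g) = 0).

(** Only [U] has usable second moments; they are bounded for sums over any list of times because the
    maximal inequality asks for all dyadic intervals. [V] is small in L1 at each time separately. *)
Lemma centered_decomposition M (c : nat -> 'I_s -> L -> R) : 1 <= M ->
  exists U V : nat -> T -> R,
  [/\ forall k w, linear_product (c k) w - Ex (linear_product (c k)) = U k w + V k w,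
      forall I : seq nat, L2 (fun w => \sum_(k <- I) U k w),
      forall I : seq nat, Ex (fun w => (\sum_(k <- I) U k w) ^+ 2) <= 2 * K ^+ s *
        ((\sum_(k <- I) \sum_(k' <- I) pair_sum (fun r l => `|c k r l|)
            (fun r l => `|c k' r l|) (fun f g => adm f g && linked f g)) +
         M `^ (2 - q) * \sum_(k <- I) \sum_(k' <- I) pair_sum (fun r l => `|c k r l|)
            (fun r l => `|c k' r l|) (@heavy_linked s L)) &
      forall k (kappa : 'I_s -> R), (forall r, 0 < kappa r) ->
        (forall r, \sum_l c k r l ^+ 2 <= kappa r ^+ 2) ->
        L1 (V k) /\ Ex (fun w => `|V k w|) <=
          2 * (tail_const * \prod_r kappa r * (K * M `^ (1 - q)))].
Proof.
move=> M1.
have V1 : 1 <= M `^ (2 - q).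
  by rewrite -{1}(powRr0 M) ler_powR//; case/andP: q12 => ? ?; lra.
have bl := zeta_light_bound HK M1 mX1.
have bt := zeta_trunc_bound HK q12 M1 mX1.
have light I := @Ex_centered_form _ _ _ P s L X1 X mX prodX K _ c I adm K0 bl (Hadm M1).
have heavyf I := @Ex_heavy_form _ _ _ P s L X1 X mX prodX K _ _ c I K0 V1 bt
  (single0 (@truncE M)) (fun B => @zeta_trunc_mean _ _ _ P s X1 _ M1 mX1 B).
have iY f : L1 (bprod (zeta_light P X1 M) f) := (block_prod_mean prodX f bl).1.
pose Lc k w := \sum_(f : {ffun 'I_s -> L}) coef (c k) f *
  (bprod (zeta_light P X1 M) f w - Ex (bprod (zeta_light P X1 M) f)).
pose U k w := Lc k w + trunc_form M (c k) w.
pose V k w := tail_form M (c k) w - Ex (tail_form M (c k)).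
have iLc k : L1 (Lc k).
  by apply: L1_sum => f _; apply: L1Z; apply: L1B => //; exact: L1_cst.
have iT k : L1 (trunc_form M (c k)).
  have [] := @Ex_heavy_form _ _ _ P s L X1 X mX prodX K _ _ (fun=> c k) [:: 0%N] K0 V1 bt
    (single0 (@truncE M)) (fun B => @zeta_trunc_mean _ _ _ P s X1 _ M1 mX1 B).
  move=> /L2_L1 + _; congr L1.
  by apply/funext => w; rewrite big_seq1.
have iR k : L1 (tail_form M (c k)).
  (* Only integrability is wanted here, so any admissible bound will do; this one works since
     [y <= (1 + y) ^ 2]. *)
  have [||//] := @tail_form_bound M (c k) (fun r => 1 + \sum_l c k r l ^+ 2) M1.
    by move=> r; rewrite ltr_wpDr// sumr_ge0// => l _; exact: sqr_ge0.
  move=> r; have : 0 <= \sum_l c k r l ^+ 2 by apply: sumr_ge0 => l _; exact: sqr_ge0.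
  by move: (\sum_l _) => y; nra.
have iLf k : L1 (light_form M (c k)) by apply: L1_sum => f _; exact: L1Z.
have T0 k : Ex (trunc_form M (c k)) = 0.
  rewrite Ex_sum => [|f _]; last first.
    by do 2!apply: L1Z; exact: (block_prod_mean prodX f bt).1.
  apply: big1 => f _; have [ib Eb] := block_prod_mean prodX f bt.
  rewrite !ExZ//; last exact: L1Z.
  case: (boolP (has_heavy f)) => [/existsP[l hl]|_]; last by rewrite mul0r mulr0.
  rewrite Eb (bigD1 l)//= zeta_trunc_mean// mul0r !mulr0//.
have LcE k w : Lc k w = light_form M (c k) w - Ex (light_form M (c k)).
  rewrite /light_form Ex_sum => [|f _]; last exact: L1Z.
  by rewrite -sumrB; apply: eq_bigr => f _; rewrite ExZ// mulrBr.
have UL2 I : L2 (fun w => \sum_(k <- I) Lc k w) /\ L2 (fun w => \sum_(k <- I) trunc_form M (c k) w).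
  by split; [exact: (light I).1|exact: (heavyf I).1].
exists U, V; split.
- move=> k w; have -> : linear_product (c k) =
    fun w => light_form M (c k) w + (trunc_form M (c k) w + tail_form M (c k) w).
    by apply/funext => w'; exact: linear_product_split.
  rewrite ExD//; last exact: L1D.
  by rewrite ExD// T0 /U /V LcE; ring.
- move=> I; have [L2a L2b] := UL2 I.
  by under eq_fun do rewrite big_split; exact: L2D.
- move=> I; have [[mA iA] [mB iB]] := UL2 I.
  have -> : (fun w => (\sum_(k <- I) U k w) ^+ 2) =
     (fun w => (\sum_(k <- I) Lc k w + \sum_(k <- I) trunc_form M (c k) w) ^+ 2).
    by apply/funext => w; rewrite -big_split.
  apply: (@le_trans _ _ (Ex (fun w => 2 * ((\sum_(k <- I) Lc k w) ^+ 2 +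
     (\sum_(k <- I) trunc_form M (c k) w) ^+ 2)))).
    apply: Ex_le; [exact: (L2D (UL2 I).1 (UL2 I).2).2|exact/L1Z/L1D|move=> w].
    move: (\sum_(k <- I) Lc k w) (\sum_(k <- I) trunc_form M (c k) w) => x y.
    by have := sqr_ge0 (x - y); rewrite sqrrB sqrrD; lra.
  rewrite ExZ ?ExD//; last exact: L1D.
  rewrite -mulrA ler_wpM2l// mulrDr lerD//; first exact: (light I).2.
  by rewrite mulrA; exact: (heavyf I).2.
- move=> k kappa k0 ck; have [i E] := tail_form_bound M1 k0 ck.
  rewrite /V; split; first by apply: L1B => //; exact: L1_cst.
  apply: (@le_trans _ _ (Ex (fun w => `|tail_form M (c k) w| + `|Ex (tail_form M (c k))|))).
    apply: Ex_le.
    + by apply/L1_abs/L1B => //; exact: L1_cst.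
    + by apply: L1D; [exact: L1_abs|exact: L1_cst].
    + by move=> w; apply: le_trans (ler_normB _ _) _.
  rewrite ExD ?Ex_cst; [|exact: L1_abs|exact: L1_cst].
  have := normr_Ex_le i; lra.
Qed.

End Decomposition.

(** * Rademacher-Menshov inequality *)

Section DyadicMaximal.
Context (R : realType).

(** The squared sums of [u] over all dyadic subintervals of [[a, a + 2 ^ m)], one for each node of
    the binary tree, are added up. *)
Fixpoint dyadic_squares (u : nat -> R) (a m : nat) : R :=
  match m with
  | 0%N => u a ^+ 2
  | m'.+1 => (\sum_(a <= k < a + 2 ^ m'.+1) u k) ^+ 2 +
      (dyadic_squares u a m' + dyadic_squares u (a + 2 ^ m') m')
  end.

Lemma dyadic_squares_ge0 u a m : 0 <= dyadic_squares u a m.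
Proof.
by elim: m a => [|m IH] a /=; rewrite ?addr_ge0// sqr_ge0.
Qed.

Lemma dyadic_squares_top u a m :
  (\sum_(a <= k < a + 2 ^ m) u k) ^+ 2 <= dyadic_squares u a m.
Proof.
case: m => [|m] /=; first by rewrite expn0 addn1 big_nat1.
by rewrite lerDl addr_ge0// dyadic_squares_ge0.
Qed.

(** An initial segment is a disjoint union of at most [m + 1] dyadic intervals. Cauchy-Schwarz is
    applied one level at a time, with weight 1 for a full left half and the number of remaining
    levels for the rest. *)
Lemma partial_sum_dyadic u a m n : (n <= 2 ^ m)%N ->
  (\sum_(a <= k < a + n) u k) ^+ 2 <= m.+1%:R * dyadic_squares u a m.
Proof.
elim: m a n => [|m IH] a n nm.
  rewrite mul1r; case: n nm => [|[|//]] _ /=.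
    by rewrite addn0 big_geq// expr0n sqr_ge0.
  by rewrite addn1 big_nat1.
set Q := dyadic_squares; have Q0 := dyadic_squares_ge0 u.
have m0 : (0 : R) < m.+1%:R by rewrite ltr0n.
have [nm'|nm'] := leqP n (2 ^ m).
  apply: le_trans (IH a n nm') _; apply: ler_pM => //; first by rewrite ler_nat.
  by rewrite /= addrA addrAC ler_wpDl ?addr_ge0 ?sqr_ge0//; exact: Q0.
have e : (a + n = (a + 2 ^ m) + (n - 2 ^ m))%N by rewrite -addnA subnKC// ltnW.
rewrite (@big_cat_nat _ _ _ (a + 2 ^ m))/= ?leq_addr//; last by rewrite leq_add2l ltnW.
have hx := dyadic_squares_top u a m.
have := IH (a + 2 ^ m)%N (n - 2 ^ m)%N; rewrite -e => /(_ _).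
have nm2 : (n - 2 ^ m <= 2 ^ m)%N by move: nm; rewrite expnS mul2n -addnn leq_subLR.
move=> /(_ nm2); move: hx; rewrite /= -/Q.
set x := \sum_(a <= k < a + 2 ^ m) u k.
set y := \sum_(a + 2 ^ m <= k < a + n) u k.
move=> hx hy.
have top : 0 <= (\sum_(a <= k < a + 2 ^ m.+1) u k) ^+ 2 by exact: sqr_ge0.
apply: (@le_trans _ _ (m.+2%:R * (Q u a m + Q u (a + 2 ^ m)%N m))); last first.
  by rewrite ler_wpM2l// ler_wpDl.
apply: (@le_trans _ _ (m.+2%:R * (x ^+ 2 + y ^+ 2 / m.+1%:R))).
  have -> : m.+2%:R * (x ^+ 2 + y ^+ 2 / m.+1%:R) =
     (x + y) ^+ 2 + (m.+1%:R * x - y) ^+ 2 / m.+1%:R :> R.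
    by rewrite -[m.+2%:R]natr1; field; rewrite gt_eqF.
  by rewrite lerDl divr_ge0 ?sqr_ge0.
by rewrite ler_wpM2l// lerD// ler_pdivrMr// [leRHS]mulrC.
Qed.

Context d (T : measurableType d) (P : probability T R) (U : nat -> T -> R)
  (U2 : forall I : seq nat, L2 P (fun w => \sum_(k <- I) U k w)).

(** The superadditivity [2 * b j <= b j.+1] bounds the total of each of the [m + 1] levels by
    [b m]. *)
Lemma Ex_dyadic_squares (b : nat -> R) m : (forall j, (j < m)%N -> 2 * b j <= b j.+1) ->
  (forall a j, (j <= m)%N ->
     Ex P (fun w => (\sum_(a <= k < a + 2 ^ j) U k w) ^+ 2) <= b j) ->
  forall a, L1 P (fun w => dyadic_squares (U ^~ w) a m) /\
    Ex P (fun w => dyadic_squares (U ^~ w) a m) <= m.+1%:R * b m.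
Proof.
elim: m => [|m IH] b2 Ub a.
  have e : (fun w => U a w ^+ 2) = (fun w => (\sum_(a <= k < a + 2 ^ 0) U k w) ^+ 2).
    by apply/funext => w; rewrite expn0 addn1 big_nat1.
  rewrite /= e mul1r; split; last exact: Ub.
  exact: (U2 (index_iota a (a + 2 ^ 0))).2.
have b2' j : (j < m)%N -> 2 * b j <= b j.+1 by move=> jm; exact/b2/ltnW.
have Ub' a' j : (j <= m)%N ->
    Ex P (fun w => (\sum_(a' <= k < a' + 2 ^ j) U k w) ^+ 2) <= b j.
  by move=> jm; exact/Ub/leqW.
have [i1 E1] := IH b2' Ub' a; have [i2 E2] := IH b2' Ub' (a + 2 ^ m)%N.
have i0 := (U2 (index_iota a (a + 2 ^ m.+1))).2.
have i12 := L1D i1 i2.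
rewrite /=; split; first exact: L1D.
rewrite ExD// ExD//.
have := Ub a m.+1 (leqnn _); have := b2 m (ltnSn _).
move=> h1 h2; rewrite -[m.+2%:R]natr1 mulrDl mul1r.
have : m.+1%:R * (2 * b m) <= m.+1%:R * b m.+1 by rewrite ler_wpM2l.
lra.
Qed.

(* Rademacher-Menshov, with the maximum replaced by an integrable dominating
   function. *)
Lemma dyadic_maximal (b : nat -> R) m B : 0 < B ->
  (forall j, (j < m)%N -> 2 * b j <= b j.+1) ->
  (forall a j, (j <= m)%N ->
     Ex P (fun w => (\sum_(a <= k < a + 2 ^ j) U k w) ^+ 2) <= b j) ->
  m.+1%:R ^+ 2 * b m <= B ^+ 2 ->
  forall a, exists g : T -> R, [/\ L1 P g, Ex P g <= B &
    forall w n, (n <= 2 ^ m)%N -> `|\sum_(a <= k < a + n) U k w| <= g w].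
Proof.
move=> B0 b2 Ub bB a; have [i E] := Ex_dyadic_squares b2 Ub a.
(* [2 B |x| <= x ^ 2 + B ^ 2] turns the bound on squares into an L1 bound by [B]. *)
pose g w := (2 * B)^-1 * (m.+1%:R * dyadic_squares (U ^~ w) a m + B ^+ 2).
exists g; split.
- by apply/L1Z/L1D; [exact: L1Z|exact: L1_cst].
- rewrite /g ExZ; last by apply: L1D; [exact: L1Z|exact: L1_cst].
  rewrite ExD; [|exact: L1Z|exact: L1_cst].
  rewrite ExZ// Ex_cst.
  rewrite ler_pdivrMl ?mulr_gt0//.
  have : m.+1%:R * Ex P (fun w => dyadic_squares (U ^~ w) a m) <= m.+1%:R * (m.+1%:R * b m).
    by rewrite ler_wpM2l.
  by move: bB; rewrite expr2 -mulrA; lra.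
- move=> w n nm; rewrite /g ler_pdivlMl ?mulr_gt0//.
  have := partial_sum_dyadic (U ^~ w) a nm; rewrite -(real_normK (num_real (\sum_(_ <= _ < _) _))).
  set x := `|_|; have := sqr_ge0 (x - B); rewrite sqrrB; lra.
Qed.

End DyadicMaximal.

(** * Almost sure convergence of series *)

Section RealSequences.
Context (R : realType).
Implicit Types (u : nat -> R).

Lemma cvgn_cauchy u :
  (forall e : R, 0 < e -> exists N, forall n, (N <= n)%N -> `|u n - u N| <= e) ->
  cvgn u.
Proof.
move=> uC; apply: cauchy_cvg; apply: cauchy_exP => e e0.
have [N uN] := uC (e / 2) (divr_gt0 e0 (ltr0Sn R 1)).
exists (u N); exists N => // n /= Nn; rewrite /ball /= distrC.
by apply: le_lt_trans (uN n Nn) _; lra.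
Qed.

Lemma cauchy_cvgn u : cvgn u ->
  forall e : R, 0 < e -> exists N, forall n, (N <= n)%N -> `|u n - u N| <= e.
Proof.
move=> /cvg_ex[l /cvgrPdist_lt ul] e e0.
have [N _ uN] := ul (e / 2) (divr_gt0 e0 (ltr0Sn R 1)).
exists N => n Nn; have h1 := uN n Nn; have h2 := uN N (leqnn N); rewrite /= in h1 h2.
rewrite (_ : u n - u N = (u n - l) + (l - u N)); last by ring.
apply: le_trans (ler_normD _ _) _; rewrite distrC; lra.
Qed.

End RealSequences.

Section MeasurableLimit.
Context d (T : measurableType d) (R : realType) (u : nat -> T -> R).
Context (mu : forall n, measurable_fun [set: T] (u n)).

Lemma measurable_cvgn_set : measurable [set w | cvgn (u ^~ w)].
Proof.
have -> : [set w | cvgn (u ^~ w)] = \bigcap_j \bigcup_N \bigcap_n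
   [set w | (N <= n)%N -> `|u n w - u N w| <= j.+1%:R^-1].
  apply/seteqP; split => w /=.
    move=> /cauchy_cvgn uC j _; have j0 : (0 : R) < j.+1%:R^-1 by rewrite invr_gt0 ltr0n.
    by have [N uN] := uC _ j0; exists N => // n _ /=; exact: uN.
  move=> uC; apply: cvgn_cauchy => e e0.
  have [j je] : exists j, (j.+1%:R : R)^-1 < e.
    by have [j] := ltr_add_invr e0; rewrite add0r => je; exists j.
  have [N _ uN] := uC j I; exists N => n Nn.
  exact: le_trans (uN n I Nn) (ltW je).
apply: bigcap_measurable => // j _; apply: bigcup_measurable => N _.
apply: bigcap_measurable => // n _.
case: (leqP N n) => _; last first.
  by rewrite (_ : [set _ | _] = setT)//; apply/seteqP; split.
have -> : [set w | is_true true -> `|u n w - u N w| <= j.+1%:R^-1] =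
   (fun w => `|u n w - u N w|) @^-1` [set x | x <= j.+1%:R^-1].
  by apply/seteqP; split => w /=; [apply|].
rewrite -[_ @^-1` _]setTI.
have mf : measurable_fun [set: T] (fun w => `|u n w - u N w|).
  by apply: measurableT_comp => //; exact: measurable_funB.
by apply: mf => //; rewrite -set_itvNyc; exact: measurable_itv.
Qed.

Lemma measurable_limn : measurable_fun [set: T] (fun w => limn (u ^~ w)).
Proof.
pose C := [set w | cvgn (u ^~ w)].
have mC : measurable C := measurable_cvgn_set.
(* A divergent sequence has the default limit [point]; [v] equals this constant off the convergence
   set, so it converges everywhere to the required function. *)
pose p : R := point.
pose v n w : R := \1_C w * u n w + (1 - \1_C w) * p.
apply: (@measurable_fun_cvg _ _ _ _ v) => [n|w _].
  have m1 : measurable_fun [set: T] (\1_C : T -> R) by exact: measurable_indic.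
  apply: measurable_funD; apply: measurable_funM => //.
  by apply: measurable_funB.
have [wC|wC] := pselect (C w).
  have -> : v ^~ w = u ^~ w.
    by apply/funext => n; rewrite /v indicE mem_set// subrr mul0r addr0 mul1r.
  exact: wC.
have -> : limn (u ^~ w) = p.
  by apply: dvgP.
have -> : v ^~ w = cst p.
  by apply/funext => n; rewrite /v indicE memNset// mul0r subr0 mul1r add0r.
exact: cvg_cst.
Qed.

End MeasurableLimit.

Section AlmostSureSeries.
Context d (T : measurableType d) (R : realType) (P : probability T R).

Lemma ae_nneseries_tail (G : nat -> T -> \bar R) :
  (forall n, measurable_fun [set: T] (G n)) -> (forall n w, (0 <= G n w)%E) ->
  (\sum_(0 <= n <oo) \int[P]_w G n w < +oo)%E ->
  {ae P, forall w, forall e : R, 0 < e -> exists M, forall n, (M <= n)%N ->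
     (\sum_(M <= m < n) G m w <= e%:E)%E}.
Proof.
move=> mG G0 Gfin; rewrite -integral_nneseries// in Gfin.
set S := (fun w => \sum_(0 <= n <oo) G n w)%E in Gfin.
have S0 w : (0 <= S w)%E by apply: nneseries_ge0.
have iS : P.-integrable setT S.
  apply/integrableP; split.
    by apply: ge0_emeasurable_sum.
  by under eq_integral do rewrite gee0_abs//.
have := integrable_ae measurableT iS; apply: filterS => w /(_ I) Sw e e0.
have Sfin : (S w < +oo)%E by rewrite ltey_eq Sw.
have := @nneseries_tail_cvg R (G ^~ w) xpredT Sfin (fun k _ => G0 k w).
move=> /fine_cvgP[[M1 _ fin]]/cvgrPdist_lt/(_ e e0)[M2 _ tail].
pose M := maxn M1 M2; exists M => n Mn.
have := tail M (leq_maxr _ _); rewrite /= sub0r normrN => tM.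
have tge0 : (0 <= \sum_(M <= k <oo) G k w)%E by apply: nneseries_ge0.
apply: (@le_trans _ _ (\sum_(M <= k <oo) G k w)%E).
  exact: nneseries_lim_ge.
have finM := fin M (leq_maxl _ _).
rewrite -(fineK finM) lee_fin; apply: ltW; apply: le_lt_trans tM.
exact: ler_norm.
Qed.

Lemma ae_L1_series_tail (g : nat -> T -> R) (B : nat -> R) :
  (forall n, L1 P (g n)) -> (forall n w, 0 <= g n w) ->
  (forall n, Ex P (g n) <= B n) -> cvgn (series B) ->
  {ae P, forall w, forall e : R, 0 < e -> exists M, forall n, (M <= n)%N ->
     \sum_(M <= m < n) g m w <= e}.
Proof.
move=> ig g0 gB cB.
have B0 n : 0 <= B n by apply: le_trans (gB n); exact: Ex_ge0.
have := @ae_nneseries_tail (fun n w => (g n w)%:E); case=> //.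
- by move=> n; exact/measurable_EFinP/L1_measurable/ig.
- under eq_eseriesr do rewrite ExE//.
  apply: (@le_lt_trans _ _ (\sum_(0 <= n <oo) (B n)%:E)%E).
    by apply: lee_nneseries => n _; rewrite ?lee_fin// Ex_ge0.
  have : (\sum_(0 <= n <oo) (B n)%:E)%E = (limn (series B))%:E.
    rewrite -EFin_lim//; congr (limn _); apply/funext => n /=.
    by rewrite sumEFin.
  by move=> ->; rewrite ltry.
move=> N [mN N0 subN]; exists N; split => // w nw; apply: subN => h; apply: nw => e e0.
have [M hM] := h e e0; exists M => n /hM.
by rewrite sumEFin lee_fin.
Qed.

Lemma cvgn_dyadic_blocks (z : nat -> R) (g : nat -> R) :
  (forall m n, (n <= 2 ^ m)%N -> `|\sum_(2 ^ m <= k < 2 ^ m + n) z k| <= g m) ->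
  (forall e : R, 0 < e -> exists M, forall n, (M <= n)%N -> \sum_(M <= m < n) g m <= e) ->
  cvgn (series z).
Proof.
move=> zg gs; apply: cvgn_cauchy => e e0; have [M gM] := gs e e0.
exists (2 ^ M)%N => n Mn.
have sE N : (2 ^ M <= N)%N -> series z N - series z (2 ^ M)%N = \sum_(2 ^ M <= k < N) z k.
  by move=> MN; rewrite /series /= (@big_cat_nat _ _ _ (2 ^ M)%N 0 N)//= addrAC subrr add0r.
rewrite sE//.
have key j : forall N, (2 ^ M <= N)%N -> (N <= 2 ^ (M + j))%N ->
    `|\sum_(2 ^ M <= k < N) z k| <= \sum_(M <= m < M + j) g m.
  elim: j => [|j IH] N MN; rewrite ?addn0.
    move=> NM; have -> : N = (2 ^ M)%N by apply/eqP; rewrite eqn_leq NM.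
    by rewrite !big_geq// normr0.
  rewrite addnS => NM; rewrite big_nat_recr ?leq_addr//=.
  have [NMj|NMj] := leqP N (2 ^ (M + j)).
    apply: le_trans (IH N MN NMj) _; rewrite lerDl.
    by apply: le_trans (zg (M + j)%N 0%N _) => //.
  have Mj : (2 ^ M <= 2 ^ (M + j))%N by rewrite leq_pexp2l// leq_addr.
  rewrite (@big_cat_nat _ _ _ (2 ^ (M + j))%N)/= ?(ltnW NMj)//.
  apply: le_trans (ler_normD _ _) _; rewrite lerD ?IH//.
  have -> : N = (2 ^ (M + j) + (N - 2 ^ (M + j)))%N by rewrite subnKC// ltnW.
  by apply: zg; rewrite leq_subLR addnn -mul2n -expnS.
apply: le_trans (key n n _ _) _ => //.
  by apply: leq_trans (ltnW (ltn_expl n (ltnSn 1))) _; rewrite leq_pexp2l// leq_addl.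
by apply: gM; rewrite leq_addr.
Qed.

Lemma succ_le_expr (z : R) m : 1 < z -> m.+1%:R <= ((z - 1)^-1 + 1) * z ^+ m.
Proof.
move=> z1; have zp : 0 < z - 1 by lra.
have K0 : 0 < (z - 1)^-1 by rewrite invr_gt0.
elim: m => [|m IH]; first by rewrite expr0 mulr1 lerDr ltW.
rewrite -[m.+2%:R]natr1; apply: le_trans (lerD IH (lexx 1)) _.
have zm : 1 <= z ^+ m by rewrite exprn_ege1// ltW.
rewrite exprS mulrCA -lerBrDl.
have -> : z * (((z - 1)^-1 + 1) * z ^+ m) - ((z - 1)^-1 + 1) * z ^+ m = z * z ^+ m.
  by field; rewrite gt_eqF.
nra.
Qed.

Lemma cvg_series_geometric_poly (A x : R) : 0 <= A -> 0 < x < 1 ->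
  cvgn (series (fun m : nat => A * m.+1%:R * x ^+ m)).
Proof.
move=> A0 /andP[x0 x1].
(* A ratio strictly between [x] and 1: the factor [m + 1] is absorbed by the powers of
   [y / x > 1]. *)
pose y := (1 + x) / 2.
have y0 : 0 < y by rewrite /y; lra.
have y1 : y < 1 by rewrite /y; lra.
have xy : x < y by rewrite /y; lra.
pose z := y / x.
have z1 : 1 < z by rewrite /z ltr_pdivlMr ?mul1r.
have zp : 0 < z - 1 by lra.
pose K := (z - 1)^-1 + 1.
have K0 : 0 <= K by rewrite addr_ge0// invr_ge0 ltW.
apply: (@series_le_cvg _ _ (geometric (A * K) y)).
- by move=> m; rewrite !mulr_ge0// exprn_ge0// ltW.
- by move=> m /=; rewrite !mulr_ge0// exprn_ge0// ltW.
- move=> m /=; rewrite -!mulrA ler_wpM2l//.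
  have -> : y ^+ m = z ^+ m * x ^+ m by rewrite -exprMn divfK// gt_eqF.
  by rewrite mulrA ler_wpM2r ?exprn_ge0 ?(ltW x0)// succ_le_expr.
by apply: is_cvg_geometric_series; rewrite ger0_norm// ltW.
Qed.

Lemma Ex_orthogonal_sum (U : nat -> T -> R) (I : seq nat) : uniq I ->
  (forall k, L2 P (U k)) ->
  (forall k k', k != k' -> Ex P (fun w => U k w * U k' w) = 0) ->
  Ex P (fun w => (\sum_(k <- I) U k w) ^+ 2) = \sum_(k <- I) Ex P (fun w => U k w ^+ 2).
Proof.
move=> uI U2 U0.
have iUU k k' : L1 P (fun w => U k w * U k' w) by exact: L2_L1M.
have -> : (fun w => (\sum_(k <- I) U k w) ^+ 2) =
    (fun w => \sum_(k <- I) \sum_(k' <- I) U k w * U k' w).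
  by apply/funext => w; rewrite expr2 big_distrlr.
rewrite Ex_sum => [|k _]; last exact: L1_sum.
rewrite big_seq [RHS]big_seq; apply: eq_bigr => k kI.
rewrite Ex_sum// (bigD1_seq k)//= big1 ?addr0 => [|k' k'k].
  by congr Ex; apply/funext => w; rewrite expr2.
by apply: U0; rewrite eq_sym.
Qed.

(** By the maximal inequality the fluctuation over the block from [2 ^ m] has L1 norm of order
    [(m + 1) * 2 ^ (m * (1 - 2 * sigma) / 2)], which is summable because [sigma > 1 / 2]. *)
Lemma ae_cvg_orthogonal_series (Z : nat -> T -> R) (A sigma : R) :
  0 < A -> 2^-1 < sigma -> (forall k, L2 P (Z k)) ->
  (forall k k', k != k' -> Ex P (fun w => Z k w * Z k' w) = 0) ->
  (forall k, Ex P (fun w => Z k w ^+ 2) <= A * k.+1%:R `^ (- (2 * sigma))) ->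
  {ae P, forall w, cvgn (series (Z ^~ w))}.
Proof.
move=> A0 s2 Z2 Z0 ZA.
pose x : R := 2 `^ ((1 - 2 * sigma) / 2).
have x0 : 0 < x by rewrite powR_gt0.
have x1 : x < 1.
  by rewrite /x -[ltRHS](powRr0 2) /powR gt_eqF// ltr_expR ltr_pM2r ?ln_gt0 ?ltr1n//; lra.
pose V m : R := A * (2 ^+ m) `^ (- (2 * sigma)).
have V0 m : 0 <= V m by rewrite mulr_ge0 ?powR_ge0// ltW.
have Vx m : 2 ^+ m * V m = A * x ^+ m ^+ 2.
  rewrite /V mulrCA; congr (_ * _).
  rewrite -[(2 : R) ^+ m]powR_mulrn// -powRrM -powRD; last by rewrite pnatr_eq0 implybT.
  rewrite /x -exprM -powR_mulrn ?powR_ge0// -powRrM; congr (_ `^ _).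
  by rewrite natrM; lra.
(* The terms before [2 ^ m] are erased: the maximal inequality asks for the variance bound on every
   interval, whereas [V m] dominates only the terms from [2 ^ m] on. *)
pose U m k w : R := if (2 ^ m <= k)%N then Z k w else 0.
have U2 m k : L2 P (U m k) by rewrite /U; case: (leqP (2 ^ m) k) => _; [exact: Z2|exact: L2_cst].
have UV m k : Ex P (fun w => U m k w ^+ 2) <= V m.
  rewrite /U; case: (leqP (2 ^ m) k) => mk; last first.
    by under eq_fun do rewrite expr0n; rewrite Ex_cst.
  apply: le_trans (ZA k) _; rewrite /V ler_wpM2l ?(ltW A0)//.
  rewrite !powRN lef_pV2 ?posrE ?powR_gt0 ?ltr0n ?exprn_gt0//.
  apply: ge0_ler_powR; rewrite ?nnegrE ?exprn_ge0 ?ler0n//; first lra.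
  by rewrite -natrX ler_nat ltnW// ltnS.
have U0 m k k' : k != k' -> Ex P (fun w => U m k w * U m k' w) = 0.
  move=> kk'; rewrite /U; case: (leqP (2 ^ m) k) => _; case: (leqP (2 ^ m) k') => _.
  - exact: Z0.
  - by under eq_fun do rewrite mulr0; rewrite Ex_cst.
  - by under eq_fun do rewrite mul0r; rewrite Ex_cst.
  - by under eq_fun do rewrite mul0r; rewrite Ex_cst.
pose B m := (1 + A) * m.+1%:R * x ^+ m.
have Bp m : 0 < B m by rewrite !mulr_gt0 ?exprn_gt0// addr_gt0.
have gex m : exists g : T -> R, [/\ L1 P g, Ex P g <= B m &
    forall w n, (n <= 2 ^ m)%N -> `|\sum_(2 ^ m <= k < 2 ^ m + n) U m k w| <= g w].
  apply: (@dyadic_maximal _ _ _ P (U m) _ (fun j => 2 ^+ j * V m) m) => //.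
  - by move=> I; apply: L2_sum => k _; exact: U2.
  - by move=> j _; rewrite exprS mulrA.
  - move=> a j _; rewrite (Ex_orthogonal_sum (iota_uniq _ _) (U2 m) (U0 m)).
    apply: (@le_trans _ _ (\sum_(a <= k < a + 2 ^ j) V m)); first exact: ler_sum.
    by rewrite big_const_nat iter_addr_0 addKn -[leLHS]mulr_natl natrX.
  - rewrite Vx /B !exprMn mulrCA mulrA ler_wpM2r ?sqr_ge0// ler_wpM2r ?sqr_ge0//.
    by have := sqr_ge0 A; rewrite sqrrD; lra.
have [g hg] := choice gex.
have ig m : L1 P (g m) by case: (hg m).
have gB m : Ex P (g m) <= B m by case: (hg m).
have Ug m w n : (n <= 2 ^ m)%N -> `|\sum_(2 ^ m <= k < 2 ^ m + n) U m k w| <= g m w.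
  by case: (hg m) => _ _; apply.
have g0 m w : 0 <= g m w by apply: le_trans (Ug m w 0%N _).
have cB : cvgn (series B).
  by apply: cvg_series_geometric_poly; [rewrite addr_ge0// ltW|apply/andP].
have := ae_L1_series_tail ig g0 gB cB; apply: filterS => w gtail.
apply: (@cvgn_dyadic_blocks (Z ^~ w) (g ^~ w)) => // m n nm.
apply: le_trans (Ug m w n nm); rewrite le_eqVlt; apply/orP; left; apply/eqP.
congr (`| _ |); rewrite big_nat [RHS]big_nat; apply: eq_bigr => k /andP[mk _].
by rewrite /U mk.
Qed.

End AlmostSureSeries.

(** * Finite approximations of the process *)

(** A multiplicative triangle inequality, [brak x <= brak y * brak (y - x)], used to compare the
    decay around a time [k] with the decay around 0. *)
Lemma succ_le_absz_mul (x y : int) n : (n <= `|x|)%N ->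
  (n < `|y|.+1 * `|(y - x)%R|.+1)%N.
Proof.
have : (`|x| <= `|y| + `|(y - x)%R|)%N by lia.
by move: `|x|%N `|y|%N `|(y - x)%R|%N => a b e; rewrite mulSn mulnS; lia.
Qed.

Section Model.
Context d (T : measurableType d) (R : realType) (P : probability T R) (s : nat)
  (xi : int -> {RV P >-> s.-tuple R}) (xi_iid : iid xi).
Local Notation L1 := (L1 P).
Local Notation L2 := (L2 P).
Local Notation Ex := (Ex P).

Lemma measurable_xi l : measurable_fun [set: T] (xi l).
Proof. exact: measurable_funPT. Qed.

Lemma iid_Ex l (phi : s.-tuple R -> R) : measurable_fun [set: s.-tuple R] phi ->
  L1 (fun w => phi (xi 1 w)) ->
  L1 (fun w => phi (xi l w)) /\ Ex (fun w => phi (xi l w)) = Ex (fun w => phi (xi 1 w)).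
Proof.
move=> mphi i1; apply: same_distribution_Ex => //; try exact: measurable_xi.
exact: xi_iid.2.
Qed.

Lemma iid_prod (L : finType) (iota : L -> int) : injective iota ->
  forall phi : L -> s.-tuple R -> R,
  (forall l, measurable_fun [set: s.-tuple R] (phi l)) ->
  (forall l, L1 (fun w => phi l (xi 1 w))) ->
  L1 (fun w => \prod_l phi l (xi (iota l) w)) /\
  Ex (fun w => \prod_l phi l (xi (iota l) w)) = \prod_l Ex (fun w => phi l (xi 1 w)).
Proof.
move=> iinj phi mphi i1.
have site l := iid_Ex (iota l) (mphi l) (i1 l).
have [|i E] := @indep_prod _ _ _ _ _ P _ xi xi_iid.1 L iota iinj phi mphi.
  by move=> l; exact: (site l).1.
by split => //; rewrite E; apply: eq_bigr => l _; exact: (site l).2.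
Qed.

(* Enumerates the indices from [- N] to [N - 1]. *)
Definition two_sided N (l : 'I_N + 'I_N) : int :=
  match l with inl i => Posz i | inr i => Negz i end.

Lemma two_sided_inj N : injective (@two_sided N).
Proof. by move=> [i|i] [j|j] //= [] /ord_inj ->. Qed.

Lemma mem_two_sided N (x : int) : (`|x| < N)%N -> exists l, @two_sided N l = x.
Proof.
case: x => n xN; first by exists (inl (Ordinal xN)).
by exists (inr (Ordinal (ltnW xN : n < N)%N)).
Qed.

Context (c : int -> 'I_s -> R).

Definition finite_product (L : finType) (iota : L -> int) (k : int) : T -> R :=
  linear_product (fun l => xi (iota l)) (fun r l => c (k - iota l) r).

Context (K q : R) (HK : moments P (xi 1) K q) (q12 : 1 < q < 2).

Let tnth_zeta r (x : s.-tuple R) : tnth x r = zeta [set r]%SET x.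
Proof. by rewrite /zeta big_set1. Qed.

Let coord2 l r : L2 (fun w => tnth (xi l w) r) /\ Ex (fun w => tnth (xi l w) r ^+ 2) <= K.
Proof.
have [_ _ /(_ [set r]%SET)] := HK; rewrite heavy1 => /(_ isT)[[m1 i1] E1] _ _.
under eq_fun do rewrite tnth_zeta.
under [X in Ex X]eq_fun do rewrite tnth_zeta.
have mz : measurable_fun [set: s.-tuple R] (fun x => zeta [set r]%SET x ^+ 2).
  by apply: measurable_funX; exact: measurable_zeta.
have [i E] := iid_Ex l mz i1.
split; last by rewrite E.
split => //; apply: measurableT_comp; [exact: measurable_zeta|exact: measurable_xi].
Qed.

Let coord_orth l l' r : l != l' -> Ex (fun w => tnth (xi l w) r * tnth (xi l' w) r) = 0.
Proof.
move=> ll'; pose iota (b : bool) := if b then l else l'.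
have iinj : injective iota.
  by move=> [] [] //= e; move: ll'; rewrite e eqxx.
have mt : measurable_fun [set: s.-tuple R] (fun x => tnth x r) by exact: measurable_tnth.
have i1 : L1 (fun w => tnth (xi 1 w) r) := L2_L1 (coord2 1 r).1.
have [_] := iid_prod iinj (fun _ => mt) (fun _ => i1).
rewrite big_bool /= => E.
transitivity (Ex (fun w => \prod_l0 tnth (xi (iota l0) w) r)).
  by congr Ex; apply/funext => w; rewrite big_bool.
rewrite E; suff -> : Ex (fun w => tnth (xi 1 w) r) = 0 by rewrite mul0r.
by under eq_fun do rewrite tnth_zeta; case: HK.
Qed.

Context (A : R) (sigma : 'I_s -> R) (A0 : 0 < A) (s2 : forall r, 2^-1 < sigma r)
  (cdec : forall l r, `|c l r| <= A * brak R l `^ (- sigma r)).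

Let half_series (iota : nat -> int) (k : int) r : injective iota ->
  (forall n, (n <= `|iota n|)%N) ->
  {ae P, forall w, cvgn (series (fun n => c (k - iota n) r * tnth (xi (iota n) w) r))}.
Proof.
move=> iinj in_.
have K1 : 1 <= K by case: HK.
have K0 : 0 < K by exact: lt_le_trans K1.
apply: (@ae_cvg_orthogonal_series _ _ _ P
  (fun n w => c (k - iota n) r * tnth (xi (iota n) w) r)
  (A ^+ 2 * brak R k `^ (2 * sigma r) * K) (sigma r)) => //.
- by rewrite !mulr_gt0 ?powR_gt0 ?brak_gt0 ?exprn_gt0.
- by move=> n; apply: L2Z; exact: (coord2 _ _).1.
- move=> n n' nn'.
  have ii : iota n != iota n' by apply: contra nn' => /eqP/iinj ->.
  have -> : (fun w => c (k - iota n) r * tnth (xi (iota n) w) r *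
      (c (k - iota n') r * tnth (xi (iota n') w) r)) =
     (fun w => (c (k - iota n) r * c (k - iota n') r) *
        (tnth (xi (iota n) w) r * tnth (xi (iota n') w) r)).
    by apply/funext => w; ring.
  rewrite ExZ ?coord_orth ?mulr0//.
  by apply: L2_L1M; exact: (coord2 _ _).1.
- move=> n; have [[mt i2] E2] := coord2 (iota n) r.
  under eq_fun do rewrite exprMn.
  rewrite ExZ//; set cc := c _ _; set e2 := Ex _.
  have e20 : 0 <= e2 by apply: Ex_ge0 => w; exact: sqr_ge0.
  rewrite [leRHS]mulrAC; apply: ler_pM; [exact: sqr_ge0|exact: e20| |exact: E2].
  have := cdec (k - iota n) r; rewrite -/cc; set y := brak R (k - iota n) => cy.
  have y0 : 0 < y by exact: brak_gt0.
  apply: (@le_trans _ _ ((A * y `^ (- sigma r)) ^+ 2)).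
    by rewrite -(real_normK (num_real cc)) lerXn2r ?nnegrE ?mulr_ge0 ?powR_ge0 ?(ltW A0).
  rewrite exprMn -[leRHS]mulrA; apply: ler_wpM2l; first exact: sqr_ge0.
  have s0 : 0 <= 2 * sigma r by have := s2 r; lra.
  have -> : (y `^ (- sigma r)) ^+ 2 = (y `^ (2 * sigma r))^-1.
    by rewrite -powR_mulrn ?powR_ge0// -powRrM mulNr powRN mulrC.
  rewrite powRN ler_pdivlMr ?powR_gt0// mulrC ler_pdivrMr ?powR_gt0//.
  rewrite -powRM ?ler0n ?(ltW (brak_gt0 _ _))//; try exact: ltW.
  apply: ge0_ler_powR => //; rewrite ?nnegrE ?ler0n ?mulr_ge0 ?(ltW y0) ?(ltW (brak_gt0 _ _))//.
  rewrite /y /brak -natrM ler_nat; exact: succ_le_absz_mul (in_ n).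
Qed.

Let half_sum (iota : nat -> int) k r w n : series (fun n => c (k - iota n) r *
    tnth (xi (iota n) w) r) n = \sum_(i < n) c (k - iota i) r * tnth (xi (iota i) w) r.
Proof. by rewrite /series /= big_mkord. Qed.

Lemma ae_finite_product_cvg : {ae P, forall w, forall k,
  (fun N => finite_product (@two_sided N) k w) @ \oo --> process_product c xi k w}.
Proof.
pose good (k : int) (r : 'I_s) w (neg : bool) :=
  let iota n := if neg then Negz n else Posz n in
  cvgn (series (fun n => c (k - iota n) r * tnth (xi (iota n) w) r)).
have aegood k r neg : {ae P, forall w, good k r w neg}.
  apply: half_series; case: neg => //; first by move=> x y [].
  by move=> x y [].
(* One almost sure event must serve all times, all coordinates and both half series; these triples
   are countable and are enumerated by [unpickle]. *)
have : {ae P, forall w, forall n : nat,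
    if @unpickle (int * 'I_s * bool)%type n is Some (k, r, neg) then good k r w neg else True}.
  apply: ae_foralln => n; case: unpickle => [[[k r] neg]|]; first exact: aegood.
  by apply: aeW.
apply: filterS => w wgood k.
have {}wgood r neg : good k r w neg by have := wgood (pickle (k, r, neg)); rewrite pickleK.
have cvg1 r : (fun N => \sum_(l : 'I_N + 'I_N) c (k - two_sided l) r *
    tnth (xi (two_sided l) w) r) @ \oo --> linear_process c xi k r w.
  under eq_fun do rewrite big_sumType/=.
  have h neg := wgood r neg; rewrite /good in h.
  have e0 : (fun N => \sum_(l < N) c (k - Posz l) r * tnth (xi (Posz l) w) r) =
      series (fun n => c (k - Posz n) r * tnth (xi (Posz n) w) r).
    by apply/funext => N; rewrite (half_sum Posz).
  have e1 : (fun N => \sum_(l < N) c (k - Negz l) r * tnth (xi (Negz l) w) r) =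
      series (fun n => c (k - Negz n) r * tnth (xi (Negz n) w) r).
    by apply/funext => N; rewrite (half_sum Negz).
  by apply: cvgD; rewrite ?e0 ?e1; [exact: (h false)|exact: (h true)].
rewrite /finite_product /linear_product /process_product.
elim: (index_enum _) => [|r rs IH].
  by under eq_fun do rewrite big_nil; rewrite big_nil; exact: cvg_cst.
by under eq_fun do rewrite big_cons; rewrite big_cons; exact: cvgM.
Qed.

Lemma measurable_process_product k : measurable_fun [set: T] (process_product c xi k).
Proof.
apply: measurable_bigprod => r _; apply: measurable_funD; apply: measurable_limn => n.
  rewrite /series /=; apply: measurable_sum => i.
  apply: measurable_funM; first exact: measurable_cst.
  apply: (measurableT_comp (f := fun x : s.-tuple R => tnth x r)); first exact: measurable_tnth.
  exact: measurable_xi.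
rewrite /series /=; apply: measurable_sum => i.
apply: measurable_funM; first exact: measurable_cst.
apply: (measurableT_comp (f := fun x : s.-tuple R => tnth x r)); first exact: measurable_tnth.
exact: measurable_xi.
Qed.

End Model.

Section Decay.
Context (R : realType) (s : nat) (c : int -> 'I_s -> R) (A sigma : R) (A0 : 0 < A)
  (s2 : 2^-1 < sigma) (cdec : forall l r, `|c l r| <= A * brak R l `^ (- sigma)).

Let sq_le l r : c l r ^+ 2 <= A ^+ 2 * brak R l `^ (- (2 * sigma)).
Proof.
rewrite -(real_normK (num_real _)); apply: (@le_trans _ _ ((A * brak R l `^ (- sigma)) ^+ 2)).
  by rewrite lerXn2r ?nnegrE ?mulr_ge0 ?powR_ge0 ?(ltW A0).
by rewrite exprMn ler_wpM2l ?sqr_ge0// -powR_mulrn ?powR_ge0// -powRrM mulNr mulrC.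
Qed.

Lemma decay_square_sum : exists2 kappa, 1 <= kappa &
  forall r S, uniq S -> \sum_(l <- S) c l r ^+ 2 <= kappa ^+ 2.
Proof.
have h : 1 < 2 * sigma by have := s2; lra.
have [C C0 HC] := @sum_brak_le R (2 * sigma) h.
exists (1 + A ^+ 2 * C) => [|r S uS].
  by rewrite lerDl mulr_ge0 ?sqr_ge0// ltW.
apply: (@le_trans _ _ (A ^+ 2 * C)).
  apply: le_trans (ler_sum _ (fun l _ => sq_le l r)) _.
  by rewrite -mulr_sumr ler_wpM2l ?sqr_ge0// HC.
have : 0 <= A ^+ 2 * C by rewrite mulr_ge0 ?sqr_ge0// ltW.
by move: (A ^+ 2 * C) => y; nra.
Qed.

Lemma decay_square_tail eps : 0 < eps -> exists N, forall r S, uniq S ->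
  (forall l, l \in S -> (N <= `|l|)%N) -> \sum_(l <- S) c l r ^+ 2 <= eps.
Proof.
(* The exponent [2 * sigma] is split into [b > 1], kept for summability, and [a > 0], spent on the
   smallness of the tail. *)
move=> e0; pose b := (1 + 2 * sigma) / 2; pose a := 2 * sigma - b.
have b1 : 1 < b by have := s2; rewrite /b; lra.
have a0 : 0 < a by have := s2; rewrite /a /b; lra.
have [C C0 HC] := @sum_brak_le R b b1.
have AC0 : 0 < A ^+ 2 * C by rewrite mulr_gt0 ?exprn_gt0.
pose y := (A ^+ 2 * C / eps) `^ a^-1.
have y0 : 0 < y by rewrite powR_gt0// divr_gt0.
have [N yN] : exists N : nat, y < N%:R.
  by exists (Num.bound y); exact: archi_boundP (ltW y0).
exists N => r S uS SN.
apply: (@le_trans _ _ (\sum_(l <- S) A ^+ 2 * (y `^ (- a) * brak R l `^ (- b)))).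
  rewrite !big_seq; apply: ler_sum => l lS; apply: le_trans (sq_le l r) _.
  rewrite ler_wpM2l ?sqr_ge0//.
  have -> : - (2 * sigma) = - a + - b by rewrite /a; ring.
  have yb : y <= brak R l.
    by apply: le_trans (ltW yN) _; rewrite /brak ler_nat; apply: leqW; exact: SN.
  rewrite powRD ?(gt_eqF (brak_gt0 _ _)) ?implybT// ler_wpM2r ?powR_ge0//.
  rewrite !powRN lef_pV2 ?posrE ?powR_gt0 ?brak_gt0 ?divr_gt0//.
  by apply: ge0_ler_powR; rewrite ?nnegrE ?(ltW a0) ?(ltW y0) ?(ltW (brak_gt0 _ _)).
rewrite -!mulr_sumr.
apply: (@le_trans _ _ (A ^+ 2 * (y `^ (- a) * C))).
  by rewrite !ler_wpM2l ?sqr_ge0 ?powR_ge0 ?HC.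
rewrite /y -powRrM mulrN mulVf ?gt_eqF// powRN powRr1 ?divr_ge0 ?(ltW AC0) ?(ltW e0)//.
by rewrite le_eqVlt; apply/orP; left; apply/eqP; field; rewrite !gt_eqF.
Qed.

End Decay.

(** * Convergence in mean of the finite products *)

Section MeanConvergence.
Context d (T : measurableType d) (R : realType) (P : probability T R) (s : nat)
  (xi : int -> {RV P >-> s.-tuple R}) (xi_iid : iid xi).
Local Notation L1 := (L1 P).
Local Notation L2 := (L2 P).
Local Notation Ex := (Ex P).
Context (K q : R) (HK : moments P (xi 1) K q) (q12 : 1 < q < 2).
Context (c : int -> 'I_s -> R) (kappa : R) (kappa1 : 1 <= kappa)
  (ck : forall r S, uniq S -> \sum_(l <- S) c l r ^+ 2 <= kappa ^+ 2)
  (ctail : forall eps, 0 < eps -> exists N, forall r S, uniq S ->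
     (forall l, l \in S -> (N <= `|l|)%N) -> \sum_(l <- S) c l r ^+ 2 <= eps).

Let kappa0 : 0 < kappa. Proof. exact: lt_le_trans kappa1. Qed.

Let L1_lp (L : finType) (iota : L -> int) (iinj : injective iota) :=
  @L1_linear_product _ _ _ _ s L (xi 1) (fun l => xi (iota l)) (measurable_xi xi 1)
    (fun l => measurable_xi xi (iota l)) (iid_prod xi_iid iinj) K q HK q12.

Let CL := L1_const s K.

Let CL0 : 0 <= CL. Proof. exact: L1_const_ge0 HK. Qed.

Let sum_shift (L : finType) (iota : L -> int) (Q : pred L) k r : injective iota ->
  \sum_(l | Q l) c (k - iota l) r ^+ 2 =
  \sum_(x <- [seq k - iota l | l <- enum Q]) c x r ^+ 2.
Proof. by move=> iinj; rewrite big_map big_enum. Qed.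

Let uniq_shift (L : finType) (iota : L -> int) (Q : pred L) k : injective iota ->
  uniq [seq k - iota l | l <- enum Q].
Proof.
move=> iinj; rewrite map_inj_uniq ?enum_uniq// => x y /addrI /oppr_inj; exact: iinj.
Qed.

Lemma L1_finite_product (L : finType) (iota : L -> int) k : injective iota ->
  L1 (finite_product xi c iota k).
Proof.
move=> iinj; apply: (L1_lp iinj (kappa := fun=> kappa) _ _).1 => // r.
by rewrite (sum_shift _ _ _ iinj); apply/ck/uniq_shift.
Qed.

(** Each coefficient family is split into the part seen by [A] and the rest, and the product is
    expanded over the sets [J] of coordinates using the first part. The full set gives the product
    over [A]; every other term contains a family of l2 norm at most [eps']. *)
Lemma finite_product_cauchy eps : 0 < eps -> exists N, forall (A B : finType) (iotaA : A -> int)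
    (iotaB : B -> int) (e : A -> B) (k : int),
  injective iotaB -> injective e -> (forall a, iotaB (e a) = iotaA a) ->
  (forall x, (`|k - x| < N)%N -> exists a, iotaA a = x) ->
  Ex (fun w => `|finite_product xi c iotaB k w - finite_product xi c iotaA k w|) <= eps.
Proof.
move=> e0; pose D := #|{set 'I_s}|%:R * (CL * kappa ^+ s) + 1.
have D1 : 1 <= D by rewrite lerDr mulr_ge0// mulr_ge0// exprn_ge0// ltW.
have D0 : 0 < D by exact: lt_le_trans D1.
(* The cap at 1 gives [eps' <= kappa], so that all factors but one can be bounded by [kappa]. *)
pose eps' := Num.min 1 (eps / D).
have e'0 : 0 < eps' by rewrite lt_min ltr01 divr_gt0.
have [N HN] := ctail (exprn_gt0 2 e'0).
exists N => A B iotaA iotaB e k Binj einj eAB cover.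
pose cB r l := c (k - iotaB l) r.
pose inA l := [exists a, e a == l].
pose mix (J : {set 'I_s}) r l := if r \in J then (if inA l then cB r l else 0)
   else (if inA l then 0 else cB r l).
pose X l := xi (iotaB l) : T -> _.
have AE w : finite_product xi c iotaA k w = linear_product X (mix finset.setT) w.
  rewrite /finite_product /linear_product; apply: eq_bigr => r _; rewrite /mix finset.in_setT.
  rewrite [RHS](eq_bigr (fun l => if inA l then cB r l * tnth (X l w) r else 0)); last first.
    by move=> l _; case: ifP => //; rewrite mul0r.
  rewrite -big_mkcond /=.
  rewrite (eq_bigl (mem (e @: [set: A]%SET))); last first.
    move=> l; apply/existsP/imsetP => [[a /eqP <-]|[a _ ->]]; first by exists a.
    by exists a.
  rewrite big_imset /=; last by move=> x y _ _; exact: einj.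
  by apply: eq_big => [a|a _]; rewrite ?inE// /cB /X eAB.
have BE w : finite_product xi c iotaB k w = \sum_(J : {set 'I_s}) linear_product X (mix J) w.
  rewrite /finite_product /linear_product.
  rewrite (eq_bigr (fun r => (\sum_l mix finset.setT r l * tnth (X l w) r) +
     (\sum_l mix finset.set0 r l * tnth (X l w) r))); last first.
    move=> r _; rewrite -big_split /=; apply: eq_bigr => l _; rewrite /mix finset.in_setT finset.in_set0.
    by rewrite /cB /X; case: ifP => _; rewrite mul0r ?addr0 ?add0r.
  rewrite bigA_distr /=; apply: eq_bigr => J _; apply: eq_bigr => r _.
  by rewrite /mix; case: ifP => rJ; rewrite ?finset.in_setT ?finset.in_set0.
have sqA r : \sum_l (if inA l then cB r l else 0) ^+ 2 <= kappa ^+ 2.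
  rewrite (eq_bigr (fun l => if inA l then cB r l ^+ 2 else 0)); last first.
    by move=> l _; case: ifP => //; rewrite expr0n.
  rewrite -big_mkcond /cB (sum_shift _ _ _ Binj); exact/ck/uniq_shift.
have sqE r : \sum_l (if inA l then 0 else cB r l) ^+ 2 <= eps' ^+ 2.
  rewrite (eq_bigr (fun l => if ~~ inA l then cB r l ^+ 2 else 0)); last first.
    by move=> l _; case: (inA l) => //=; rewrite expr0n.
  rewrite -big_mkcond /cB (sum_shift (fun l => ~~ inA l) _ _ Binj).
  apply: HN; first exact: uniq_shift.
  move=> x /mapP[l]; rewrite mem_enum unfold_in => nA ->.
  rewrite leqNgt; apply: contraNN nA => xN; have [a /esym ea] := cover _ xN.
  by apply/existsP; exists a; apply/eqP/Binj; rewrite eAB.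
have bnd J : L1 (linear_product X (mix J)) /\
    Ex (fun w => `|linear_product X (mix J) w|) <=
    CL * \prod_r (if r \in J then kappa else eps').
  apply: (L1_lp Binj) => r; first by case: ifP.
  by rewrite /mix; case: ifP.
have bnd' J : J != finset.setT ->
    Ex (fun w => `|linear_product X (mix J) w|) <= CL * (kappa ^+ s * eps').
  move=> JT; apply: le_trans (bnd J).2 _; rewrite ler_wpM2l//.
  have [r0 r0J] : exists r0, r0 \notin J.
    apply/existsP; rewrite -negb_forall; apply: contraNN JT => /forallP h.
    by apply/eqP/setP => r; rewrite h inE.
  rewrite (bigD1 r0)//= (negbTE r0J) mulrC ler_wpM2r ?(ltW e'0)//.
  apply: (@le_trans _ _ (\prod_(i < s | i != r0) kappa)).
    apply: ler_prod => r _; case: ifP => _; rewrite ?(ltW kappa0) ?(ltW e'0)//=.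
    by rewrite (le_trans _ kappa1)// ge_min lexx.
  rewrite prodr_const; apply: ler_weXn2l => //.
  by rewrite -[leqRHS](card_ord s) max_card.
apply: (@le_trans _ _ (Ex (fun w => \sum_(J : {set 'I_s} | J != finset.setT)
    `|linear_product X (mix J) w|))).
  apply: Ex_le.
  - by apply/L1_abs/L1B; apply: L1_finite_product => //;
      move=> x y xy; apply: einj; apply: Binj; rewrite !eAB.
  - by apply: L1_sum => J _; exact/L1_abs/(bnd J).1.
  - move=> w; rewrite AE BE (bigD1 finset.setT)//= addrC addrK.
    exact: ler_norm_sum.
rewrite Ex_sum => [|J _]; last exact/L1_abs/(bnd J).1.
apply: le_trans (ler_sum _ bnd') _.
rewrite sumr_const -mulr_natl.
apply: (@le_trans _ _ (#|{set 'I_s}|%:R * (CL * (kappa ^+ s * eps')))).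
  rewrite ler_wpM2r ?ler_nat ?max_card// !mulr_ge0 ?exprn_ge0 ?(ltW kappa0) ?(ltW e'0)//.
apply: (@le_trans _ _ (D * eps')).
  by rewrite !mulrA -/CL /D mulrDl !mulrA lerDl mul1r ltW.
by rewrite mulrC -ler_pdivlMr// ge_min lexx orbT.
Qed.

End MeanConvergence.

Lemma L1_limit d (T : measurableType d) (R : realType) (P : probability T R)
    (X : nat -> T -> R) (Y : T -> R) (B : R) :
  (forall n, L1 P (X n)) -> (forall n, Ex P (fun w => `|X n w|) <= B) ->
  measurable_fun [set: T] Y ->
  {ae P, forall w, (X n w) @[n --> \oo] --> Y w} ->
  L1 P Y /\ Ex P (fun w => `|Y w|) <= B.
Proof.
move=> iX XB mY XY.
have mX n : measurable_fun [set: T] (fun w => `|X n w|%:E).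
  by apply/measurable_EFinP; apply: measurableT_comp => //; exact: L1_measurable.
have mYE : measurable_fun [set: T] (fun w => `|Y w|%:E).
  by apply/measurable_EFinP; apply: measurableT_comp.
have le : (\int[P]_w `|Y w|%:E <= B%:E)%E.
  have -> : (\int[P]_w `|Y w|%:E = \int[P]_w limn_einf (fun n => `|X n w|%:E))%E.
    apply: ge0_ae_eq_integral => //.
    - have -> : (fun w => limn_einf (fun n => `|X n w|%:E)) =
          (fun w => - limn_esup (-%E \o (fun n => `|X n w|%:E)))%E.
        by apply/funext => w; rewrite limn_esupN oppeK.
      apply: (measurableT_comp (f := @oppe R)) => //.
      apply: measurable_fun_limn_esup => n.
      by apply: (measurableT_comp (f := @oppe R)).
    - move=> w _; rewrite limn_einf_lim; apply: lime_ge; first exact: is_cvg_einfs.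
      by apply: nearW => n; apply: le_ereal_inf_tmp => _ [m /= _ <-]; rewrite lee_fin.
    - apply: filterS XY => w XYw _.
      have : (`|X n w|%:E @[n --> \oo] --> `|Y w|%:E)%E.
        by apply/cvg_EFin; [exact: nearW|exact: cvg_norm].
      by move=> /cvg_limn_einf_sup[-> _].
  have X0 n w : [set: T] w -> (0 <= `|X n w|%:E)%E by rewrite lee_fin.
  apply: le_trans (fatou P measurableT mX X0) _.
  rewrite limn_einf_lim; apply: lime_le; first exact: is_cvg_einfs.
  apply: nearW => n; apply: ge_ereal_inf; exists (\int[P]_w `|X n w|%:E)%E.
    by exists n => /=.
  by rewrite (ExE (L1_abs (iX n))) lee_fin.
have iY : L1 P Y.
  apply/integrableP; split; first exact/measurable_EFinP.
  by apply: le_lt_trans le _; exact: ltry.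
by split => //; rewrite -lee_fin -(ExE (L1_abs iY)).
Qed.

Section ProcessProductMean.
Context d (T : measurableType d) (R : realType) (P : probability T R) (s : nat)
  (xi : int -> {RV P >-> s.-tuple R}) (xi_iid : iid xi).
Local Notation L1 := (L1 P).
Local Notation L2 := (L2 P).
Local Notation Ex := (Ex P).
Context (K q : R) (HK : moments P (xi 1) K q) (q12 : 1 < q < 2).
Context (c : int -> 'I_s -> R) (A sigma : R) (A0 : 0 < A) (s2 : 2^-1 < sigma)
  (cdec : forall l r, `|c l r| <= A * brak R l `^ (- sigma)).

Let pp := process_product c xi.

(** The order of the quantifiers matters: [N] is uniform in the time and in the index set, which
    allows a window and its translates to be compared. *)
Lemma process_product_near eps : 0 < eps -> exists N, forall (L : finType)
    (iota : L -> int) (k : int), injective iota ->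
  (forall x, (`|k - x| < N)%N -> exists a, iota a = x) ->
  L1 (pp k) /\ Ex (fun w => `|pp k w - finite_product xi c iota k w|) <= eps.
Proof.
move=> e0; have [kappa k1 ck] := decay_square_sum A0 s2 cdec.
have ctail := decay_square_tail A0 s2 cdec.
have [N HN] := finite_product_cauchy xi_iid HK q12 k1 ck ctail e0.
exists N => L iota k iinj cover.
have iL := L1_finite_product xi_iid HK q12 k1 ck k iinj.
have [n0 Hn0] := absz_bounded [seq iota l | l <- enum L].
have Hn l : (`|iota l| < n0)%N by apply/Hn0/map_f; rewrite mem_enum.
pose X n w := finite_product xi c (@two_sided (n + n0)) k w - finite_product xi c iota k w.
have iX n : L1 (X n).
  by apply: L1B => //; apply: (L1_finite_product xi_iid HK q12 k1 ck k (@two_sided_inj _)).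
have XB n : Ex (fun w => `|X n w|) <= eps.
  have [e He] : exists e : L -> 'I_(n + n0) + 'I_(n + n0), forall l, two_sided (e l) = iota l.
    apply: (@fin_all_exists L (fun=> ('I_(n + n0) + 'I_(n + n0))%type)
      (fun l x => two_sided x = iota l)) => l.
    by apply: mem_two_sided; rewrite (leq_trans (Hn l))// leq_addl.
  apply: (HN _ _ _ _ e) => //; first exact: two_sided_inj.
  by move=> l l' ee; apply: iinj; rewrite -!He ee.
have mp : measurable_fun [set: T] (fun w => pp k w - finite_product xi c iota k w).
  apply: measurable_funB; first exact: measurable_process_product.
  exact: L1_measurable iL.
have XY : {ae P, forall w, (X n w) @[n --> \oo] --> pp k w - finite_product xi c iota k w}.
  apply: filterS (ae_finite_product_cvg xi_iid HK A0 (fun=> s2) cdec) => w cw.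
  apply: cvgB; last exact: cvg_cst.
  by rewrite (cvg_shiftn n0 (fun N => finite_product xi c (@two_sided N) k w)); exact: cw.
have [i E] := L1_limit iX XB mp XY.
split => //; have := L1D i iL; congr L1.
by apply/funext => w; rewrite subrK.
Qed.

Let Ex_near (X Y : T -> R) eps : L1 X -> L1 Y -> Ex (fun w => `|X w - Y w|) <= eps ->
  `|Ex X - Ex Y| <= eps.
Proof.
by move=> iX iY; rewrite -ExB//; apply: le_trans; apply: normr_Ex_le; exact: L1B.
Qed.

Let L1_fp (L : finType) (iota : L -> int) k : injective iota ->
  L1 (finite_product xi c iota k).
Proof.
move=> iinj; have [kappa k1 ck] := decay_square_sum A0 s2 cdec.
exact: (L1_finite_product xi_iid HK q12 k1 ck k iinj).
Qed.

Lemma L1_process_product k : L1 (pp k).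
Proof.
have [N HN] := process_product_near ltr01.
have [] // := HN _ (@two_sided (N + `|k|)) k (@two_sided_inj _).
by move=> x xN; apply: mem_two_sided; lia.
Qed.

Lemma Ex_finite_product_cvg k :
  Ex (finite_product xi c (@two_sided N) k) @[N --> \oo] --> Ex (pp k).
Proof.
apply/cvgrPdist_le => eps e0; have [N HN] := process_product_near e0.
exists (N + `|k|)%N => // n /= Nn.
apply: Ex_near; [exact: L1_process_product|exact/L1_fp/two_sided_inj|].
have [] // := HN _ (@two_sided n) k (@two_sided_inj _).
by move=> x xN; apply: mem_two_sided; lia.
Qed.

Lemma Ex_finite_product_shift (L : finType) (iota : L -> int) k h : injective iota ->
  Ex (finite_product xi c (fun l => iota l + h) (k + h)) = Ex (finite_product xi c iota k).
Proof.
move=> iinj; have iinj' : injective (fun l => iota l + h) by move=> x y /addIr; exact: iinj.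
have iz (B : {set 'I_s}) : L1 (fun w => zeta B (xi 1 w)) by have [_ /(_ B)[]] := HK.
have mean iota' (ii : injective iota') f : L1 (block_prod (fun l : L => xi (iota' l)) (@zeta R s) f) /\
    Ex (block_prod (fun l : L => xi (iota' l)) (@zeta R s) f) =
    \prod_l Ex (fun w => zeta (fibre f l) (xi 1 w)).
  by apply: (iid_prod xi_iid ii (phi := fun l => zeta (fibre f l))) => // l; exact: measurable_zeta.
have fpE iota' k' : finite_product xi c iota' k' = fun w => \sum_(f : {ffun 'I_s -> L})
    (\prod_r c (k' - iota' (f r)) r) * block_prod (fun l : L => xi (iota' l)) (@zeta R s) f w.
  by apply/funext => w; exact: linear_productE.
rewrite !fpE.
rewrite !Ex_sum => [|f _|f _]; try by apply: L1Z; apply: (mean _ _ f).1.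
apply: eq_bigr => f _; rewrite !ExZ ?(mean _ iinj f).2 ?(mean _ iinj' f).2//;
  try by apply: (mean _ _ f).1.
by congr (_ * _); apply: eq_bigr => r _; congr c; ring.
Qed.

(** A window around 1 and its translate by [k - 1] give finite products with the same mean, and both
    are close to the process. This identifies the centring constant, taken at time 1, with the mean
    at every time. *)
Lemma Ex_process_product k : Ex (pp k) = Ex (pp 1).
Proof.
apply/eqP; rewrite -subr_eq0 -normr_le0; apply/ler_addgt0Pl => eps e0; rewrite addr0.
have [N HN] := process_product_near (divr_gt0 e0 (ltr0Sn R 1)).
pose iota (l : 'I_N.+1 + 'I_N.+1) := two_sided l + (k - 1).
have iinj : injective iota by move=> x y /addIr; exact: two_sided_inj.
have [_ E1] := HN _ (@two_sided N.+1) 1 (@two_sided_inj _)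
  ltac:(by move=> x xN; apply: mem_two_sided; lia).
have cover x : (`|k - x| < N)%N -> exists l, iota l = x.
  move=> xN; have [|l lx] := @mem_two_sided N.+1 (x - (k - 1)); first by lia.
  by exists l; rewrite /iota lx subrK.
have [_ Ek] := HN _ iota k iinj cover.
have n1 := Ex_near (L1_process_product 1) (L1_fp 1 (@two_sided_inj _)) E1.
have nk := Ex_near (L1_process_product k) (L1_fp k iinj) Ek.
have := Ex_finite_product_shift 1 (k - 1) (@two_sided_inj N.+1).
rewrite (_ : 1 + (k - 1) = k); last by ring.
rewrite -/iota => e; rewrite e in nk.
apply: (@le_trans _ _ (eps / 2 + eps / 2)); last by lra.
move: n1 nk; set e' := Ex (finite_product _ _ _ _) => n1 nk.
have -> : Ex (pp k) - Ex (pp 1) = (Ex (pp k) - e') - (Ex (pp 1) - e') by ring.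
by apply: le_trans (ler_normB _ _) _; exact: lerD.
Qed.

End ProcessProductMean.

(** * Maximal estimate and strong law *)

Section MaximalEstimate.
Context d (T : measurableType d) (R : realType) (P : probability T R) (s : nat)
  (xi : int -> {RV P >-> s.-tuple R}) (xi_iid : iid xi).
Local Notation L1 := (L1 P).
Local Notation L2 := (L2 P).
Local Notation Ex := (Ex P).
Context (K q : R) (HK : moments P (xi 1) K q) (q12 : 1 < q < 2).
Context (c : int -> 'I_s -> R) (kappa : R) (kappa1 : 1 <= kappa)
  (ck : forall r S, uniq S -> \sum_(l <- S) c l r ^+ 2 <= kappa ^+ 2).
Context (p beta D : R) (p1 : 1 < p) (pq : p < q) (beta12 : 1 < beta < 2)
  (betap : beta < 2 / p) (D0 : 0 <= D)
  (adm : forall N, rel {ffun 'I_s -> 'I_N + 'I_N})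
  (Hadm : forall N M, 1 <= M -> forall f g, ~~ adm N f g ->
    let X l := xi (@two_sided N l) : T -> _ in
    Ex (fun w => block_prod X (zeta_light P (xi 1) M) f w *
                 block_prod X (zeta_light P (xi 1) M) g w) = 0 /\
    Ex (block_prod X (zeta_light P (xi 1) M) f) *
    Ex (block_prod X (zeta_light P (xi 1) M) g) = 0)
  (HD : forall N m n, \sum_(m <= k < m + n) \sum_(m <= k' < m + n)
     pair_sum (fun r l => `|shifted c (@two_sided N) k r l|)
              (fun r l => `|shifted c (@two_sided N) k' r l|)
              (fun f g => adm N f g && linked f g) <= D * n%:R `^ beta).

(** Excess over [1 / p] of the growth exponent of the maximum up to [n = 2 ^ m]. The first entry
    comes from the light part, of standard deviation [n ^ (beta / 2)]; the second from the truncated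
    part, of variance [n * M ^ (2 - q)] with [M = n ^ (1 / p)]. *)
Definition decay_exponent : R := Num.max (beta / 2 - p^-1) ((1 - q / p) / 2).
Local Notation eta := decay_exponent.

Let p0 : 0 < p. Proof. exact: lt_trans p1. Qed.
Lemma decay_exponent_lt0 : eta < 0.
Proof.
rewrite gt_max; apply/andP; split; first by move: betap; lra.
have : 1 < q / p by rewrite ltr_pdivlMr ?mul1r.
lra.
Qed.

Let Eb : beta <= 2 * (eta + p^-1).
Proof. have : beta / 2 - p^-1 <= eta by rewrite le_max lexx. lra. Qed.

Let Eq : 1 - q / p <= 2 * eta.
Proof. have : (1 - q / p) / 2 <= eta by rewrite le_max lexx orbT. lra. Qed.

Definition maximal_const : R :=
  4 * K ^+ s * (D + window_heavy_const s kappa) + 1 + 2 * (tail_const s K * kappa ^+ s * K).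

Let pow2D (a b : R) : 2 `^ a * 2 `^ b = 2 `^ (a + b) :> R.
Proof. by rewrite powRD// pnatr_eq0 implybT. Qed.

Let pow2n (m : nat) : (2 ^ m)%:R = 2 `^ m%:R :> R.
Proof. by rewrite natrX powR_mulrn. Qed.

Let pow2_le (a b : R) : a <= b -> 2 `^ a <= 2 `^ b :> R.
Proof. by move=> ab; apply: ler_powR => //; rewrite ler1n. Qed.

Let double_le_sqr (y : R) : 0 <= y -> 2 * y <= (2 * y + 1) ^+ 2.
Proof. by move=> y0; have := mulr_ge0 y0 y0; rewrite expr2; lra. Qed.

Lemma finite_maximal_bound N m : exists g : T -> R, [/\ L1 g,
    Ex g <= maximal_const * m.+1%:R * 2 `^ (m%:R * (eta + p^-1)) &
    forall w n, (n <= 2 ^ m)%N ->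
      `|\sum_(1 <= k < n.+1) (finite_product xi c (@two_sided N) (Posz k) w -
          Ex (finite_product xi c (@two_sided N) (Posz k)))| <= g w].
Proof.
have K1 : 1 <= K by case: HK.
have K0 : 0 <= K by exact: le_trans K1.
have Ks0 : 0 <= K ^+ s by rewrite exprn_ge0.
have kp0 : 0 < kappa by exact: lt_le_trans kappa1.
have W0 := window_heavy_const_ge0 s kappa1.
set W := window_heavy_const s kappa in W0.
have tc0 : 0 <= tail_const s K by exact: tail_const_ge0 HK.
have mm : 0 <= m%:R :> R by exact: ler0n.
pose M : R := 2 `^ (m%:R / p).
have M1 : 1 <= M.
  by rewrite /M -{1}(powRr0 2) ler_powR ?ler1n// divr_ge0 ?(ltW p0).
have Mpow a : M `^ a = 2 `^ (m%:R * (a / p)).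
  by rewrite /M -powRrM; congr (_ `^ _); ring.
have [U [V [UV U2 UE VE]]] := centered_decomposition
  (measurable_xi xi 1) (fun l => measurable_xi xi (@two_sided N l))
  (iid_prod xi_iid (@two_sided_inj N)) HK q12 (@Hadm N)
  (shifted c (@two_sided N)) M1.
pose C1 := 2 * K ^+ s * (D + W).
have C10 : 0 <= C1 by rewrite !mulr_ge0// addr_ge0.
(* The level [M] is fixed by the top scale [m], not by [j]; the superadditivity of the first summand
   comes from [beta > 1]. *)
pose b j := C1 * (2 `^ (j%:R * beta) + M `^ (2 - q) * 2 `^ j%:R).
have b2 j : (j < m)%N -> 2 * b j <= b j.+1.
  move=> _; rewrite /b mulrCA ler_wpM2l// mulrDr; apply: lerD.
    rewrite -{1}(powRr1 (ler0n R 2)) pow2D pow2_le// -natr1; case/andP: beta12; lra.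
  by rewrite mulrCA ler_wpM2l ?powR_ge0// -{1}(powRr1 (ler0n R 2)) pow2D pow2_le// -natr1 addrC.
have Ub a j : (j <= m)%N ->
    Ex (fun w => (\sum_(a <= k < a + 2 ^ j) U k w) ^+ 2) <= b j.
  move=> _; apply: le_trans (UE _) _.
  rewrite /b /C1 -[leRHS]mulrA ler_wpM2l ?mulr_ge0//.
  have M0 : 0 <= M `^ (2 - q) by exact: powR_ge0.
  apply: (@le_trans _ _ (D * (2 ^ j)%:R `^ beta + M `^ (2 - q) * (W * (2 ^ j)%:R))).
    apply: lerD; first exact: HD.
    by rewrite ler_wpM2l//; apply: window_pair_sum_heavy => //; exact: two_sided_inj.
  rewrite pow2n -powRrM; have := @powR_ge0 R 2 (j%:R * beta); have := @powR_ge0 R 2 j%:R.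
  move: (2 `^ (j%:R * beta)) (2 `^ j%:R) (M `^ (2 - q)) M0 => u v z z0 v0 u0.
  have := mulr_ge0 W0 u0; have := mulr_ge0 D0 (mulr_ge0 z0 v0); lra.
pose z : R := 2 `^ (m%:R * (eta + p^-1)).
have z0 : 0 < z by exact: powR_gt0.
have zz : z ^+ 2 = 2 `^ (m%:R * (2 * (eta + p^-1))).
  by rewrite expr2 /z pow2D; congr (_ `^ _); ring.
have bm : b m <= 2 * C1 * z ^+ 2.
  rewrite /b (_ : 2 * C1 * z ^+ 2 = C1 * (z ^+ 2 + z ^+ 2)); last by ring.
  rewrite ler_wpM2l// lerD//; first by rewrite zz pow2_le// ler_wpM2l.
  rewrite zz Mpow pow2D pow2_le// -{2}(mulr1 m%:R) -mulrDr ler_wpM2l//.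
  by move: Eq; rewrite mulrBl; lra.
have C11 : 0 < 2 * C1 + 1 by rewrite ltr_wpDl// mulr_ge0.
have [||g1 [ig1 Eg1 g1U]] := @dyadic_maximal _ _ _ _ _ U2 b m
  (m.+1%:R * ((2 * C1 + 1) * z)) _ b2 Ub _ 1%N.
- by rewrite !mulr_gt0// ltr0n.
- rewrite exprMn ler_wpM2l ?sqr_ge0//; apply: le_trans bm _.
  rewrite exprMn ler_wpM2r ?sqr_ge0//; exact: double_le_sqr.
pose g w := g1 w + \sum_(1 <= k < (2 ^ m).+1) `|V k w|.
have VE' k : L1 (V k) /\ Ex (fun w => `|V k w|) <=
    2 * (tail_const s K * kappa ^+ s * (K * M `^ (1 - q))).
  have [||i E] := VE k (fun=> kappa) => //.
    by move=> r; apply: shifted_sq => //; exact: two_sided_inj.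
  by split => //; rewrite prodr_const card_ord in E.
have iV : L1 (fun w => \sum_(1 <= k < (2 ^ m).+1) `|V k w|).
  by apply: L1_sum => k _; exact/L1_abs/(VE' k).1.
exists g; split.
- exact: L1D.
- rewrite ExD// -/z Ex_sum => [|k _]; last exact/L1_abs/(VE' k).1.
  apply: (@le_trans _ _ (m.+1%:R * ((2 * C1 + 1) * z) +
     (2 ^ m)%:R * (2 * (tail_const s K * kappa ^+ s * (K * M `^ (1 - q)))))).
    apply: lerD => //; apply: le_trans (ler_sum _ (fun k _ => (VE' k).2)) _.
    by rewrite big_const_nat subn1 iter_addr_0 -[leLHS]mulr_natl.
  (* As [1 - q / p <= 2 * eta] and [eta < 0], the exponent is at most [eta + 1 / p]: the L1 norms of
     all remainders in the window may simply be added. *)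
  have Mz : (2 ^ m)%:R * M `^ (1 - q) <= z.
    rewrite pow2n Mpow pow2D pow2_le// -{1}(mulr1 m%:R) -mulrDr ler_wpM2l//.
    have : eta < 0 := decay_exponent_lt0.
    have : 1 < q / p by rewrite ltr_pdivlMr ?mul1r.
    by move: Eq; rewrite mulrBl; lra.
  set t := tail_const s K * kappa ^+ s.
  have t0 : 0 <= t by rewrite mulr_ge0// exprn_ge0// ltW.
  have m1 : (1 : R) <= m.+1%:R by rewrite ler1n.
  have -> : (2 ^ m)%:R * (2 * (t * (K * M `^ (1 - q)))) =
      2 * (t * K) * ((2 ^ m)%:R * M `^ (1 - q)) by ring.
  apply: (@le_trans _ _ (m.+1%:R * ((2 * C1 + 1) * z) + m.+1%:R * (2 * (t * K) * z))).
    rewrite lerD2l; have tK0 : 0 <= 2 * (t * K) by apply: mulr_ge0 => //; exact: mulr_ge0.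
    apply: (@le_trans _ _ (2 * (t * K) * z)); first by rewrite ler_wpM2l.
    by rewrite ler_peMl// mulr_ge0 ?(ltW z0).
  by rewrite /maximal_const -/W -/t /C1 le_eqVlt; apply/orP; left; apply/eqP; ring.
- move=> w n nm; rewrite /g.
  under eq_bigr => k _ do rewrite (UV k w).
  rewrite big_split /=; apply: le_trans (ler_normD _ _) _; apply: lerD.
    by have := g1U w n nm; rewrite add1n.
  apply: le_trans (ler_norm_sum _ _ _) _.
  rewrite [leRHS](@big_cat_nat _ _ _ n.+1) //= ?lerDl//; first exact: sumr_ge0.
Qed.

End MaximalEstimate.

Lemma cvg_bigmax (R : realType) (I : Type) (r : seq I) (u : I -> nat -> R) (l : I -> R) :
  (forall i, u i @ \oo --> l i) ->
  (\big[Num.max/0]_(i <- r) u i n) @[n --> \oo] --> \big[Num.max/0]_(i <- r) l i.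
Proof.
move=> ul; elim: r => [|i r IH].
  by under eq_fun do rewrite big_nil; rewrite big_nil; exact: cvg_cst.
under eq_fun do rewrite big_cons maxr_absE; rewrite big_cons maxr_absE.
apply: cvgM; last exact: cvg_cst.
by apply: cvgD; [exact: cvgD|apply: cvg_norm; exact: cvgB].
Qed.

Lemma cvg_bigsum (R : realType) (I : Type) (r : seq I) (u : I -> nat -> R) (l : I -> R) :
  (forall i, u i @ \oo --> l i) ->
  (\sum_(i <- r) u i n) @[n --> \oo] --> \sum_(i <- r) l i.
Proof.
move=> ul; elim: r => [|i r IH].
  by under eq_fun do rewrite big_nil; rewrite big_nil; exact: cvg_cst.
by under eq_fun do rewrite big_cons; rewrite big_cons; exact: cvgD.
Qed.

Lemma measurable_bigmax d (T : measurableType d) (R : realType) (I : Type) (r : seq I)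
    (h : I -> T -> R) : (forall i, measurable_fun [set: T] (h i)) ->
  measurable_fun [set: T] (fun w => \big[Num.max/0]_(i <- r) h i w).
Proof.
move=> mh; elim: r => [|i r IH].
  by under eq_fun do rewrite big_nil; exact: measurable_cst.
by under eq_fun do rewrite big_cons; exact: measurable_maxr.
Qed.

Lemma expectation_Ex d (T : measurableType d) (R : realType) (P : probability T R)
  (X : T -> R) : fine ('E_P[X])%E = Ex P X.
Proof. by rewrite unlock. Qed.

Section AlmostSureConvergence.
Context d (T : measurableType d) (R : realType) (P : probability T R) (s : nat)
  (xi : int -> {RV P >-> s.-tuple R}) (xi_iid : iid xi).
Local Notation L1 := (L1 P).
Local Notation Ex := (Ex P).
Context (K q : R) (HK : moments P (xi 1) K q) (q12 : 1 < q < 2).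
Context (c : int -> 'I_s -> R) (A sigma : R) (A0 : 0 < A) (s2 : 2^-1 < sigma)
  (cdec : forall l r, `|c l r| <= A * brak R l `^ (- sigma)).
Context (p C eta : R) (p0 : 0 < p) (C0 : 0 <= C) (eta0 : eta < 0)
  (finite_bound : forall N m, exists g : T -> R, [/\ L1 g,
    Ex g <= C * m.+1%:R * 2 `^ (m%:R * (eta + p^-1)) &
    forall w n, (n <= 2 ^ m)%N ->
      `|\sum_(1 <= k < n.+1) (finite_product xi c (@two_sided N) (Posz k) w -
          Ex (finite_product xi c (@two_sided N) (Posz k)))| <= g w]).

Let S n w := \sum_(1 <= k < n.+1) (process_product c xi (Posz k) w -
  Ex (process_product c xi 1)).

Let maximal m w := \big[Num.max/0]_(n < (2 ^ m).+1) `|S n w|.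

Let maximal_ge m w n : (n <= 2 ^ m)%N -> `|S n w| <= maximal m w.
Proof.
by move=> nm; rewrite -ltnS in nm; exact: (le_bigmax _ (fun i : 'I__ => `|S i w|) (Ordinal nm)).
Qed.

Let maximal_ge0 m w : 0 <= maximal m w.
Proof. exact: le_trans (maximal_ge w (leq0n _)). Qed.

Let maximal_bound m : L1 (maximal m) /\
  Ex (maximal m) <= C * m.+1%:R * 2 `^ (m%:R * (eta + p^-1)).
Proof.
have [kappa k1 ck] := decay_square_sum A0 s2 cdec.
pose fp N k := finite_product xi c (@two_sided N) (Posz k).
have ifp N k : L1 (fp N k).
  exact: (L1_finite_product xi_iid HK q12 k1 ck (Posz k) (@two_sided_inj N)).
pose X N w := \big[Num.max/0]_(n < (2 ^ m).+1)
  `|\sum_(1 <= k < n.+1) (fp N k w - Ex (fp N k))|.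
have X0 N w : 0 <= X N w.
  rewrite /X; elim/big_rec: _ => // i x _ x0; by rewrite le_max x0 orbT.
have mX N : measurable_fun [set: T] (X N).
  apply: measurable_bigmax => n; apply: measurableT_comp => //.
  apply: (L1_measurable (P := P)); apply: L1_sum => k _; apply: L1B => //; exact: L1_cst.
have [||||iY EY] := @L1_limit _ _ _ P X (maximal m) (C * m.+1%:R * 2 `^ (m%:R * (eta + p^-1))).
- move=> N; have [g [ig _ gX]] := finite_bound N m.
  apply: L1_le ig => // w; rewrite ger0_norm//.
  apply: bigmax_le => [|n _]; last by apply: gX; rewrite -ltnS.
  exact: le_trans (gX w 0%N _).
- move=> N; have [g [ig Eg gX]] := finite_bound N m.
  have Xg w : `|X N w| <= g w.
    rewrite ger0_norm//; apply: bigmax_le => [|n _]; last by apply: gX; rewrite -ltnS.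
    exact: le_trans (gX w 0%N _).
  apply: le_trans Eg; apply: Ex_le => //; apply: L1_abs; exact: L1_le Xg ig.
- apply: measurable_bigmax => n; apply: measurableT_comp => //.
  apply: measurable_sum => k; apply: measurable_funB => //.
  exact: measurable_process_product.
- apply: filterS (ae_finite_product_cvg xi_iid HK A0 (fun=> s2) cdec) => w cw.
  apply: cvg_bigmax => n; apply: cvg_norm; apply: cvg_bigsum => k; apply: cvgB; first exact: cw.
  rewrite -(Ex_process_product xi_iid HK q12 A0 s2 cdec (Posz k)).
  exact: (Ex_finite_product_cvg xi_iid HK q12 A0 s2 cdec).
split => //; apply: le_trans EY; rewrite le_eqVlt; apply/orP; left; apply/eqP.
by congr Ex; apply/funext => w; rewrite ger0_norm.
Qed.

Let x : R := 2 `^ eta.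

Lemma finite_bound_cvg : normalized_sums_to_0 c xi p.
Proof.
have x0 : 0 < x by exact: powR_gt0.
have x1 : x < 1.
  have : 1 `^ (- eta) < 2 `^ (- eta) :> R.
    by apply: gt0_ltr_powR; rewrite ?oppr_gt0 ?nnegrE ?ler0n ?ltr1n.
  by rewrite powR1 powRN invf_gt1.
pose G m w := 2 `^ (- (m%:R / p)) * maximal m w.
have G0 m w : 0 <= G m w by rewrite mulr_ge0 ?powR_ge0.
have H : {ae P, forall w, forall e : R, 0 < e -> exists M, forall n, (M <= n)%N ->
     \sum_(M <= m < n) G m w <= e}.
  apply: (@ae_L1_series_tail _ _ _ P G (fun m => C * m.+1%:R * x ^+ m)).
  - by move=> m; apply/L1Z/(maximal_bound m).1.
  - exact: G0.
  - move=> m; rewrite ExZ ?(maximal_bound m).1//.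
    apply: le_trans (ler_wpM2l (powR_ge0 _ _) (maximal_bound m).2) _.
    rewrite mulrCA ler_wpM2l ?mulr_ge0// -powRD ?pnatr_eq0 ?implybT//.
    rewrite /x -powR_mulrn ?powR_ge0// -powRrM le_eqVlt; apply/orP; left; apply/eqP.
    by congr (_ `^ _); ring.
  - by apply: cvg_series_geometric_poly => //; rewrite x0.
rewrite /normalized_sums_to_0; apply: filterS H => w tail; rewrite expectation_Ex.
apply/cvgrPdist_le => e e0.
have c0 : 0 < 2 `^ p^-1 :> R by exact: powR_gt0.
have [M HM] := tail (e / 2 `^ p^-1) (divr_gt0 e0 c0).
exists (2 ^ M)%N => // n /= Mn.
have n0 : (0 < n)%N by apply: leq_trans Mn; rewrite expn_gt0.
(* [n] is compared with the next power [2 ^ j.+1]; the loss is the factor [2 ^ (1 / p)] by which [e]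
   was divided above. *)
have /andP[jn nj] := trunc_log_bounds (ltnSn 1) n0; set j := trunc_log 2 n in jn nj.
have Mj : (M <= j)%N by rewrite /j; exact: trunc_log_max.
have GM : G j.+1 w <= e / 2 `^ p^-1.
  apply: le_trans (HM j.+2 _); last by lia.
  by rewrite big_nat_recr ?(leq_trans Mj)//= lerDr sumr_ge0.
rewrite sub0r normrN normrM ger0_norm ?powR_ge0// -/(S n w).
apply: (@le_trans _ _ (2 `^ p^-1 * G j.+1 w)); last by rewrite -ler_pdivlMl// mulrC.
rewrite /G mulrA; apply: ler_pM; rewrite ?powR_ge0//; last exact/maximal_ge/ltnW.
rewrite -powRD ?pnatr_eq0 ?implybT//.
have -> : p^-1 - j.+1%:R / p = - (j%:R / p) by rewrite -natr1; ring.
rewrite !powRN lef_pV2 ?posrE ?powR_gt0 ?ltr0n//.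
rewrite powRrM ge0_ler_powR ?nnegrE ?invr_ge0 ?powR_ge0 ?(ltW p0)//.
by rewrite powR_mulrn// -natrX ler_nat.
Qed.

End AlmostSureConvergence.

(** * Consequences of the tail and decay conditions *)

Section WeakTail.
Context d (T : measurableType d) (R : realType) (P : probability T R).

Lemma Ex_indic A : measurable A -> L1 P (\1_A : T -> R) /\ (Ex P (\1_A : T -> R))%:E = P A.
Proof.
move=> mA; have i1 : L1 P (\1_A : T -> R).
  apply: (L1_le (Y := fun=> 1)); last exact: L1_cst.
    exact: measurable_indic.
  by move=> w; rewrite ger0_norm ?indicE ?ler0n// lern1 leq_b1.
by split => //; rewrite -ExE// integral_indic ?setIT.
Qed.

(** The event [2 ^+ j < W] enters with weight [(2 ^+ j.+1) ^ q] and probability at most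
    [C * (2 ^+ j) ^ (- a)], which gives a geometric series of ratio [2 ^ (q - a)]. Cutting [W] off
    at [2 ^+ n] keeps everything bounded until the limit is taken. *)
Lemma weak_tail_moment (W : T -> R) (C a q : R) :
  measurable_fun [set: T] W -> (forall w, 0 <= W w) -> 0 <= C -> 0 < q -> q < a ->
  (forall t, 1 <= t -> ((t `^ a)%:E * P [set w | (t < W w)%R] <= C%:E)%E) ->
  L1 P (fun w => W w `^ q).
Proof.
move=> mW W0 C0 q0 qa tail.
pose x : R := 2 `^ (q - a).
have x0 : 0 < x by exact: powR_gt0.
have x1 : x < 1.
  have : 1 `^ (a - q) < 2 `^ (a - q) :> R.
    by apply: gt0_ltr_powR; rewrite ?subr_gt0 ?nnegrE ?ler0n ?ltr1n.
  by rewrite powR1 -[a - q]opprB powRN invf_gt1// powR_gt0.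
pose A j := [set w | (2 ^+ j < W w)%R].
have mA j : measurable (A j).
  by rewrite -[A j]setTI; exact: measurable_fun_ltr.
pose X n w := Num.min (W w) (2 ^+ n) `^ q.
have p0 n : (0 : R) < 2 ^+ n by exact: exprn_gt0.
have m0 n w : 0 <= Num.min (W w) (2 ^+ n) by rewrite le_min W0 ltW.
pose b j : R := (2 ^+ j.+1) `^ q.
have Xb n w : X n w <= 1 + \sum_(j < n) b j * \1_(A j) w.
  elim: n => [|n IH]; rewrite /X.
    rewrite big_ord0 addr0 expr0 -[leRHS](_ : 1 `^ q = 1); last by rewrite powR1.
    by apply: ge0_ler_powR; rewrite ?(ltW q0) ?nnegrE// ?ge_min ?lexx ?orbT// (m0 0%N).
  rewrite big_ord_recr /= addrA; have [Wn|nW] := leP (W w) (2 ^+ n).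
    have Wn1 : W w <= 2 ^+ n.+1 by apply: le_trans Wn _; rewrite ler_eXn2l ?ltr1n.
    rewrite min_l//; move: IH; rewrite /X min_l// => IH; apply: le_trans IH _.
    by rewrite lerDl mulr_ge0 ?powR_ge0// indicE ler0n.
  rewrite indicE mem_set// mulr1; apply: (@le_trans _ _ (b n)).
    by apply: ge0_ler_powR; rewrite ?(ltW q0) ?nnegrE ?m0 ?(ltW (p0 _))// ge_min lexx orbT.
  rewrite lerDr addr_ge0// sumr_ge0// => j _.
  by rewrite mulr_ge0 ?powR_ge0// indicE ler0n.
have iS n : L1 P (fun w => 1 + \sum_(j < n) b j * \1_(A j) w).
  apply: L1D; first exact: L1_cst.
  by apply: L1_sum => j _; apply: L1Z; exact: (Ex_indic (mA j)).1.
have mX n : measurable_fun [set: T] (X n).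
  by apply: (measurableT_comp (measurable_powR q)); apply: measurable_minr.
have X0 n w : 0 <= X n w by exact: powR_ge0.
have XB n : Ex P (fun w => `|X n w|) <= 1 + C * 2 `^ q * (1 - x)^-1.
  apply: (@le_trans _ _ (Ex P (fun w => 1 + \sum_(j < n) b j * \1_(A j) w))).
    apply: Ex_le => //; last by move=> w; rewrite ger0_norm.
    apply: L1_abs; apply: L1_le (iS n) => // w; by rewrite ger0_norm.
  rewrite ExD; [|exact: L1_cst|by apply: L1_sum => j _; apply: L1Z; exact: (Ex_indic (mA j)).1].
  rewrite Ex_cst lerD2l Ex_sum => [|j _]; last by apply: L1Z; exact: (Ex_indic (mA j)).1.
  apply: (@le_trans _ _ (\sum_(j < n) C * 2 `^ q * x ^+ j)).
    apply: ler_sum => j _; have [i E] := Ex_indic (mA j); rewrite ExZ//.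
    have := tail (2 ^+ j) (exprn_ege1 j _); rewrite ler1n => /(_ isT).
    rewrite -/(A j) -E -EFinM lee_fin => t; rewrite /b.
    have -> : (2 ^+ j.+1) `^ q = 2 `^ q * x ^+ j * (2 ^+ j) `^ a :> R.
      rewrite /x -!powR_mulrn ?powR_ge0// -!powRrM -!powRD ?pnatr_eq0 ?implybT//.
      by congr (_ `^ _); rewrite -natr1; ring.
    rewrite -[leLHS]mulrA (_ : C * 2 `^ q * x ^+ j = 2 `^ q * x ^+ j * C); last by ring.
    by rewrite ler_wpM2l ?mulr_ge0 ?powR_ge0 ?exprn_ge0 ?(ltW x0).
  rewrite -mulr_sumr ler_wpM2l ?mulr_ge0 ?powR_ge0//.
  have nx : 0 < 1 - x by lra.
  rewrite -(ler_pM2l nx) divff ?gt_eqF// -[1 - x]opprB mulNr -subrX1 opprB.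
  by rewrite lerBlDr lerDl exprn_ge0// ltW.
have [|||//] := L1_limit (P := P) (X := X) (Y := fun w => W w `^ q) _ XB.
- move=> n; apply: L1_le (iS n) => // w; by rewrite ger0_norm.
- exact: (measurableT_comp (measurable_powR q)).
- apply: aeW => w; apply: cvg_near_cst.
have [N WN] : exists N, W w <= 2 ^+ N.
  exists (Num.bound (W w)); apply: le_trans (ltW (archi_boundP (W0 w))) _.
  by rewrite -natrX ler_nat ltnW// ltn_expl.
exists N => // n /= Nn; rewrite /X min_l//; apply: le_trans WN _.
by rewrite ler_eXn2l ?ltr1n.
Qed.

End WeakTail.

(** [B] is enumerated before its complement. This puts an arbitrary block into the form used by the
    tail condition, which speaks of the first values of a permutation. *)
Lemma perm_initial_segment s (B : {set 'I_s}) :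
  exists pi : 'S_s, forall j, (pi j \in B) = (j < #|B|)%N.
Proof.
pose l := enum B ++ enum (~: B)%SET.
have sl : size l = s by rewrite size_cat -!cardE finset.cardsC card_ord.
have ul : uniq l.
  rewrite cat_uniq !enum_uniq andbT /=; apply/hasPn => r.
  by rewrite !mem_enum inE.
pose f (j : 'I_s) := nth j l j.
have finj : injective f.
  move=> i j; rewrite /f (set_nth_default j) ?sl// => /eqP.
  by rewrite nth_uniq ?sl// => /eqP/ord_inj.
exists (perm finj) => j; rewrite permE /f nth_cat -cardE.
case: ltnP => jB; first by rewrite -mem_enum mem_nth// -cardE.
have : nth j (enum (~: B)%SET) (j - #|B|) \in enum (~: B)%SET.
  by rewrite mem_nth// -cardE -(ltn_add2l #|B|) subnKC// finset.cardsC card_ord.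
by rewrite mem_enum inE => /negbTE.
Qed.

Section Moments.
Context d (T : measurableType d) (R : realType) (P : probability T R) (s : nat)
  (xi : int -> {RV P >-> s.-tuple R}) (alpha0 : R).
Local Notation L1 := (L1 P).
Local Notation L2 := (L2 P).
Local Notation Ex := (Ex P).
Context (xi_mean : forall r, ('E_P[fun w => tnth (xi 1 w) r] = 0)%E)
  (xi_reg : forall r, ('E_P[fun w => (`|tnth (xi 1 w) r| ^+ maxn s 2)%R] < +oo)%E)
  (alpha0_gt1 : 1 < alpha0) (xi_tail : tail_condition xi alpha0).
Implicit Types B : {set 'I_s}.

Let mzeta B : measurable_fun [set: T] (fun w => zeta B (xi 1 w)).
Proof. by apply: measurableT_comp => //; exact: measurable_zeta. Qed.
Let mcoord r : measurable_fun [set: T] (fun w => tnth (xi 1 w) r).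
Proof.
by apply: (measurableT_comp (f := fun x : s.-tuple R => tnth x r)) => //; exact: measurable_tnth.
Qed.

Let L1_coord_pow r : L1 (fun w => `|tnth (xi 1 w) r| ^+ maxn s 2).
Proof.
apply/integrableP; split.
  by apply/measurable_EFinP; apply: measurable_funX; exact: measurableT_comp.
apply: le_lt_trans (xi_reg r); rewrite unlock le_eqVlt; apply/orP; left; apply/eqP.
by apply: eq_integral => w _ /=; rewrite ger0_norm ?exprn_ge0.
Qed.

Let light_sq B : ~~ heavy B -> L2 (fun w => zeta B (xi 1 w)).
Proof.
move=> lB; split => //.
have B2 : (2 * #|B| <= maxn s 2)%N by move: lB; rewrite /heavy; lia.
apply: (L1_le (Y := fun w => 1 + \sum_r `|tnth (xi 1 w) r| ^+ maxn s 2)).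
- exact: measurable_funX.
- move=> w; rewrite ger0_norm ?sqr_ge0//.
  (* The maximum includes 1 so that the powers of [y] increase with the exponent:
     [2 * #|B| <= maxn s 2] then brings in the moment of the regularity condition. *)
  pose y := \big[Num.max/1]_r `|tnth (xi 1 w) r|.
  have y1 : 1 <= y by exact: bigmax_ge_id.
  have yr r : `|tnth (xi 1 w) r| <= y by exact: le_bigmax.
  apply: (@le_trans _ _ (y ^+ maxn s 2)).
    rewrite -(real_normK (num_real _)) /zeta normr_prod.
    apply: (@le_trans _ _ ((y ^+ #|B|) ^+ 2)).
      rewrite lerXn2r ?nnegrE ?prodr_ge0 ?exprn_ge0 ?(le_trans ler01)//.
      rewrite -prodr_const; apply: ler_prod => r _; by rewrite normr_ge0 yr.
    by rewrite -exprM mulnC; apply: ler_weXn2l.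
  rewrite /y; elim/big_ind: _ => [|u v IHu IHv|r _].
  + by rewrite expr1n lerDl sumr_ge0// => r _; rewrite exprn_ge0.
  + by rewrite maxEle; case: ifP.
  + rewrite (bigD1 r)//= addrCA lerDl addr_ge0//.
    by apply: sumr_ge0 => r' _; exact: exprn_ge0.
- by apply: L1D; [exact: L1_cst|apply: L1_sum => r _; exact: L1_coord_pow].
Qed.

(** A heavy block has [s - i] elements with [i] in the range of the tail condition. Since
    [alpha_i >= alpha0] and [t >= 1], the single exponent [alpha0] serves all heavy blocks. *)
Let heavy_tail B : heavy B -> exists2 C, 0 <= C &
  forall t, 1 <= t -> ((t `^ alpha0)%:E * P [set w | (t < `|zeta B (xi 1 w)|)%R] <= C%:E)%E.
Proof.
move=> /andP[B1 B2]; have [pi piB] := perm_initial_segment B.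
have Bs : (#|B| <= s)%N by rewrite -[leqRHS](card_ord s) max_card.
pose i := (s - #|B|)%N.
have iB : (s - i)%N = #|B| by rewrite /i subKn.
have ii : i \in index_iota 0 (s.-1)./2.+1 by rewrite mem_index_iota /= /i; lia.
have tfin : (tail_sup xi alpha0 pi i < +oo)%E.
  apply: le_lt_trans xi_tail.
  apply: le_trans (le_bigmax _ (fun pi : 'S_s => \big[maxe/-oo%E]_(0 <= i < (s.-1)./2.+1)
     tail_sup xi alpha0 pi i) pi).
  exact: (le_bigmax_seq _ _ xpredT (fun j => tail_sup xi alpha0 pi j) ii).
have ae : alpha0 <= tail_exponent s alpha0 i.
  rewrite /tail_exponent iB ler_peMl ?(le_trans ler01 (ltW alpha0_gt1))//.
  by rewrite ler_pdivlMr ?mul1r ?ler_nat// ltr0n; lia.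
have sup t : 1 <= t -> ((t `^ alpha0)%:E * P [set w | (t < `|zeta B (xi 1 w)|)%R]
    <= tail_sup xi alpha0 pi i)%E.
  move=> t1; apply: (@le_trans _ _ ((t `^ tail_exponent s alpha0 i)%:E *
     P [set w | (t < `|zeta B (xi 1 w)|)%R])%E).
    by rewrite lee_wpmul2r// lee_fin ler_powR.
  apply: ereal_sup_ubound; exists t => /=; first by rewrite in_itv /= t1.
  congr (_ * P _)%E; apply/seteqP; rewrite iB /zeta.
  have e w : \prod_(j < s | (j < #|B|)%N) `|tnth (xi 1 w) (pi j)| =
      `|\prod_(r in B) tnth (xi 1 w) r|.
    rewrite normr_prod [RHS](reindex_inj (@perm_inj _ pi)) /=; apply: eq_bigl => j; by rewrite piB.
  by split => w /=; rewrite e.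
exists (fine (tail_sup xi alpha0 pi i)) => [|t t1].
  by apply: fine_ge0; apply: le_trans (sup 1 (lexx _)); rewrite mule_ge0// lee_fin powR_ge0.
rewrite fineK ?sup// fin_numElt tfin andbT; apply: lt_le_trans (sup 1 (lexx _)).
by rewrite (lt_le_trans (ltNyr 0))// mule_ge0// lee_fin powR_ge0.
Qed.

(** For [s = 1] no block is heavy, so [q] is not tied to [alpha0]; this is why [alpha0] is absent
    from the bound on [p] in that case. The constant is 1 plus the sum of all these moments over all
    blocks. *)
Lemma moments_exist q : 1 < q < 2 -> (q < alpha0) || (s == 1)%N ->
  exists K, moments P (xi 1) K q.
Proof.
move=> /andP[q1 q2] qa; have q0 : 0 < q by exact: lt_trans q1.
have hq B : heavy B -> L1 (fun w => `|zeta B (xi 1 w)| `^ q).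
  move=> hB; have {}qa : q < alpha0.
    case/orP: qa => // /eqP s1; move: hB => /andP[B1 _].
    have : (#|B| <= s)%N by rewrite -[leqRHS](card_ord s) max_card.
    by move: B1; lia.
  have [C C0 tl] := heavy_tail hB.
  by apply: weak_tail_moment tl => //; exact: measurableT_comp.
have iz B : L1 (fun w => zeta B (xi 1 w)).
  case: (boolP (heavy B)) => hB; last exact/L2_L1/light_sq.
  apply: L1_le (L1D (L1_cst P 1) (hq B hB)) => // w.
  have [z1|z1] := leP `|zeta B (xi 1 w)| 1; first by rewrite ler_wpDr ?powR_ge0.
  by rewrite ler_wpDl// le1r_powR ?(ltW z1) ?(ltW q1).
pose k B := Ex (fun w => `|zeta B (xi 1 w)|) + (Ex (fun w => zeta B (xi 1 w) ^+ 2) +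
   Ex (fun w => `|zeta B (xi 1 w)| `^ q)).
have a0 B : 0 <= Ex (fun w => `|zeta B (xi 1 w)|) by exact: Ex_ge0.
have b0 B : 0 <= Ex (fun w => zeta B (xi 1 w) ^+ 2) by apply: Ex_ge0 => w; exact: sqr_ge0.
have c0 B : 0 <= Ex (fun w => `|zeta B (xi 1 w)| `^ q).
  by apply: Ex_ge0 => w; exact: powR_ge0.
have k0 B : 0 <= k B by rewrite /k !addr_ge0.
have kK B : k B <= 1 + \sum_(B : {set 'I_s}) k B.
  by rewrite (bigD1 B)//= addrCA lerDl addr_ge0// sumr_ge0.
exists (1 + \sum_(B : {set 'I_s}) k B); split.
- by rewrite lerDl sumr_ge0.
- move=> B; split => //; apply: le_trans (kK B); rewrite lerDl addr_ge0//.
- move=> B lB; split; first exact: light_sq.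
  by apply: le_trans (kK B); rewrite /k addrCA lerDl addr_ge0.
- move=> B hB; split; first exact: hq.
  by apply: le_trans (kK B); rewrite /k addrA lerDr addr_ge0.
- move=> r; have := xi_mean r; rewrite unlock => E.
  transitivity (Ex (fun w => tnth (xi 1 w) r)).
    by congr Ex; apply/funext => w; rewrite /zeta big_set1.
  by rewrite /Ex /Rintegral E.
Qed.

End Moments.

Section PolynomialDecay.
Context (R : realType) (s : nat) (c : int -> 'I_s -> R).

Lemma decay_condition_brak (sigma : 'I_s -> R) : (forall r, 0 < sigma r <= 1) ->
  decay_condition c sigma ->
  exists2 A, 0 < A & forall l r, `|c l r| <= A * brak R l `^ (- sigma r).
Proof.
move=> sig dec.
pose E r := ereal_sup [set (`|l%:~R : R| `^ sigma r * `|c l r|)%R%:E | l in [set: int]].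
have El r l : ((`|l%:~R : R| `^ sigma r * `|c l r|)%:E <= E r)%E.
  by apply: ereal_sup_ubound; exists l.
have Ef r : E r \is a fin_num.
  rewrite fin_numElt dec andbT; apply: lt_le_trans (El r 0).
  exact: ltNyr.
(* The decay condition gives no control of [c 0 r], which is added separately; the factor 2 pays for
   replacing [|l|] by [|l| + 1]. *)
pose k r := 2 * fine (E r) + `|c 0 r|.
have E0 r : 0 <= fine (E r).
  by rewrite -lee_fin fineK//; apply: le_trans (El r 0); rewrite lee_fin mulr_ge0 ?powR_ge0.
have k0 r : 0 <= k r by rewrite addr_ge0 ?mulr_ge0.
have kA r : k r <= 1 + \sum_r k r.
  by rewrite (bigD1 r)//= addrCA lerDl addr_ge0// sumr_ge0.
exists (1 + \sum_r k r) => [|l r]; first by rewrite ltr_pwDl// sumr_ge0.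
have /andP[s0 s1] := sig r.
have b0 := brak_gt0 R l; have bp : 0 < brak R l `^ sigma r by exact: powR_gt0.
rewrite powRN ler_pdivlMr//; apply: le_trans (kA r).
have [->|l0] := eqVneq l 0.
  by rewrite /brak absz0 powR1 mulr1 /k lerDr mulr_ge0.
rewrite /k; apply: (@le_trans _ _ (2 * fine (E r))); last by rewrite lerDl.
have := El r l; rewrite -(fineK (Ef r)) lee_fin => Elr.
apply: (@le_trans _ _ (2 * (`|l%:~R : R| `^ sigma r * `|c l r|))); last by rewrite ler_wpM2l.
rewrite mulrA mulrC ler_wpM2r//.
have l1 : 1 <= `|l%:~R : R| by rewrite -intr_norm ler1z; lia.
apply: (@le_trans _ _ ((2 * `|l%:~R : R|) `^ sigma r)).
  apply: ge0_ler_powR; rewrite ?(ltW s0) ?nnegrE ?(ltW b0) ?mulr_ge0//.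
  by rewrite /brak -natr1 natr_absz intr_norm; lra.
by rewrite powRM// ler_wpM2r ?powR_ge0// ler1_powR// ler1n.
Qed.

Context (A : R) (A0 : 0 < A).

Lemma decay_weaken (sigma tau : 'I_s -> R) : (forall r, tau r <= sigma r) ->
  (forall l r, `|c l r| <= A * brak R l `^ (- sigma r)) ->
  forall l r, `|c l r| <= A * brak R l `^ (- tau r).
Proof.
move=> ts dec l r; apply: le_trans (dec l r) _; rewrite ler_wpM2l ?(ltW A0)//.
by apply: ler_powR; rewrite ?brak_ge1// lerN2.
Qed.

Context (tau : 'I_s -> R) (tau12 : forall r, 2^-1 < tau r < 1)
  (dec : forall l r, `|c l r| <= A * brak R l `^ (- tau r)).

Lemma correlation_bound : exists2 G, 0 <= G & forall r r' h (S : seq int), uniq S ->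
  \sum_(x <- S) `|c x r| * `|c (x + h) r'| <= G * brak R h `^ (1 - tau r - tau r').
Proof.
have /(@fin_all_exists _ (fun=> R))[C HC] (j : 'I_s * 'I_s) : exists C, 0 < C /\
    forall (S : seq int) h, uniq S -> \sum_(l <- S) brak R l `^ (- tau j.1) *
      brak R (l + h) `^ (- tau j.2) <= C * brak R h `^ (1 - tau j.1 - tau j.2).
  have /andP[a1 a2] := tau12 j.1; have /andP[b1 b2] := tau12 j.2.
  have a01 : 0 < tau j.1 < 1 by rewrite a2 andbT; move: a1; lra.
  have b01 : 0 < tau j.2 < 1 by rewrite b2 andbT; move: b1; lra.
  have ab : 1 < tau j.1 + tau j.2 by move: a1 b1; lra.
  by have [C C0 H] := sum_brak_conv a01 b01 ab; exists C.
have A2 : 0 <= A ^+ 2 by exact: sqr_ge0.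
exists (A ^+ 2 * \sum_j C j) => [|r r' h S uS].
  by rewrite mulr_ge0// sumr_ge0// => j _; rewrite ltW//; have [] := HC j.
apply: (@le_trans _ _ (\sum_(x <- S) A ^+ 2 * (brak R x `^ (- tau r) *
    brak R (x + h) `^ (- tau r')))).
  apply: ler_sum => x _.
  rewrite (_ : A ^+ 2 * _ =
    A * brak R x `^ (- tau r) * (A * brak R (x + h) `^ (- tau r'))); last by ring.
  by apply: ler_pM.
rewrite -mulr_sumr -[leRHS]mulrA ler_wpM2l//; apply: le_trans ((HC (r, r')).2 S h uS) _.
rewrite ler_wpM2r ?powR_ge0// (bigD1 (r, r'))//= lerDl sumr_ge0// => j _.
by rewrite ltW//; have [] := HC j.
Qed.

End PolynomialDecay.

Section WindowBounds.
Context (R : realType) (s : nat) (c : int -> 'I_s -> R) (A kappa beta : R)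
  (A0 : 0 < A) (kappa1 : 1 <= kappa)
  (ck : forall r (S : seq int), uniq S -> \sum_(l <- S) c l r ^+ 2 <= kappa ^+ 2)
  (beta12 : 1 < beta < 2).

Let pair_const_nneg : 0 <= pair_const s kappa.
Proof. by rewrite /pair_const mulr_ge0// exprn_ge0// (le_trans ler01). Qed.

Lemma window_bound_no_singleton :
  (forall l r, `|c l r| <= A * brak R l `^ (- ((3 - beta) / 2))) ->
  exists2 D, 0 <= D & forall (L : finType) (iota : L -> int) m n, injective iota ->
  \sum_(m <= k < m + n) \sum_(m <= k' < m + n)
    pair_sum (fun r l => `|shifted c iota k r l|) (fun r l => `|shifted c iota k' r l|)
      (fun f g => no_singleton f g && linked f g) <= D * n%:R `^ beta.
Proof.
(* With this common exponent the correlations decay like [brak h ^ (beta - 2)]; it lies strictly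
   between 1/2 and 1 because [1 < beta < 2]. *)
move=> dec; pose tau (r : 'I_s) : R := (3 - beta) / 2.
have tau12 r : 2^-1 < tau r < 1.
  by have /andP[? ?] := beta12; rewrite /tau; apply/andP; split; lra.
have [G G0 HG] := @correlation_bound _ _ c A tau tau12 dec.
have [Cw Cw0 HCw] := sum_brak_window beta12.
exists (pair_const s kappa * (s%:R * s%:R * G) * Cw) => [|L iota m n iinj].
  apply: mulr_ge0; last exact: ltW.
  by apply: mulr_ge0; [exact: pair_const_nneg|rewrite !mulr_ge0].
apply: (window_pair_sum_linked kappa1 ck iinj
  (gamma := fun r r' h => G * brak R h `^ (1 - tau r - tau r'))) => // r r' h.
by rewrite /tau (_ : 1 - _ - _ = beta - 2)//; lra.
Qed.

Lemma window_bound_even (sigma : 'I_s -> R) m0 : ~~ odd s ->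
  (forall r, 2^-1 < sigma r <= 1) -> (forall r r', r != r' -> m0 <= sigma r + sigma r') ->
  4 - 2 * m0 < beta ->
  (forall l r, `|c l r| <= A * brak R l `^ (- sigma r)) ->
  exists2 D, 0 <= D & forall (L : finType) (iota : L -> int) m n, injective iota ->
  \sum_(m <= k < m + n) \sum_(m <= k' < m + n)
    pair_sum (fun r l => `|shifted c iota k r l|) (fun r l => `|shifted c iota k' r l|)
      (fun f g => even_fibres f g && linked f g) <= D * n%:R `^ beta.
Proof.
move=> s_even sig pairs mb dec.
pose delta := Num.min (4^-1) ((beta - (4 - 2 * m0)) / 4).
have delta0 : 0 < delta by rewrite lt_min; apply/andP; split; lra.
have delta4 : delta <= 4^-1 by rewrite ge_min lexx.
have deltab : 4 * delta <= beta - (4 - 2 * m0).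
  have : delta <= (beta - (4 - 2 * m0)) / 4 by rewrite ge_min lexx orbT.
  lra.
(* Exponents strictly below 1 avoid the logarithm that the convolution has at exponent 1. Four of
   them lose at most [4 * delta] in total, which fits in the margin left by [beta]. *)
pose tau r := Num.min (sigma r) (1 - delta).
have tau12 r : 2^-1 < tau r < 1.
  have /andP[sr _] := sig r; rewrite lt_min sr /= gt_min; apply/andP; split; first lra.
  by apply/orP; right; lra.
have tau_ge r : sigma r - delta <= tau r.
  by have /andP[_ s1] := sig r; rewrite le_min; apply/andP; split; lra.
have tau_le r : tau r <= sigma r by rewrite ge_min lexx.
have dec' := decay_weaken A0 (fun r => tau_le r) dec.
have [G G0 HG] := @correlation_bound _ _ c A tau tau12 dec'.
have [Cw Cw0 HCw] := sum_brak_window beta12.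
exists (pair_const s kappa * (#|{: ('I_s * 'I_s) * ('I_s * 'I_s)}|%:R *
    (kappa ^+ 2 * kappa ^+ 2 + G ^+ 2 * Cw))) => [|L iota m n iinj].
  apply: mulr_ge0; first exact: pair_const_nneg.
  by rewrite mulr_ge0// addr_ge0// mulr_ge0 ?sqr_ge0 ?(ltW Cw0).
apply: (window_pair_sum_even kappa1 ck iinj
  (gamma := fun r r' h => G * brak R h `^ (1 - tau r - tau r'))) => //.
  exact: sqr_ge0.
move=> r1 r2 r1' r2' h r12 r12'.
rewrite mulrACA -expr2 ler_wpM2l ?sqr_ge0// -powRD ?(gt_eqF (brak_gt0 _ _)) ?implybT//.
apply: ler_powR; first exact: brak_ge1.
have := pairs _ _ r12; have := pairs _ _ r12'.
have := tau_ge r1; have := tau_ge r2; have := tau_ge r1'; have := tau_ge r2'.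
lra.
Qed.

End WindowBounds.

(** * Symmetry and conclusion *)

(** The combined fibres have total size 4, so an odd one that is not a singleton has size 3 and
    leaves a singleton elsewhere. Hence the bound for even fibres is available whenever [s = 2]. *)
Lemma no_singleton_even_fibres (L : finType) (f g : {ffun 'I_2 -> L}) :
  no_singleton f g -> even_fibres f g.
Proof.
move=> /forallP ns; apply/forallP => l; apply/negP => odd_l.
have := sum_card_fibre f; have := sum_card_fibre g.
rewrite (bigD1 l)//= [X in _ -> X = _ -> _](bigD1 l)//= => gl fl.
have : (\sum_(l' | l' != l) (#|fibre f l'| + #|fibre g l'|) = 1)%N.
  rewrite big_split /=; move: (ns l) odd_l gl fl.
  move: (\sum_(_ | _) #|fibre f _|)%N (\sum_(_ | _) #|fibre g _|)%N #|fibre f l| #|fibre g l|.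
  move=> u v a b ab1 ab gl fl; have : (a + b = 3)%N.
    have : (a + b < 5)%N by lia.
    by move: (a + b)%N ab1 ab => [|[|[|[|[|]]]]].
  lia.
move=> tot; have [l' ll' l'0] : exists2 l', l' != l & (0 < #|fibre f l'| + #|fibre g l'|)%N.
  apply/exists_inP; apply: contra_eqT tot; rewrite negb_exists_in => /forall_inP h.
  by rewrite big1// => l' /h; rewrite -eqn0Ngt => /eqP.
move/eqP: (ns l') tot l'0; rewrite (bigD1 l')//=.
move: (\sum_(_ | _) _)%N (#|fibre f l'| + #|fibre g l'|)%N => u v; lia.
Qed.

Section AeEqual.
Context d (T : measurableType d) (R : realType) (P : probability T R).

Lemma L1_ae_eq (X Y : T -> R) : L1 P X -> measurable_fun [set: T] Y ->
  {ae P, forall w, X w = Y w} -> L1 P Y /\ Ex P Y = Ex P X.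
Proof.
move=> iX mY XY.
have [|||iY _] := L1_limit (P := P) (X := fun=> X) (Y := Y)
  (B := Ex P (fun w => `|X w|)) (fun=> iX) => //.
  by apply: filterS XY => w ->; exact: cvg_cst.
split => //; have mB : measurable_fun [set: T] (fun w => Y w - X w).
  by apply: measurable_funB => //; exact: L1_measurable iX.
have [||_ E] := L1_limit (P := P) (X := fun _ _ => 0) (Y := fun w => Y w - X w) (B := 0)
   (fun=> L1_cst P 0) _ mB.
- by move=> n; rewrite normr0 Ex_cst.
- by apply: filterS XY => w ->; rewrite subrr; exact: cvg_cst.
apply/eqP; rewrite -subr_eq0 -ExB// -normr_le0.
by apply: le_trans E; apply: normr_Ex_le; exact: L1B.
Qed.

End AeEqual.

(** * Symmetric innovations *)

Section Parity.
Context d (T : measurableType d) (R : realType) (P : probability T R) (s : nat)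
  (x1 : {RV P >-> s.-tuple R}).
Local Notation L1 := (L1 P).
Local Notation Ex := (Ex P).
Context (K q : R) (HK : moments P x1 K q) (r0 : 'I_s)
  (equal_coords : {ae P, forall w r r', tnth (x1 w) r = tnth (x1 w) r'})
  (sym : symmetric_rv P (fun w => tnth (x1 w) r0)).

Let mx1 : measurable_fun [set: T] x1. Proof. exact: measurable_funPT. Qed.

Let Y w := tnth (x1 w) r0.

Let mY : measurable_fun [set: T] Y.
Proof.
by apply: (measurableT_comp (f := fun x : s.-tuple R => tnth x r0)) => //; exact: measurable_tnth.
Qed.

Let zeta_diag : {ae P, forall w, forall B, zeta B (x1 w) = Y w ^+ #|B|}.
Proof.
apply: filterS equal_coords => w eqw B.
by rewrite /zeta -prodr_const; apply: eq_bigr => r _; exact: eqw.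
Qed.

Let Ex_odd (h : R -> R) : measurable_fun [set: R] h -> (forall y, h (- y) = - h y) ->
  L1 (fun w => h (Y w)) -> Ex (fun w => h (Y w)) = 0.
Proof.
move=> mh hodd ih.
have mNY : measurable_fun [set: T] (fun w => - Y w) by exact: measurableT_comp.
have [_] := same_distribution_Ex mY mNY sym mh ih.
under [X in Ex X = _ -> _]eq_fun do rewrite hodd.
by rewrite ExN// => /eqP; rewrite eq_sym -addr_eq0 => /eqP; lra.
Qed.

Let trunc_mean_odd M (B : {set 'I_s}) : odd #|B| -> trunc_mean P x1 M B = 0.
Proof.
move=> oB; have mt : measurable_fun [set: R] (fun y => trunc M (y ^+ #|B|)).
  by apply: (measurableT_comp (measurable_trunc M)); exact: exprn_measurable.
have it : L1 (fun w => trunc M (zeta B (x1 w))).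
  have [_ /(_ B)[iz _] _ _ _] := HK.
  apply: (L1_le (Y := fun w => `|zeta B (x1 w)|)); last exact: L1_abs.
    apply: (measurableT_comp (measurable_trunc M)); exact: L1_measurable iz.
  by move=> w; exact: normr_trunc.
have [ih E] := L1_ae_eq (Y := fun w => trunc M (Y w ^+ #|B|)) it
  (measurableT_comp mt mY) (filterS (fun w h => congr1 (trunc M) (h B)) zeta_diag).
rewrite /trunc_mean -E; apply: (Ex_odd mt) => // y.
by rewrite exprNn -signr_odd oB expr1 mulN1r truncN.
Qed.

(** Almost surely the light variable of a block is a function [psi] of the common coordinate with
    the parity of the size of the block; for a heavy block of odd size this holds because its
    truncated mean is zero. The product for [B] and [B'] is then an odd function of a symmetric
    variable. *)
Lemma zeta_light_parity M : 1 <= M -> forall B B' : {set 'I_s}, odd (#|B| + #|B'|)%N ->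
  Ex (fun w => zeta_light P x1 M B (x1 w) * zeta_light P x1 M B' (x1 w)) = 0.
Proof.
move=> M1 B B' oBB'.
pose psi (D : {set 'I_s}) y := if heavy D then trunc_mean P x1 M D else y ^+ #|D|.
have mpsi D : measurable_fun [set: R] (psi D).
  rewrite /psi; case: heavy; first exact: measurable_cst.
  exact: exprn_measurable.
have psiN (D : {set 'I_s}) y : psi D (- y) = (-1) ^+ #|D| * psi D y.
  rewrite /psi; case: heavy; last exact: exprNn.
  case: (boolP (odd #|D|)) => oD; first by rewrite trunc_mean_odd// mulr0.
  by rewrite -signr_odd (negbTE oD) mul1r.
have [_ _ l2 _] := zeta_light_bound HK M1 mx1.
have iz := L2_L1M (l2 B) (l2 B').
have mh : measurable_fun [set: R] (fun y => psi B y * psi B' y) by exact: measurable_funM.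
have aeh : {ae P, forall w, zeta_light P x1 M B (x1 w) * zeta_light P x1 M B' (x1 w) =
    psi B (Y w) * psi B' (Y w)}.
  by apply: filterS zeta_diag => w h; rewrite /zeta_light /psi !h.
have [ih <-] := L1_ae_eq (Y := fun w => psi B (Y w) * psi B' (Y w)) iz (measurableT_comp mh mY) aeh.
apply: (Ex_odd mh) => // y; rewrite !psiN mulrACA -exprD -signr_odd oBB' expr1 mulN1r//.
Qed.

End Parity.

Section Assembly.
Context d (T : measurableType d) (R : realType) (P : probability T R) (s : nat)
  (xi : int -> {RV P >-> s.-tuple R}) (xi_iid : iid xi).
Local Notation L1 := (L1 P).
Local Notation Ex := (Ex P).
Context (K q : R) (HK : moments P (xi 1) K q) (q12 : 1 < q < 2).
Context (c : int -> 'I_s -> R) (A : R) (sigma : 'I_s -> R) (A0 : 0 < A)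
  (sig : forall r, 2^-1 < sigma r <= 1)
  (cdec : forall l r, `|c l r| <= A * brak R l `^ (- sigma r)).
Context (p : R) (p1 : 1 < p) (pq : p < q).

Let p0 : 0 < p. Proof. exact: lt_trans p1. Qed.

Definition uncorrelated_unless (adm : forall N, rel {ffun 'I_s -> 'I_N + 'I_N}) :=
  forall N M, 1 <= M -> forall f g, ~~ adm N f g ->
    let X l := xi (@two_sided N l) : T -> _ in
    Ex (fun w => block_prod X (zeta_light P (xi 1) M) f w *
                 block_prod X (zeta_light P (xi 1) M) g w) = 0 /\
    Ex (block_prod X (zeta_light P (xi 1) M) f) *
    Ex (block_prod X (zeta_light P (xi 1) M) g) = 0.

Let sigma0 : R := \big[Num.min/1]_r sigma r.

Let sigma0_half : 2^-1 < sigma0.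
Proof. by apply: lt_bigmin => [|r _]; [lra|have /andP[] := sig r]. Qed.

Let cdec0 l r : `|c l r| <= A * brak R l `^ (- sigma0).
Proof. by apply: (decay_weaken A0 _ cdec (tau := fun=> sigma0)) => r'; exact: bigmin_le. Qed.

Lemma cvg_of_uncorrelated (adm : forall N, rel {ffun 'I_s -> 'I_N + 'I_N}) (beta : R) :
  1 < beta -> beta < 2 / p -> uncorrelated_unless adm ->
  (forall kappa, 1 <= kappa ->
     (forall r (S : seq int), uniq S -> \sum_(l <- S) c l r ^+ 2 <= kappa ^+ 2) ->
   exists2 D, 0 <= D & forall N m n, \sum_(m <= k < m + n) \sum_(m <= k' < m + n)
     pair_sum (fun r l => `|shifted c (@two_sided N) k r l|)
              (fun r l => `|shifted c (@two_sided N) k' r l|)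
              (fun f g => adm N f g && linked f g) <= D * n%:R `^ beta) ->
  normalized_sums_to_0 c xi p.
Proof.
move=> b1 bp Hadm window.
have [kappa k1 ck] := decay_square_sum A0 sigma0_half cdec0.
have [D D0 HD] := window kappa k1 ck.
have b12 : 1 < beta < 2.
  by rewrite b1 (lt_le_trans bp)// ler_pdivrMr// ler_peMr// ltW.
have K1 : 1 <= K by case: HK.
have K0 : 0 <= K by exact: le_trans K1.
have kp0 : 0 <= kappa by exact: le_trans k1.
have C0 : 0 <= maximal_const s K kappa D.
  rewrite /maximal_const; apply: addr_ge0; [apply: addr_ge0 => //; apply: mulr_ge0|apply: mulr_ge0 => //].
  - by rewrite mulr_ge0// exprn_ge0.
  - by rewrite addr_ge0// window_heavy_const_ge0.
  - by rewrite mulr_ge0// mulr_ge0 ?exprn_ge0// (tail_const_ge0 HK).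
exact: (finite_bound_cvg xi_iid HK q12 A0 sigma0_half cdec0 p0 C0
  (decay_exponent_lt0 p1 pq bp) (finite_maximal_bound xi_iid HK q12 k1 ck p1 pq b12 bp D0 Hadm HD)).
Qed.

Let p2 : 1 < 2 / p.
Proof. by rewrite ltr_pdivlMr ?mul1r//; move: pq; case/andP: q12; lra. Qed.

Lemma uncorrelated_no_singleton : uncorrelated_unless (fun N => @no_singleton s _).
Proof.
move=> N M M1 f g fg X; apply: (block_prod_orthogonal (iid_prod xi_iid (@two_sided_inj N))) fg.
  exact: (zeta_light_bound HK M1 (measurable_xi xi 1)).
by move=> r; rewrite /zeta_light heavy1; case: HK.
Qed.

Lemma cvg_general tau : tau <= 1 -> (forall r, tau <= sigma r) -> p < 2 / (3 - 2 * tau) ->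
  normalized_sums_to_0 c xi p.
Proof.
move=> tau1 ts ptau; have t3 : 0 < 3 - 2 * tau by lra.
have tp : 3 - 2 * tau < 2 / p.
  by rewrite ltr_pdivlMr// mulrC -ltr_pdivlMr.
(* A midpoint: [beta] must leave room on both sides, above the growth exponent [3 - 2 * tau] of the
   variance and below [2 / p]. *)
pose beta := (Num.max 1 (3 - 2 * tau) + 2 / p) / 2.
have mp : Num.max 1 (3 - 2 * tau) < 2 / p by rewrite gt_max p2.
have m1 : 1 <= Num.max 1 (3 - 2 * tau) by rewrite le_max lexx.
have m2 : 3 - 2 * tau <= Num.max 1 (3 - 2 * tau) by rewrite le_max lexx orbT.
have b1 : 1 < beta by rewrite /beta; lra.
have bp : beta < 2 / p by rewrite /beta; lra.
have b2 : 3 - 2 * tau <= beta by rewrite /beta; lra.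
have b12 : 1 < beta < 2.
  by rewrite b1 (lt_le_trans bp)// ler_pdivrMr// ler_peMr// ltW.
apply: (cvg_of_uncorrelated b1 bp uncorrelated_no_singleton) => kappa k1 ck.
have [|D D0 HD] := @window_bound_no_singleton _ _ _ A _ _ k1 ck b12.
  apply: (decay_weaken A0 _ cdec (tau := fun=> (3 - beta) / 2)) => r.
  by apply: le_trans (ts r); lra.
by exists D => // N m n; apply: HD; exact: two_sided_inj.
Qed.

Lemma cvg_even m0 : ~~ odd s -> (forall r r', r != r' -> m0 <= sigma r + sigma r') ->
  p * (2 - m0) < 1 -> uncorrelated_unless (fun N => @even_fibres s _) ->
  normalized_sums_to_0 c xi p.
Proof.
move=> s_even pairs pm Hadm.
have tp : 4 - 2 * m0 < 2 / p by rewrite ltr_pdivlMr//; move: pm; lra.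
(* The maximum with 1 keeps [beta] above 1 when [m0] exceeds 3/2, where [4 - 2 * m0] drops below
   1. *)
pose beta := (Num.max 1 (4 - 2 * m0) + 2 / p) / 2.
have mp : Num.max 1 (4 - 2 * m0) < 2 / p by rewrite gt_max p2.
have m1 : 1 <= Num.max 1 (4 - 2 * m0) by rewrite le_max lexx.
have m2 : 4 - 2 * m0 <= Num.max 1 (4 - 2 * m0) by rewrite le_max lexx orbT.
have b1 : 1 < beta by rewrite /beta; lra.
have bp : beta < 2 / p by rewrite /beta; lra.
have b2 : 4 - 2 * m0 < beta by rewrite /beta; lra.
have b12 : 1 < beta < 2.
  by rewrite b1 (lt_le_trans bp)// ler_pdivrMr// ler_peMr// ltW.
apply: (cvg_of_uncorrelated b1 bp Hadm) => kappa k1 ck.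
have [D D0 HD] := window_bound_even A0 k1 ck b12 s_even sig pairs b2 cdec.
by exists D => // N m n; apply: HD; exact: two_sided_inj.
Qed.

Lemma uncorrelated_parity : (forall M, 1 <= M -> forall B B' : {set 'I_s},
    odd (#|B| + #|B'|)%N ->
    Ex (fun w => zeta_light P (xi 1) M B (xi 1 w) * zeta_light P (xi 1) M B' (xi 1 w)) = 0) ->
  uncorrelated_unless (fun N => @even_fibres s _).
Proof.
move=> par N M M1 f g fg X; apply: (block_prod_parity (iid_prod xi_iid (@two_sided_inj N))) fg.
  exact: (zeta_light_bound HK M1 (measurable_xi xi 1)).
exact: par.
Qed.

End Assembly.

Lemma normalized_sums_mono d (T : measurableType d) (R : realType) (P : probability T R)
    (s : nat) (xi : int -> {RV P >-> s.-tuple R}) (c : int -> 'I_s -> R) (p p' : R) :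
  0 < p -> p <= p' -> normalized_sums_to_0 c xi p' -> normalized_sums_to_0 c xi p.
Proof.
move=> p0 pp'; rewrite /normalized_sums_to_0; apply: filterS => w /cvgrPdist_le H.
apply/cvgrPdist_le => e e0; have [N _ HN] := H e e0.
exists N.+1 => // n /= Nn; have := HN n (ltnW Nn).
rewrite !sub0r !normrN !normrM !(ger0_norm (powR_ge0 _ _)); apply: le_trans.
rewrite ler_wpM2r// ler_powR ?ler1n ?(leq_ltn_trans _ Nn)//.
by rewrite lerN2 lef_pV2 ?posrE// (lt_le_trans p0).
Qed.

Lemma bigmine_EFin (R : realType) (I : finType) (Q : pred I) (F : I -> R) (i1 : I) : Q i1 ->
  exists2 i0, Q i0 & (\big[mine/+oo]_(i | Q i) (F i)%:E = (F i0)%:E)%E /\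
    forall i, Q i -> F i0 <= F i.
Proof.
move=> Q1; have [i0 Q0 F0] := arg_minP F Q1; exists i0 => //; split => //.
apply/eqP; rewrite eq_le; apply/andP; split; first exact: (bigmin_le_cond _ (fun i => (F i)%:E)).
by apply: le_bigmin => [|i Qi]; rewrite ?leey// lee_fin F0.
Qed.

(** At [m = 2] the inverse is [+oo] and the product is 0, so the multiplied form covers this case
    too. *)
Lemma lt_inve_sub (R : realType) (p m : R) : 0 < p -> m <= 2 ->
  (p%:E < (2 - m)%:E^-1)%E = (p * (2 - m) < 1).
Proof.
move=> p0 m2; have [->|m2'] := eqVneq m 2.
  by rewrite subrr inve0 ltry mulr0 ltr01.
have m0 : 0 < 2 - m by rewrite subr_gt0 lt_neqAle m2' m2.
by rewrite inver gt_eqF// lte_fin -[(2 - m)^-1]mul1r ltr_pdivlMr.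
Qed.

(** * Choice of the auxiliary exponents *)

Section Reduction.
Context (d : measure_display) (T : measurableType d) (R : realType)
    (P : probability T R) (s : nat)
    (xi : int -> {RV P >-> s.-tuple R}) (c : int -> 'I_s -> R)
    (alpha0 : R) (sigma : 'I_s -> R)
    (xi_iid : iid xi)
    (xi_mean : forall (l : int) (r : 'I_s),
       ('E_P[fun w => tnth (xi l w) r] = 0)%E)
    (xi_reg : forall r : 'I_s,
       ('E_P[fun w => (`|tnth (xi 1 w) r| ^+ maxn s 2)%R] < +oo)%E)
    (alpha0_gt1 : 1 < alpha0)
    (xi_tail : tail_condition xi alpha0)
    (sigma_range : forall r : 'I_s, 2^-1 < sigma r <= 1)
    (c_decay : decay_condition c sigma).

Let moments_of q : 1 < q < 2 -> (q < alpha0) || (s == 1)%N ->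
  exists K, moments P (xi 1) K q.
Proof. by move=> q12 qa; exact: (moments_exist (xi_mean 1) xi_reg alpha0_gt1 xi_tail q12 qa). Qed.

Let sigma01 r : 0 < sigma r <= 1.
Proof. by have /andP[s0 ->] := sigma_range r; rewrite andbT (lt_trans _ s0)// invr_gt0. Qed.

(** The estimates assume [p > 1]; a smaller exponent follows from a larger one that is still below
    the bound. *)
Let above1 (b p : R) : 1 < b -> 0 < p -> p < b ->
  (forall p', 1 < p' -> p' < b -> normalized_sums_to_0 c xi p') -> normalized_sums_to_0 c xi p.
Proof.
move=> b1 p0 pb H; pose p' := (Num.max 1 p + b) / 2.
have mb : Num.max 1 p < b by rewrite gt_max b1.
have m1 : 1 <= Num.max 1 p by rewrite le_max lexx.
have mp : p <= Num.max 1 p by rewrite le_max lexx orbT.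
apply: (@normalized_sums_mono _ _ _ _ _ _ _ _ p'); rewrite // /p'; first by lra.
by apply: H; lra.
Qed.

Let choose_moment (p : R) : 1 < p -> p < 2 -> (p < alpha0) || (s == 1)%N ->
  (forall K q A, moments P (xi 1) K q -> 1 < q < 2 -> p < q -> 0 < A ->
    (forall l r, `|c l r| <= A * brak R l `^ (- sigma r)) -> normalized_sums_to_0 c xi p) ->
  normalized_sums_to_0 c xi p.
Proof.
move=> p1 p2 pa H; have [A A0 cdec] := decay_condition_brak sigma01 c_decay.
pose b := if (s == 1)%N then 2 else Num.min alpha0 2.
have b2 : b <= 2 by rewrite /b; case: ifP => // _; rewrite ge_min lexx orbT.
have pb : p < b.
  by rewrite /b; case: (boolP (s == 1)%N) pa => // _; rewrite orbF lt_min => ->.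
pose q := (p + b) / 2.
have q12 : 1 < q < 2 by rewrite /q; apply/andP; split; lra.
have qa : (q < alpha0) || (s == 1)%N.
  case: (boolP (s == 1)%N) => s1; rewrite ?orbT// orbF.
  have : b <= alpha0 by rewrite /b (negbTE s1) ge_min lexx.
  by rewrite /q; lra.
have [K HK] := moments_of q12 qa.
by apply: (H K q A HK q12 _ A0 cdec); rewrite /q; lra.
Qed.

Lemma general_case tau p : 2^-1 < tau <= 1 -> (forall r, tau <= sigma r) -> 0 < p ->
  p < 2 / (3 - 2 * tau) -> (p < alpha0) || (s == 1)%N -> normalized_sums_to_0 c xi p.
Proof.
move=> /andP[t2 t1] ts p0 pt pa; have t3 : 0 < 3 - 2 * tau by lra.
pose b := if (s == 1)%N then 2 / (3 - 2 * tau) else Num.min alpha0 (2 / (3 - 2 * tau)).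
have bt : b <= 2 / (3 - 2 * tau) by rewrite /b; case: ifP => // _; rewrite ge_min lexx orbT.
have b1 : 1 < b.
  have t0 : 1 < 2 / (3 - 2 * tau) by rewrite ltr_pdivlMr ?mul1r//; lra.
  by rewrite /b; case: ifP => // _; rewrite lt_min alpha0_gt1.
have pb : p < b.
  by rewrite /b; case: (boolP (s == 1)%N) pa => // _; rewrite orbF lt_min pt andbT.
apply: (above1 b1 p0 pb) => p' p1 p'b.
have p't : p' < 2 / (3 - 2 * tau) by exact: lt_le_trans p'b bt.
have p'2 : p' < 2.
  by apply: lt_le_trans p't _; rewrite ler_pdivrMr//; lra.
have p'a : (p' < alpha0) || (s == 1)%N.
  case: (boolP (s == 1)%N) => s1; rewrite ?orbT// orbF.
  by apply: lt_le_trans p'b _; rewrite /b (negbTE s1) ge_min lexx.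
apply: choose_moment => // K q A HK q12 pq A0 cdec.
exact: (cvg_general xi_iid HK q12 A0 sigma_range cdec p1 pq t1 ts).
Qed.

Lemma even_case m p : ~~ odd s -> 1 < m <= 2 ->
  (forall r r', r != r' -> m <= sigma r + sigma r') ->
  (forall K q, moments P (xi 1) K q -> uncorrelated_unless xi (fun N => @even_fibres s _)) ->
  0 < p -> p < 2 -> p < alpha0 -> p * (2 - m) < 1 -> normalized_sums_to_0 c xi p.
Proof.
move=> s_even /andP[m1 m2] pairs par p0 p2 pa pm.
(* For [m = 2] the third constraint is void, and the value 2 is then neutral in the minimum. *)
pose b := Num.min (Num.min 2 alpha0) (if m == 2 then 2 else (2 - m)^-1).
have b12 : b <= 2 by rewrite /b ge_min ge_min lexx.
have ba : b <= alpha0 by rewrite /b !ge_min lexx orbT.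
have bm p' : 0 < p' -> p' < b -> p' * (2 - m) < 1.
  move=> p'0; rewrite /b !lt_min => /andP[_].
  have [->|m2'] := eqVneq m 2; first by rewrite subrr mulr0.
  have m0 : 0 < 2 - m by rewrite subr_gt0 lt_neqAle m2' m2.
  by rewrite -[(2 - m)^-1]mul1r ltr_pdivlMr.
have bP p' : p' < 2 -> p' < alpha0 -> p' * (2 - m) < 1 -> p' < b.
  move=> h1 h2 h3; rewrite /b !lt_min h1 h2 /=.
  have [//|m2'] := eqVneq m 2.
  have m0 : 0 < 2 - m by rewrite subr_gt0 lt_neqAle m2' m2.
  by rewrite -[(2 - m)^-1]mul1r ltr_pdivlMr.
have b1 : 1 < b by apply: bP => //; lra.
apply: (above1 b1 p0 (bP _ p2 pa pm)) => p' p1 p'b.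
have p'2 := lt_le_trans p'b b12; have p'a := lt_le_trans p'b ba.
apply: choose_moment => //; first by rewrite p'a.
move=> K q A HK q12 pq A0 cdec.
apply: (cvg_even xi_iid HK q12 A0 sigma_range cdec p1 pq s_even pairs _ (par K q HK)).
by apply: bm => //; exact: lt_trans p1.
Qed.

End Reduction.

Local Open Scope ring_scope.

Theorem theorem1 (d : measure_display) (T : measurableType d) (R : realType)
    (P : probability T R) (s : nat) (s_gt0 : (0 < s)%N)
    (xi : int -> {RV P >-> s.-tuple R}) (c : int -> 'I_s -> R)
    (alpha0 : R) (sigma : 'I_s -> R)
    (xi_iid : iid xi)
    (xi_mean : forall (l : int) (r : 'I_s),
       ('E_P[fun w => tnth (xi l w) r] = 0)%E)
    (xi_reg : forall r : 'I_s,
       ('E_P[fun w => (`|tnth (xi 1 w) r| ^+ maxn s 2)%R] < +oo)%E)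
    (alpha0_gt1 : 1 < alpha0)
    (xi_tail : tail_condition xi alpha0)
    (sigma_range : forall r : 'I_s, 2^-1 < sigma r <= 1)
    (c_decay : decay_condition c sigma) :
  (forall p : R, 0 < p -> (p%:E < p_bound alpha0 sigma)%E ->
     normalized_sums_to_0 c xi p) /\
  ({ae P, forall w, forall r r' : 'I_s,
      tnth (xi 1 w) r = tnth (xi 1 w) r'} ->
   symmetric_rv P (fun w => tnth (xi 1 w) (Ordinal s_gt0)) ->
   ~~ odd s ->
   forall p : R, 0 < p -> (p%:E < p_bound_symmetric alpha0 sigma)%E ->
     normalized_sums_to_0 c xi p).
Proof.
split=> [|equal_coords sym s_even] p p0.
  case: s s_gt0 xi c sigma xi_iid xi_mean xi_reg xi_tail sigma_range c_decay
    => [//|[|[|n]]] _ {}xi {}c {}sigma {}xi_iid {}xi_mean {}xi_reg {}xi_tail {}sigma_range {}c_decay.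
  - rewrite /= lte_fin => pb.
    apply: (general_case xi_iid xi_mean xi_reg alpha0_gt1 xi_tail sigma_range c_decay
      (sigma_range ord0) _ p0 pb); last by rewrite eqxx orbT.
    by move=> r; rewrite (ord1 r).
  - rewrite /= !lt_min !lte_fin => /andP[/andP[p2 pa]].
    have /andP[a0 a1] := sigma_range ord0; have /andP[b0 b1] := sigma_range ord_max.
    rewrite -addrA -opprD lt_inve_sub//; last by lra.
    apply: (even_case xi_iid xi_mean xi_reg alpha0_gt1 xi_tail sigma_range c_decay) => //.
    + by apply/andP; split; lra.
    + have ordE (r : 'I_2) : r = ord0 \/ r = ord_max.
        by case: r => [[|[|//]] ?]; [left|right]; exact: val_inj.
      by move=> r r'; case: (ordE r) => ->; case: (ordE r') => -> //; rewrite addrC.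
    + move=> K q HK N M M1 f g fg; apply: (uncorrelated_no_singleton xi_iid HK M1).
      by apply: contra fg; exact: no_singleton_even_fibres.
  - rewrite /= lt_min lte_fin => /andP[pa].
    have [i0 _ [-> imin]] := bigmine_EFin sigma (erefl : xpredT (ord0 : 'I_n.+3)).
    have /andP[t2 t1] := sigma_range i0.
    have t3 : 0 < 3 - 2 * sigma i0 by lra.
    rewrite -EFinM -EFinB inver gt_eqF// -EFinM lte_fin => pb.
    apply: (general_case xi_iid xi_mean xi_reg alpha0_gt1 xi_tail sigma_range c_decay
      (sigma_range i0) _ p0 pb); last by rewrite pa.
    by move=> r; exact: imin.
(* A positive even [s] is at least 2, so a pair of indices exists and the minimum is attained rather
   than equal to the neutral [+oo]. *)
have s1 : (1 < s)%N by clear -s_gt0 s_even; case: s s_gt0 s_even => [|[|]].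
rewrite /p_bound_symmetric !lt_min !lte_fin => /andP[/andP[p2 pa]].
have [ij ij_lt [-> imin]] := bigmine_EFin (fun ij : 'I_s * 'I_s => sigma ij.1 + sigma ij.2)
  (isT : (fun ij : 'I_s * 'I_s => (ij.1 < ij.2)%N) (Ordinal s_gt0, Ordinal s1)).
have /andP[a0 a1] := sigma_range ij.1; have /andP[b0 b1] := sigma_range ij.2.
rewrite -EFinB lt_inve_sub//; last by lra.
apply: (even_case xi_iid xi_mean xi_reg alpha0_gt1 xi_tail sigma_range c_decay) => //.
- by apply/andP; split; lra.
- move=> r r' rr'; case: (ltngtP r r') => [lt|lt|eq].
  + exact: (imin (r, r')).
  + by rewrite [leRHS]addrC; exact: (imin (r', r)).
  + by move: rr'; rewrite (ord_inj eq) eqxx.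
- move=> K q HK; apply: (uncorrelated_parity xi_iid HK) => M M1.
  exact: (zeta_light_parity HK equal_coords sym M1).
Qed.
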